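(* Let $R$ be a ring with involution as in the context, and let $(C,\phi)$ and $(C',\phi')$ be signed $n$-dimensional symmetric Poincaré complexes over $R$. Then: (1) (Additivity) $\tau^{NEW}(C\oplus C',\phi\oplus\phi')=\tau^{NEW}(C,\phi)+\tau^{NEW}(C',\phi')\in K_1(R)$. (2) (Duality) $\tau^{NEW}(C,\phi)=(-1)^n\tau^{NEW}(C,\phi)^*+\frac{n(n+1)}{2}\epsilon(\chi(C),\chi(C))\in K_1(R)$. (3) (Homotopy invariance) If $(f,\sigma)$ is a homotopy equivalence from $(C,\phi)$ to $(C',\phi')$, then $\tau^{NEW}(C',\phi')=\tau^{NEW}(C,\phi)+\tau^{NEW}(f)+(-1)^n\tau^{NEW}(f)^*\in K_1(R)$. (4) (Cobordism invariance) If $(C,\phi)$ is homotopy equivalent, by a homotopy equivalence with underlying chain equivalence $C\to\partial D$, to the boundary $(\partial D,\partial\phi^D)$ of a connected signed $(n+1)$-dimensional symmetric complex $(D,\phi^D)$, then $$\tau^{NEW}(C,\phi)=(-1)^{n+1}\tau^{NEW}(C\to\partial D)^*-\tau^{NEW}(C\to\partial D)+\tfrac12(n+1)(n+2)\,\epsilon(\chi(D),\chi(D))\in K_1(R).$$ (5) (Orientation change) $\tau^{NEW}(C,-\phi)=\tau^{NEW}(C,\phi)+\epsilon(\chi(C),\chi(C))\in K_1(R)$. (6) $\tau^{NEW}(C,\phi)$ is independent of the choice of sign $\eta_C$.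
   Context: $R$ is an associative ring with $1$ and involution such that the rank of f.g. free modules is well defined. All modules are based f.g. free $R$-modules; the dual $M^*=\mathrm{Hom}_R(M,R)$ is a based module via the involution and the dual basis, and $M^{**}$ is identified with $M$. An isomorphism $f$ of based modules has a torsion $\tau(f)\in K_1(R)$ (the class of its matrix); $\tau(f)^*=\tau(f^* )$ defines an involution on $K_1(R)$. For based modules $\epsilon(M,N)=\mathrm{rank}(M)\,\mathrm{rank}(N)\,\tau(-1)\in K_1(R)$, extended to $\epsilon(a,b)=ab\,\tau(-1)$ for integers $a,b$. Signed complexes. Chain complexes are bounded complexes of based f.g. free modules; $n$-dimensional means concentrated in degrees $0,\dots,n$ (the boundary complexes below may in addition be nonzero in degree $-1$ and in one degree above the nominal dimension; all formulas are read with indices in $\mathbb{Z}$). $\chi(C)=\sum_r(-1)^r\mathrm{rank}\,C_r$, $C_{odd}=\bigoplus_r C_{2r+1}$, $C_{even}=\bigoplus_r C_{2r}$, $(SC)_r=C_{r-1}$, $\beta(C,D)=\sum_{i>j}(\epsilon(C_{2i},D_{2j})-\epsilon(C_{2i+1},D_{2j+1}))$. A signed complex is a pair $(C,\eta_C)$ with $\eta_C\in\{0,\tau(-1)\}\subset K_1(R)$; $\eta_{SC}=-\eta_C$, $\eta_{C\oplus D}=\eta_C+\eta_D-\beta(C,D)+\epsilon(C_{odd},\chi(D))$. For a contractible signed complex with chain contraction $\Gamma$, $\tau^{NEW}(C)=\tau(d+\Gamma:C_{odd}\to C_{even})+\eta_C$. The mapping cone of $f:C\to D$ is $\mathcal{C}(f)_r=D_r\oplus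 C_{r-1}$, $d=\begin{pmatrix}d_D&(-1)^{r+1}f\\0&d_C\end{pmatrix}$, $\eta_{\mathcal{C}(f)}=\eta_{D\oplus SC}$; for a chain equivalence $f$ of signed complexes $\tau^{NEW}(f)=\tau^{NEW}(\mathcal{C}(f))\in K_1(R)$. Duals. Write $C^r=(C_r)^*$. $C^{n-*}$ is the complex with $(C^{n-*})_r=C^{n-r}$ and $d=(-1)^rd_C^*:C^{n-r}\to C^{n-r+1}$, with sign $\eta_{C^{n-*}}=(-1)^{n+1}\eta_C^*+(-1)^{n+1}\beta(C,C)^*+\alpha_n(C)$, where $\alpha_n(C)=\sum_{r\equiv n+2,n+3\,(\mathrm{mod}\,4)}\epsilon(C^r,C^r)$. $T:\mathrm{Hom}_R(C^p,D_q)\to\mathrm{Hom}_R(D^q,C_p)$ is $T\phi=(-1)^{pq}\phi^*$. Symmetric complexes. An $n$-dimensional symmetric complex $(C,\phi)$ is an $n$-dimensional chain complex $C$ with morphisms $\phi_s:C^{n-r+s}\to C_r$ ($s\ge0$) such that $d\phi_s+(-1)^r\phi_sd^*+(-1)^{n+s+1}(\phi_{s-1}+(-1)^sT\phi_{s-1})=0:C^{n-r+s-1}\to C_r$ ($s\geq 0$, $\phi_{-1}=0$); then $\phi_0:C^{n-*}\to C$ is a chain map. It is Poincaré if $\phi_0$ is a chain equivalence, and connected if $H_0(\phi_0:C^{n-*}\to C)=0$ (the zeroth homology of the mapping cone). It is signed if $C$ is signed. A morphism $(f,\sigma):(C,\phi)\to(C',\phi')$ is a chain map $f:C\to C'$ with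 morphisms $\sigma_s:C'^{\,n+1+s-r}\to C'_r$ ($s\ge0$, $\sigma_{-1}=0$) such that $\phi'_s-f\phi_sf^*=d\sigma_s+(-1)^r\sigma_sd^*+(-1)^{n+s}(\sigma_{s-1}+(-1)^sT\sigma_{s-1}):C'^{\,n-r+s}\to C'_r$; it is a homotopy equivalence if $f$ is a chain equivalence. The boundary of a connected $n$-dimensional symmetric complex $(C,\phi)$ is the $(n-1)$-dimensional symmetric Poincaré complex $(\partial C,\partial\phi)$ with $\partial C_r=C_{r+1}\oplus C^{n-r}$, $d_{\partial C}=\begin{pmatrix}d_C&(-1)^r\phi_0\\0&(-1)^rd_C^*\end{pmatrix}:\partial C_r\to\partial C_{r-1}$, $\partial\phi_0=\begin{pmatrix}(-1)^{n-r-1}T\phi_1&(-1)^{rn}\\1&0\end{pmatrix}:\partial C^{n-r-1}=C^{n-r}\oplus C_{r+1}\to\partial C_r$, and for $s\ge1$ $\partial\phi_s=\begin{pmatrix}(-1)^{n-r+s-1}T\phi_{s+1}&0\\0&0\end{pmatrix}:\partial C^{n-r+s-1}=C^{n-r+s}\oplus C_{r-s+1}\to\partial C_r$. It is given any choice of sign. The absolute torsion of a signed symmetric Poincaré complex is $\tau^{NEW}(C,\phi)=\tau^{NEW}(\phi_0:C^{n-*}\to C)\in K_1(R)$. *)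

(* Defs.v *)
From HB Require Import structures.
From mathcomp Require Import all_boot all_order all_algebra.
From mathcomp Require Import generic_quotient boolp zify.

Set Implicit Arguments.
Unset Strict Implicit.
Unset Printing Implicit Defensive.

Import Order.TTheory GRing.Theory Num.Theory.
Local Open Scope ring_scope.
Local Open Scope quotient_scope.

Section GL.
Variable R : pzRingType.

Definition mx_inverse n (A B : 'M[R]_n) := A *m B = 1%:M /\ B *m A = 1%:M.

Lemma mx_inverse_sym n (A B : 'M[R]_n) : mx_inverse A B -> mx_inverse B A.
Proof. by case. Qed.

Lemma mx_inverse_mul n (A A' B B' : 'M[R]_n) :
  mx_inverse A A' -> mx_inverse B B' -> mx_inverse (A *m B) (B' *m A').
Proof.
move=> [a1 a2] [b1 b2]; split.
  by rewrite mulmxA -(mulmxA A) b1 mulmx1.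
by rewrite mulmxA -(mulmxA B') a2 mulmx1.
Qed.

Lemma mx_inverse1 n : mx_inverse (1%:M : 'M[R]_n) 1%:M.
Proof. by split; rewrite mulmx1. Qed.

(* The stabilisation A (+) 1 : 'M_N of A : 'M_n, for n <= N. *)
Definition stab N n (A : 'M[R]_n) : 'M[R]_N :=
  \matrix_(i, j) match insub (val i), insub (val j) with
                 | Some i', Some j' => A i' j'
                 | _, _ => (i == j)%:R
                 end.

Let insub_ordN n k : (n <= k)%N -> insub k = None :> option 'I_n.
Proof. by move=> le; rewrite insubN // -leqNgt. Qed.

Lemma stabE n k (A : 'M[R]_n) : stab (n + k) A = block_mx A 0 0 1%:M.
Proof.
apply/matrixP => i j; rewrite !mxE.
case: splitP => i' ei; rewrite mxE; case: splitP => j' ej; rewrite ?mxE -?val_eqE /= ei ej.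
- by rewrite !valK.
- by rewrite valK insub_ordN ?leq_addr // ltn_eqF // (leq_trans (ltn_ord i')) ?leq_addr.
- by rewrite insub_ordN ?leq_addr // gtn_eqF // (leq_trans (ltn_ord j')) ?leq_addr.
- by rewrite insub_ordN ?leq_addr // eqn_add2l.
Qed.

Lemma stab_mul N n (A B : 'M[R]_n) :
  (n <= N)%N -> stab N (A *m B) = stab N A *m stab N B.
Proof.
move=> /subnKC <-; rewrite !stabE mulmx_block.
by rewrite !mulmx0 !mul0mx !addr0 !add0r mulmx1.
Qed.

Lemma stab1 N n : stab N (1%:M : 'M[R]_n) = 1%:M.
Proof.
apply/matrixP => i j; rewrite !mxE.
case: insubP => [i' _ ei|_] //; case: insubP => [j' _ ej|_] //.
by rewrite mxE -val_eqE /= ei ej.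
Qed.

Lemma stab_id n (A : 'M[R]_n) : stab n A = A.
Proof. by apply/matrixP => i j; rewrite !mxE !valK. Qed.

Lemma stab_stab M N n (A : 'M[R]_n) :
  (n <= N)%N -> stab M (stab N A) = stab M A.
Proof.
move=> le; apply/matrixP => i j; rewrite !mxE.
case: (ltnP i N) => [iN|Ni]; last by rewrite insub_ordN // insub_ordN // (leq_trans le).
rewrite (insubT (fun k => k < N)%N iN).
case: (ltnP j N) => [jN|Nj].
  by rewrite (insubT (fun k => k < N)%N jN) mxE /= -!val_eqE.
by rewrite insub_ordN // (@insub_ordN n j) ?(leq_trans le) //; case: insub.
Qed.

Lemma stab_inverse N n (A B : 'M[R]_n) : (n <= N)%N ->
  mx_inverse A B -> mx_inverse (stab N A) (stab N B).
Proof. by move=> le [e1 e2]; split; rewrite -stab_mul // ?e1 ?e2 stab1. Qed.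

(* The commutator subgroup of GL_n(R). *)
Inductive comm_subgroup n : 'M[R]_n -> Prop :=
| Comm1 : comm_subgroup 1%:M
| CommM P P' Q Q' X : mx_inverse P P' -> mx_inverse Q Q' -> comm_subgroup X ->
    comm_subgroup (P *m Q *m P' *m Q' *m X).

Lemma commM n (X Y : 'M[R]_n) :
  comm_subgroup X -> comm_subgroup Y -> comm_subgroup (X *m Y).
Proof.
move=> cX cY; elim: cX => [|P P' Q Q' {}X iP iQ _ IH]; first by rewrite mul1mx.
by rewrite -mulmxA; apply: CommM.
Qed.

Lemma comm1 n (P P' Q Q' : 'M[R]_n) : mx_inverse P P' -> mx_inverse Q Q' ->
  comm_subgroup (P *m Q *m P' *m Q').
Proof. by move=> iP iQ; rewrite -[X in comm_subgroup X]mulmx1; apply: CommM => //; apply: Comm1. Qed.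

Lemma comm_inv n (X : 'M[R]_n) :
  comm_subgroup X -> exists2 Y, comm_subgroup Y & mx_inverse X Y.
Proof.
elim=> [|P P' Q Q' {}X iP iQ _ [Y cY iXY]].
  by exists 1%:M; [apply: Comm1 | apply: mx_inverse1].
have [iP' iQ'] := (mx_inverse_sym iP, mx_inverse_sym iQ).
exists (Y *m (Q *m (P *m (Q' *m P')))).
  by rewrite !mulmxA -!mulmxA; apply: commM => //; rewrite !mulmxA; apply: comm1.
apply: mx_inverse_mul => //; apply: mx_inverse_mul => //.
by apply: mx_inverse_mul => //; apply: mx_inverse_mul.
Qed.

Lemma comm_conj n (X P P' : 'M[R]_n) : mx_inverse P P' ->
  comm_subgroup X -> comm_subgroup (P *m X *m P').
Proof.
move=> iP cX; have [Y cY iXY] := comm_inv cX.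
have -> : P *m X *m P' = (P *m X *m P' *m Y) *m X.
  by case: iXY => _ YX; rewrite -[RHS]mulmxA YX mulmx1.
by apply: commM => //; apply: comm1.
Qed.

Lemma comm_stab N n (X : 'M[R]_n) : (n <= N)%N ->
  comm_subgroup X -> comm_subgroup (stab N X).
Proof.
move=> le; elim=> [|P P' Q Q' {}X iP iQ _ IH].
  by rewrite stab1; apply: Comm1.
by rewrite !stab_mul //; apply: CommM => //; apply: stab_inverse.
Qed.

Record gl := GL {
  gl_size : nat;
  gl_mx : 'M[R]_gl_size;
  gl_inv : 'M[R]_gl_size;
  gl_invP : mx_inverse gl_mx gl_inv
}.

HB.instance Definition _ := gen_eqMixin gl.
HB.instance Definition _ := gen_choiceMixin gl.

(* Congruence of x and y in GL(R) modulo its commutator subgroup. *)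
Definition gl_congr (x y : gl) : Prop := exists N X,
  [/\ (gl_size x <= N)%N, (gl_size y <= N)%N, @comm_subgroup N X
    & stab N (gl_mx x) = X *m stab N (gl_mx y)].

Lemma gl_congr_refl x : gl_congr x x.
Proof. by exists (gl_size x), 1%:M; split=> //; [apply: Comm1|rewrite mul1mx]. Qed.

Lemma gl_congr_sym x y : gl_congr x y -> gl_congr y x.
Proof.
move=> [N [X [lx ly cX e]]]; have [Y cY [_ YX]] := comm_inv cX.
by exists N, Y; split=> //; rewrite e mulmxA YX mul1mx.
Qed.

Lemma gl_congr_widen x y : gl_congr x y -> exists N0, forall N, (N0 <= N)%N ->
  exists X, [/\ (gl_size x <= N)%N, (gl_size y <= N)%N, @comm_subgroup N X
    & stab N (gl_mx x) = X *m stab N (gl_mx y)].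
Proof.
move=> [N0 [X [lx ly cX e]]]; exists N0 => N le; exists (stab N X).
split; [exact: leq_trans lx le | exact: leq_trans ly le | exact: comm_stab |].
by rewrite -(stab_stab _ _ lx) e stab_mul // stab_stab.
Qed.

Lemma gl_congr_trans y x z : gl_congr x y -> gl_congr y z -> gl_congr x z.
Proof.
move=> /gl_congr_widen[N1 h1] /gl_congr_widen[N2 h2].
have [X [lx _ cX eX]] := h1 _ (leq_maxl N1 N2).
have [Y [_ lz cY eY]] := h2 _ (leq_maxr N1 N2).
exists (maxn N1 N2), (X *m Y); split=> //; first exact: commM.
by rewrite eX eY mulmxA.
Qed.

Definition gl_eqv (x y : gl) : bool := `[< gl_congr x y >].

Lemma gl_eqv_refl : reflexive gl_eqv.
Proof. by move=> x; apply/asboolP/gl_congr_refl. Qed.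

Lemma gl_eqv_sym : symmetric gl_eqv.
Proof. by move=> x y; apply/asboolP/asboolP; apply: gl_congr_sym. Qed.

Lemma gl_eqv_trans : transitive gl_eqv.
Proof. by move=> y x z /asboolP h /asboolP k; apply/asboolP/(gl_congr_trans h k). Qed.

Canonical gl_equiv := EquivRel gl_eqv gl_eqv_refl gl_eqv_sym gl_eqv_trans.

(* K_1(R) = GL(R)^ab, written additively. *)
Definition K1 : Type := {eq_quot gl_equiv}.
HB.instance Definition _ := Quotient.on K1.
HB.instance Definition _ := Choice.on K1.

Definition cls (x : gl) : K1 := \pi_K1 x.

Lemma clsP x y : cls x = cls y <-> gl_congr x y.
Proof.
rewrite /cls; split=> [/eqquotP /asboolP //|h]; by apply/eqquotP/asboolP.
Qed.

Lemma cls_ind (P : K1 -> Prop) : (forall x, P (cls x)) -> forall a, P a.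
Proof. by move=> h a; elim/quotW: a. Qed.

Definition gl1 : gl := GL (mx_inverse1 0).
Definition gl_opp (x : gl) : gl := GL (mx_inverse_sym (gl_invP x)).

Definition gl_mul_subproof (x y : gl) := mx_inverse_mul
  (stab_inverse (leq_maxl (gl_size x) (gl_size y)) (gl_invP x))
  (stab_inverse (leq_maxr (gl_size x) (gl_size y)) (gl_invP y)).
Definition gl_mul (x y : gl) : gl := GL (gl_mul_subproof x y).

Definition k1_add (a b : K1) : K1 := cls (gl_mul (repr a) (repr b)).
Definition k1_opp (a : K1) : K1 := cls (gl_opp (repr a)).

Lemma gl_congr_stab x y N X : (gl_size x <= N)%N -> (gl_size y <= N)%N ->
  comm_subgroup X -> stab N (gl_mx x) = X *m stab N (gl_mx y) -> gl_congr x y.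
Proof. by move=> *; exists N, X. Qed.

Lemma stab_gl_mul N x y : (gl_size (gl_mul x y) <= N)%N ->
  stab N (gl_mx (gl_mul x y)) = stab N (gl_mx x) *m stab N (gl_mx y).
Proof. by move=> le; rewrite /= stab_mul // !stab_stab ?leq_maxl ?leq_maxr. Qed.

Lemma gl_mul_congr x x' y y' : gl_congr x x' -> gl_congr y y' ->
  gl_congr (gl_mul x y) (gl_mul x' y').
Proof.
move=> /gl_congr_widen[N1 h1] /gl_congr_widen[N2 h2].
have [X [lx lx' cX eX]] := h1 _ (leq_maxl N1 N2).
have [Y [ly ly' cY eY]] := h2 _ (leq_maxr N1 N2).
set N := maxn N1 N2 in X Y lx lx' ly ly' cX cY eX eY.
have iX := stab_inverse lx' (gl_invP x').
set A := stab N (gl_mx x') in eX iX *; set A' := stab N (gl_inv x') in iX *.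
apply: (@gl_congr_stab _ _ N (X *m (A *m Y *m A'))).
- by rewrite geq_max lx ly.
- by rewrite geq_max lx' ly'.
- by apply: commM => //; apply: comm_conj.
rewrite !stab_gl_mul ?geq_max ?lx ?ly ?lx' ?ly' // eX eY -/A.
by case: iX => _ A'A; rewrite !mulmxA -(mulmxA _ A' A) A'A mulmx1.
Qed.

Lemma gl_congr_eq x y N : (gl_size x <= N)%N -> (gl_size y <= N)%N ->
  stab N (gl_mx x) = stab N (gl_mx y) -> gl_congr x y.
Proof. by move=> lx ly e; apply: (gl_congr_stab lx ly (@Comm1 N)); rewrite mul1mx. Qed.

Lemma gl_mulC x y : gl_congr (gl_mul x y) (gl_mul y x).
Proof.
pose N := maxn (gl_size x) (gl_size y).
have [lx ly] : (gl_size x <= N)%N /\ (gl_size y <= N)%N by rewrite leq_maxl leq_maxr.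
have iX := stab_inverse lx (gl_invP x); have iY := stab_inverse ly (gl_invP y).
apply: (@gl_congr_stab _ _ N (stab N (gl_mx x) *m stab N (gl_mx y)
          *m stab N (gl_inv x) *m stab N (gl_inv y))).
- by [].
- by rewrite /= maxnC.
- exact: comm1.
rewrite !stab_gl_mul //; last by rewrite /= maxnC.
case: iX iY => _ iX [_ iY].
by rewrite !mulmxA -(mulmxA _ _ (stab N (gl_mx y))) iY mulmx1 -(mulmxA _ _ (stab N (gl_mx x))) iX mulmx1.
Qed.

Lemma gl_mulA x y z : gl_congr (gl_mul x (gl_mul y z)) (gl_mul (gl_mul x y) z).
Proof.
set u := gl_mul x _; set v := gl_mul _ z.
have le : (gl_size v <= gl_size u)%N by rewrite /= maxnA.
have lex : (gl_size (gl_mul y z) <= gl_size u)%N by rewrite leq_maxr.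
have lez : (gl_size (gl_mul x y) <= gl_size u)%N by rewrite /= maxnA leq_maxl.
by apply: (@gl_congr_eq _ _ (gl_size u)) => //; rewrite !stab_gl_mul // mulmxA.
Qed.

Lemma gl_mul1 x : gl_congr (gl_mul gl1 x) x.
Proof.
by apply: (@gl_congr_eq _ _ (gl_size x)); rewrite ?stab_gl_mul //= ?max0n // stab1 mul1mx.
Qed.

Lemma gl_mulV x : gl_congr (gl_mul (gl_opp x) x) gl1.
Proof.
apply: (@gl_congr_eq _ _ (gl_size x)); rewrite ?stab_gl_mul //= ?maxnn //.
by rewrite stab1 -stab_mul // (gl_invP x).2 stab1.
Qed.

Lemma gl_opp_congr x y : gl_congr x y -> gl_congr (gl_opp x) (gl_opp y).
Proof.
move=> h.
apply: gl_congr_trans (gl_congr_sym (gl_mul1 _)) _.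
apply: gl_congr_trans (gl_mul_congr (gl_congr_sym (gl_mulV y)) (gl_congr_refl _)) _.
apply: gl_congr_trans (gl_congr_sym (gl_mulA _ _ _)) _.
apply: gl_congr_trans (gl_mul_congr (gl_congr_refl _) (gl_mulC _ _)) _.
apply: gl_congr_trans (gl_mul_congr (gl_congr_refl _) (gl_mul_congr (gl_congr_refl _) (gl_congr_sym h))) _.
apply: gl_congr_trans (gl_mul_congr (gl_congr_refl _) (gl_mulV _)) _.
apply: gl_congr_trans (gl_mulC _ _) _; exact: gl_mul1.
Qed.

Lemma repr_cls x : gl_congr (repr (cls x)) x.
Proof. by apply/clsP; rewrite /cls reprK. Qed.

Lemma k1_addE x y : k1_add (cls x) (cls y) = cls (gl_mul x y).
Proof. by apply/clsP; apply: gl_mul_congr; apply: repr_cls. Qed.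

Lemma k1_oppE x : k1_opp (cls x) = cls (gl_opp x).
Proof. by apply/clsP; apply: gl_opp_congr; apply: repr_cls. Qed.

Lemma k1_addA : associative k1_add.
Proof.
elim/cls_ind=> x; elim/cls_ind=> y; elim/cls_ind=> z.
by rewrite !k1_addE; apply/clsP/gl_mulA.
Qed.

Lemma k1_addC : commutative k1_add.
Proof.
by elim/cls_ind=> x; elim/cls_ind=> y; rewrite !k1_addE; apply/clsP/gl_mulC.
Qed.

Lemma k1_add0 : left_id (cls gl1) k1_add.
Proof. by elim/cls_ind=> x; rewrite k1_addE; apply/clsP/gl_mul1. Qed.

Lemma k1_addN : left_inverse (cls gl1) k1_opp k1_add.
Proof. by elim/cls_ind=> x; rewrite k1_oppE k1_addE; apply/clsP/gl_mulV. Qed.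

HB.instance Definition _ :=
  GRing.isZmodule.Build K1 k1_addA k1_addC k1_add0 k1_addN.

Lemma clsD x y : cls x + cls y = cls (gl_mul x y).
Proof. exact: k1_addE. Qed.

Lemma clsN x : - cls x = cls (gl_opp x).
Proof. exact: k1_oppE. Qed.

Lemma cls0 : 0 = cls gl1.
Proof. by []. Qed.

(* The torsion of (the isomorphism of based modules with matrix) A; a matrix
   that is not square or not invertible gets the junk value 0. *)
Definition tau m n (A : 'M[R]_(m, n)) : K1 :=
  let A' : 'M[R]_m := conform_mx 1%:M A in
  match pselect (exists B, mx_inverse A' B) with
  | left h => cls (GL (projT2 (cid h)))
  | right _ => 0
  end.

Lemma tauE n (A B : 'M[R]_n) (iA : mx_inverse A B) : tau A = cls (GL iA).
Proof.
rewrite /tau; case: pselect => [h|[]]; last by exists B; rewrite conform_mx_id.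
by apply/clsP; apply: (@gl_congr_eq _ _ n) => //=; rewrite conform_mx_id.
Qed.

Lemma mx_inverseN1 : mx_inverse (- 1%:M : 'M[R]_1) (- 1%:M).
Proof. by split; rewrite mulmxN mulNmx opprK mulmx1. Qed.

Definition tau_m1 : K1 := tau (- 1%:M : 'M[R]_1).

Lemma tau_m1E : tau_m1 = cls (GL mx_inverseN1).
Proof. exact: tauE. Qed.

Lemma tau_m1D : tau_m1 + tau_m1 = 0.
Proof.
rewrite tau_m1E clsD cls0; apply/clsP/(@gl_congr_eq _ _ 1) => //.
by rewrite stab_gl_mul //= stab_id mx_inverseN1.1 stab1.
Qed.

End GL.

Record involution (R : pzRingType) := Involution {
  inv_fun :> {additive R -> R};
  inv_mul : forall x y, inv_fun (x * y) = inv_fun y * inv_fun x;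
  inv_inv : involutive inv_fun
}.

(* The rank of a finitely generated free R-module is well defined. *)
Definition invariant_rank (R : pzRingType) : Prop :=
  forall m n (A : 'M[R]_(m, n)) (B : 'M[R]_(n, m)),
    A *m B = 1%:M -> B *m A = 1%:M -> m = n.

Section Dagger.
Variables (R : pzRingType) (J : involution R).

Lemma inv_one : J 1 = 1.
Proof. by have := inv_mul J (J 1) 1; rewrite inv_inv mulr1 inv_inv. Qed.

(* The matrix of the dual f^* : N^* -> M^* of a map f : M -> N. *)
Definition dag m n (A : 'M[R]_(m, n)) : 'M[R]_(n, m) := map_mx J A^T.

Lemma dagK m n (A : 'M_(m, n)) : dag (dag A) = A.
Proof. by apply/matrixP => i j; rewrite !mxE inv_inv. Qed.

Lemma dag0 m n : dag (0 : 'M_(m, n)) = 0.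
Proof. by apply/matrixP => i j; rewrite !mxE raddf0. Qed.

Lemma dagD m n (A B : 'M_(m, n)) : dag (A + B) = dag A + dag B.
Proof. by apply/matrixP => i j; rewrite !mxE raddfD. Qed.

Lemma dagN m n (A : 'M_(m, n)) : dag (- A) = - dag A.
Proof. by apply/matrixP => i j; rewrite !mxE raddfN. Qed.

Lemma dagM m n p (A : 'M_(m, n)) (B : 'M_(n, p)) :
  dag (A *m B) = dag B *m dag A.
Proof.
apply/matrixP => i j; rewrite !mxE raddf_sum.
by apply: eq_bigr => k _; rewrite !mxE inv_mul.
Qed.

Lemma dag1 n : dag (1%:M : 'M_n) = 1%:M.
Proof.
apply/matrixP => i j; rewrite !mxE eq_sym.
by case: eqP => _; rewrite ?mulr1n ?mulr0n ?inv_one ?raddf0.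
Qed.

Lemma dag_block m1 m2 n1 n2 (A : 'M_(m1, n1)) (B : 'M_(m1, n2))
    (C : 'M_(m2, n1)) (D : 'M_(m2, n2)) :
  dag (block_mx A B C D) = block_mx (dag A) (dag C) (dag B) (dag D).
Proof. by rewrite /dag tr_block_mx map_block_mx. Qed.

Lemma mx_inverse_dag n (A B : 'M[R]_n) :
  mx_inverse A B -> mx_inverse (dag A) (dag B).
Proof. by case=> e1 e2; split; rewrite -dagM ?e1 ?e2 dag1. Qed.

Definition gl_dag (x : gl R) : gl R := GL (mx_inverse_dag (gl_invP x)).

(* The involution of K_1(R) with tau(f)^* = tau(f^* ). *)
Definition k1_dag (a : K1 R) : K1 R := cls (gl_dag (repr a)).

Lemma dag_stab N n (A : 'M[R]_n) : (n <= N)%N -> dag (stab N A) = stab N (dag A).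
Proof. by move=> /subnKC <-; rewrite !stabE dag_block !dag0 dag1. Qed.

Lemma gl_dag_congr x y : gl_congr x y -> gl_congr (gl_dag x) (gl_dag y).
Proof.
move=> [N [X [lx ly cX e]]].
have cX' : comm_subgroup (dag X).
  elim: cX => [|P P' Q Q' {e}X iP iQ _ IH]; first by rewrite dag1; apply: Comm1.
  rewrite !dagM; apply: commM => //; rewrite !mulmxA.
  by apply: comm1; apply/mx_inverse_sym/mx_inverse_dag.
have [iY1 iY2] := stab_inverse ly (mx_inverse_dag (gl_invP y)).
exists N, (stab N (gl_mx (gl_dag y)) *m dag X *m stab N (gl_inv (gl_dag y))).
split=> //; first exact: comm_conj.
by rewrite -mulmxA iY2 mulmx1 -!dag_stab // e dagM.
Qed.

Lemma k1_dagE x : k1_dag (cls x) = cls (gl_dag x).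
Proof. by apply/clsP; apply: gl_dag_congr; apply: repr_cls. Qed.

Lemma k1_dag_tau n (A B : 'M[R]_n) : mx_inverse A B ->
  k1_dag (tau A) = tau (dag A).
Proof. by move=> iA; rewrite (tauE iA) k1_dagE (tauE (mx_inverse_dag iA)). Qed.

Lemma k1_dagD : {morph k1_dag : a b / a + b}.
Proof.
elim/cls_ind=> x; elim/cls_ind=> y; rewrite clsD !k1_dagE addrC clsD.
apply/clsP; pose N := gl_size (gl_mul x y).
have [lx ly] : (gl_size x <= N)%N /\ (gl_size y <= N)%N by rewrite leq_maxl leq_maxr.
apply: (@gl_congr_eq _ _ _ N) => //; first by rewrite /= maxnC.
rewrite [RHS]stab_gl_mul /=; last by rewrite maxnC.
by rewrite stab_id dagM !dag_stab.
Qed.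

Lemma k1_dag0 : k1_dag 0 = 0.
Proof. by apply: (addrI (k1_dag 0)); rewrite -k1_dagD !addr0. Qed.

Lemma k1_dag_tau_m1 : k1_dag (tau_m1 R) = tau_m1 R.
Proof. by rewrite /tau_m1 (k1_dag_tau (mx_inverseN1 R)) dagN dag1. Qed.

End Dagger.

Section Signs.
Variable R : pzRingType.

Definition is_sign (x : K1 R) : Prop := x = 0 \/ x = tau_m1 R.

(* epsilon(a, b) = ab tau(-1) *)
Definition eps (a b : int) : K1 R := tau_m1 R *~ (a * b).

Lemma is_sign0 : is_sign 0.
Proof. by left. Qed.

Lemma is_signD x y : is_sign x -> is_sign y -> is_sign (x + y).
Proof.
by case=> ->; case=> ->; rewrite ?add0r ?addr0 ?tau_m1D; [left|right|right|left].
Qed.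

Lemma is_signN x : is_sign x -> is_sign (- x).
Proof.
case=> ->; first by left; rewrite oppr0.
by right; apply/eqP; rewrite eq_sym -subr_eq0 opprK tau_m1D.
Qed.

Lemma is_signMz x (k : int) : is_sign x -> is_sign (x *~ k).
Proof.
move=> sx; have h m : is_sign (x *+ m).
  by elim: m => [|m IH]; [left | rewrite mulrS; apply: is_signD].
by case: k => m; [exact: h | rewrite NegzE mulrNz; apply: is_signN; apply: h].
Qed.

Lemma is_sign_eps a b : is_sign (eps a b).
Proof. by apply: is_signMz; right. Qed.

Lemma is_sign_dag (J : involution R) x : is_sign x -> is_sign (k1_dag J x).
Proof. by case=> ->; rewrite ?k1_dag0 ?k1_dag_tau_m1; [left|right]. Qed.

End Signs.

(* The sum over the degrees -N, ..., N. *)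
Definition zsum (V : nmodType) (N : nat) (F : int -> V) : V :=
  \sum_(i < N.*2.+1) F (i%:Z - N%:Z).

Lemma is_sign_zsum (R : pzRingType) N F :
  (forall r, is_sign (F r)) -> @is_sign R (zsum N F).
Proof. by move=> h; apply: big_ind => //; [exact: is_sign0 | exact: is_signD]. Qed.

(* (-1)^r *)
Definition sg (R : pzRingType) (r : int) : R := (-1) ^+ `|r|%N.

Section Sg.
Variable R : pzRingType.

Lemma sg_odd r : sg R r = (-1) ^+ odd `|r|%N.
Proof. by rewrite /sg signr_odd. Qed.

Lemma sgE (r s : int) : odd `|r|%N = odd `|s|%N -> sg R r = sg R s.
Proof. by rewrite !sg_odd => ->. Qed.

Lemma sgN (r s : int) : odd `|r|%N = ~~ odd `|s|%N -> sg R r = - sg R s.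
Proof. by rewrite !sg_odd => ->; case: odd; rewrite /= ?opprK. Qed.

Lemma sgD r s : sg R (r + s) = sg R r * sg R s.
Proof.
rewrite !sg_odd -signr_addb; congr (_ ^+ nat_of_bool _).
by case: r s => r [] s; lia.
Qed.

Lemma sgZZ r m n (A : 'M[R]_(m, n)) : sg R r *: (sg R r *: A) = A.
Proof. by rewrite scalerA -sgD sg_odd (_ : odd _ = false) ?scale1r //; lia. Qed.

Lemma scale_sg r m n (A : 'M[R]_(m, n)) : sg R r *: A = if odd `|r|%N then - A else A.
Proof. by rewrite sg_odd; case: odd; rewrite ?scaleN1r ?scale1r. Qed.

Lemma mulmx_sg r m n p (A : 'M[R]_(m, n)) (B : 'M[R]_(n, p)) :
  A *m (sg R r *: B) = sg R r *: (A *m B).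
Proof. by rewrite !scale_sg; case: odd; rewrite ?mulmxN. Qed.

Lemma dag_sg (J : involution R) r m n (A : 'M[R]_(m, n)) :
  dag J (sg R r *: A) = sg R r *: dag J A.
Proof. by rewrite !scale_sg; case: odd; rewrite ?dagN. Qed.

End Sg.

(* A based f.g. free module is R^n for n its rank, and a map R^n -> R^m is the
   matrix in 'M_(m, n) by which it acts on column vectors. To avoid casts
   between equal degrees, graded maps are given by matrices for all pairs of
   degrees: df p q : C_p -> C_q is the differential if q = p - 1, and is 0
   otherwise. bd is a bound for the absolute value of the nonzero degrees. *)
Record complex (R : pzRingType) := Complex {
  rk : int -> nat;
  df : forall p q : int, 'M[R]_(rk q, rk p);
  bd : nat;
  rk_bd : forall r, (bd < `|r|)%N -> rk r = 0%N;
  df_deg : forall p q, q != p - 1 -> df p q = 0;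
  df_df : forall p q r, df q r *m df p q = 0
}.

Record chain_map (R : pzRingType) (C D : complex R) := ChainMap {
  cm :> forall r : int, 'M[R]_(rk D r, rk C r);
  cm_df : forall p q, df D p q *m cm p = cm q *m df C p q
}.

Section Complexes.
Variable R : pzRingType.
Implicit Types C D : complex R.

(* n-dimensional: concentrated in degrees 0, ..., n *)
Definition dimensional (n : nat) C : Prop :=
  forall r, ~~ (0 <= r <= n%:Z) -> rk C r = 0%N.

(* The identity map of C_p = C_q if p = q, and 0 otherwise. *)
Definition idm C (p q : int) : 'M[R]_(rk C q, rk C p) :=
  \matrix_(i, j) ((p == q) && (i == j :> nat))%:R.

Lemma idm1 C p : idm C p p = 1%:M.
Proof. by apply/matrixP => i j; rewrite !mxE eqxx. Qed.

Lemma idm0 C p q : p != q -> idm C p q = 0.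
Proof. by move=> /negPf ne; apply/matrixP => i j; rewrite !mxE ne. Qed.

Lemma dag_idm (J : involution R) C p q : dag J (idm C p q) = idm C q p.
Proof.
apply/matrixP => i j; rewrite !mxE eq_sym [(j : nat) == _]eq_sym.
by case: (_ && _); rewrite ?inv_one ?raddf0.
Qed.

Definition chi C : int := zsum (bd C) (fun r => (-1) ^+ `|r|%N * (rk C r)%:Z).

Definition rk_odd C : nat := zsum (bd C) (fun i => rk C (2 * i + 1)).

Definition beta C D : K1 R :=
  zsum (bd C) (fun i => zsum (bd D) (fun j =>
    if j < i then
      eps R (rk C (2 * i)) (rk D (2 * j))
      - eps R (rk C (2 * i + 1)) (rk D (2 * j + 1))
    else 0)).

Lemma is_sign_beta C D : is_sign (beta C D).
Proof.
do 2![apply: is_sign_zsum => ?]; case: ifP => _; last exact: is_sign0.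
by apply: is_signD; [|apply: is_signN]; apply: is_sign_eps.
Qed.

Definition homotopic_to_0 C (u : forall r : int, 'M[R]_(rk C r)) : Prop :=
  exists H : forall p q : int, 'M[R]_(rk C q, rk C p), forall r,
    u r = df C (r + 1) r *m H r (r + 1) + H (r - 1) r *m df C r (r - 1).

Definition chain_equivalence C D (f : chain_map C D) : Prop :=
  exists g : chain_map D C,
    homotopic_to_0 (fun r => g r *m f r - 1%:M) /\
    homotopic_to_0 (fun r => f r *m g r - 1%:M).

Definition chain_contraction C
    (G : forall p q : int, 'M[R]_(rk C q, rk C p)) : Prop :=
  (forall p q, q != p + 1 -> G p q = 0) /\
  (forall r, df C (r + 1) r *m G r (r + 1) + G (r - 1) r *m df C r (r - 1)
             = 1%:M).

Definition contractible C : Prop := exists G, @chain_contraction C G.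

(* The matrix of d + Gamma : C_odd -> C_even. *)
Definition odd_even C (G : forall p q : int, 'M[R]_(rk C q, rk C p)) :=
  let ev (i : 'I_(bd C).*2.+1) : int := 2 * (i%:Z - (bd C)%:Z) in
  let od (i : 'I_(bd C).*2.+1) : int := 2 * (i%:Z - (bd C)%:Z) + 1 in
  \mxblock_(i, j) (df C (od j) (ev i) + G (od j) (ev i)).

(* The zeroth homology vanishes. *)
Definition H0_eq0 C : Prop :=
  forall x : 'cV[R]_(rk C 0), df C 0 (-1) *m x = 0 ->
    exists y : 'cV[R]_(rk C 1), df C 1 0 *m y = x.

Section Sum.
Variables C D : complex R.
Definition sum_rk r := (rk C r + rk D r)%N.
Definition sum_df p q : 'M[R]_(sum_rk q, sum_rk p) :=
  block_mx (df C p q) 0 0 (df D p q).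

Lemma sum_bd r : (maxn (bd C) (bd D) < `|r|)%N -> sum_rk r = 0%N.
Proof. by rewrite gtn_max /sum_rk => /andP[h1 h2]; rewrite !rk_bd. Qed.

Lemma sum_deg p q : q != p - 1 -> sum_df p q = 0.
Proof. by move=> h; rewrite /sum_df !df_deg // block_mx0. Qed.

Lemma sum_dfdf p q r : sum_df q r *m sum_df p q = 0.
Proof.
by rewrite /sum_df mulmx_block !mulmx0 !mul0mx !df_df !add0r block_mx0.
Qed.

Definition dsum : complex R := Complex sum_bd sum_deg sum_dfdf.
End Sum.

Section Shift.
Variable C : complex R.
Lemma shift_bd r : ((bd C).+1 < `|r|)%N -> rk C (r - 1) = 0%N.
Proof. by move=> h; rewrite rk_bd //; lia. Qed.

Lemma shift_deg p q : q != p - 1 -> df C (p - 1) (q - 1) = 0.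
Proof. by move=> h; rewrite df_deg //; apply: contra h => /eqP; lia. Qed.

Definition shift : complex R :=
  @Complex R (fun r => rk C (r - 1)) (fun p q => df C (p - 1) (q - 1))
    (bd C).+1 shift_bd shift_deg (fun p q r => df_df C _ _ _).
End Shift.

Section Cone.
Variables (C D : complex R) (f : chain_map C D).
Definition cone_rk r := (rk D r + rk C (r - 1))%N.
Definition cone_df p q : 'M[R]_(cone_rk q, cone_rk p) :=
  block_mx (df D p q) (sg R (p + 1) *: (idm D (p - 1) q *m f (p - 1)))
           0          (df C (p - 1) (q - 1)).

Lemma cone_bd r : (maxn (bd D) (bd C).+1 < `|r|)%N -> cone_rk r = 0%N.
Proof.
by rewrite gtn_max /cone_rk => /andP[h1 h2]; rewrite rk_bd ?shift_bd.
Qed.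

Lemma cone_deg p q : q != p - 1 -> cone_df p q = 0.
Proof.
move=> h; rewrite /cone_df df_deg // shift_deg // idm0 1?eq_sym //.
by rewrite mul0mx scaler0 block_mx0.
Qed.

Lemma cone_dfdf p q r : cone_df q r *m cone_df p q = 0.
Proof.
have [->|h] := eqVneq q (p - 1); last by rewrite (cone_deg h) mulmx0.
have [->|h] := eqVneq r (p - 1 - 1); last by rewrite (cone_deg h) mul0mx.
rewrite mulmx_block !mulmx0 !mul0mx !df_df !add0r !idm1 !mul1mx.
rewrite mulmx_sg -scalemxAl cm_df (@sgN _ (p - 1 + 1) (p + 1)); last by lia.
by rewrite scaleNr addrN block_mx0.
Qed.

Definition cone : complex R := Complex cone_bd cone_deg cone_dfdf.
End Cone.

Section Dual.
Variables (J : involution R) (n : nat) (C : complex R).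
(* C^{n-*}, where C^r = (C_r)^* is identified with R^(rk C_r) by the dual
   basis *)
Definition dual_rk (r : int) := rk C (n%:Z - r).
Definition dual_df p q : 'M[R]_(dual_rk q, dual_rk p) :=
  sg R p *: dag J (df C (n%:Z - q) (n%:Z - p)).

Lemma dual_bd r : (bd C + n < `|r|)%N -> dual_rk r = 0%N.
Proof. by move=> h; rewrite /dual_rk rk_bd //; lia. Qed.

Lemma dual_deg p q : q != p - 1 -> dual_df p q = 0.
Proof.
move=> h; rewrite /dual_df df_deg ?dag0 ?scaler0 //.
by apply: contra h => /eqP; lia.
Qed.

Lemma dual_dfdf p q r : dual_df q r *m dual_df p q = 0.
Proof. by rewrite mulmx_sg -scalemxAl -dagM df_df dag0 !scaler0. Qed.

Definition dual : complex R := Complex dual_bd dual_deg dual_dfdf.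
End Dual.

End Complexes.

Record scomplex (R : pzRingType) := SComplex {
  scx :> complex R;
  eta : K1 R;
  eta_sign : is_sign eta
}.

Section Signed.
Variable R : pzRingType.
Implicit Types C D : scomplex R.

Definition sum_eta C D : K1 R :=
  eta C + eta D - beta C D + eps R (rk_odd C) (chi D).

Lemma sum_eta_sign C D : is_sign (sum_eta C D).
Proof.
apply: is_signD; last exact: is_sign_eps.
apply: is_signD; last by apply/is_signN/is_sign_beta.
by apply: is_signD; apply: eta_sign.
Qed.

Definition sdsum C D : scomplex R := @SComplex R (dsum C D) _ (sum_eta_sign C D).

Definition sshift C : scomplex R :=
  @SComplex R (shift C) (- eta C) (is_signN (eta_sign C)).

Definition scone C D (f : chain_map C D) : scomplex R :=
  @SComplex R (cone f) _ (eta_sign (sdsum D (sshift C))).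

Definition alpha (n : nat) (C : complex R) : K1 R :=
  zsum (bd C) (fun r =>
    if (r == n%:Z + 2 %[mod 4])%Z || (r == n%:Z + 3 %[mod 4])%Z
    then eps R (rk C r) (rk C r) else 0).

Definition dual_eta (J : involution R) (n : nat) C : K1 R :=
  k1_dag J (eta C) *~ (-1) ^+ n.+1 + k1_dag J (beta C C) *~ (-1) ^+ n.+1
  + alpha n C.

Lemma dual_eta_sign J n C : is_sign (dual_eta J n C).
Proof.
apply: is_signD; last first.
  by apply: is_sign_zsum => r; case: ifP => _; [exact: is_sign_eps|exact: is_sign0].
by apply: is_signD; apply/is_signMz/is_sign_dag;
  [exact: eta_sign | exact: is_sign_beta].
Qed.

Definition sdual J n C : scomplex R :=
  @SComplex R (dual J n C) _ (dual_eta_sign J n C).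

(* The torsion of a contractible signed complex, computed from some chain
   contraction; 0 if C is not contractible. *)
Definition tau_new C : K1 R :=
  match pselect (contractible C) with
  | left h => tau (odd_even (projT1 (cid h))) + eta C
  | right _ => 0
  end.

(* The torsion of a chain equivalence f of signed complexes. *)
Definition tau_map C D (f : chain_map C D) : K1 R := tau_new (scone f).

End Signed.

Section Symmetric.
Variables (R : pzRingType) (J : involution R).
Local Notation sg := (sg R).

(* The sequences (phi_s) with phi s p q the component C^p -> C_q of phi_s. *)
Definition hom_seq (C : complex R) :=
  nat -> forall p q : int, 'M[R]_(rk C q, rk C p).

(* T : Hom(C^q, C_p) -> Hom(C^p, C_q) *)
Definition transp (C : complex R) (u : forall p q : int, 'M[R]_(rk C q, rk C p))
    (p q : int) : 'M[R]_(rk C q, rk C p) :=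
  sg (p * q) *: dag J (u q p).

(* phi_{s-1}, with phi_{-1} = 0 *)
Definition lower (C : complex R) (phi : hom_seq C) : hom_seq C :=
  fun s => if s is s'.+1 then phi s' else fun p q => 0.

(* d phi_s + (-1)^r phi_s d^* + (-1)^(m+s) (phi_{s-1} + (-1)^s T phi_{s-1})
   : C^p -> C_r *)
Definition sym_diff (C : complex R) (m : nat) (phi : hom_seq C) (s : nat)
    (p r : int) : 'M[R]_(rk C r, rk C p) :=
  df C (r + 1) r *m phi s p (r + 1)
  + sg r *: (phi s (p + 1) r *m dag J (df C (p + 1) p))
  + sg (m%:Z + s%:Z) *: (lower phi s p r + sg s *: transp (lower phi s) p r).

Record sym_struct (n : nat) (C : complex R) := SymStruct {
  sym :> forall (s : nat) (p q : int), 'M[R]_(rk C q, rk C p);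
  sym_deg : forall s p q, p + q != n%:Z + s%:Z -> sym s p q = 0;
  sym_eq : forall s p r, p + r = n%:Z + s%:Z - 1 ->
    sym_diff n.+1 sym s p r = 0
}.

Section Phi0.
Variables (n : nat) (C : complex R) (phi : sym_struct n C).

Lemma phi0_df p q :
  df C p q *m phi 0%N (n%:Z - p) p = phi 0%N (n%:Z - q) q *m df (dual J n C) p q.
Proof.
have [->|h] := eqVneq q (p - 1); last first.
  by rewrite !df_deg // mul0mx mulmx0.
have e1 : p - 1 + 1 = p by lia.
have e2 : n%:Z - p + 1 = n%:Z - (p - 1) by lia.
have := @sym_eq _ _ phi 0%N (n%:Z - p) (p - 1).
rewrite /sym_diff /= /transp dag0 !scaler0 !addr0 scaler0 addr0 e1 e2.
move=> /(_ _)/eqP; rewrite addr_eq0 => /(_ _)/eqP ->; last by lia.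
rewrite /= /dual_df mulmx_sg -scaleNr; congr (_ *: _).
by apply/esym/sgN; lia.
Qed.

(* phi_0 : C^{n-*} -> C *)
Definition phi0 : chain_map (dual J n C) C :=
  @ChainMap R (dual J n C) C (fun r => phi 0%N (n%:Z - r) r) phi0_df.

Definition poincare : Prop := chain_equivalence phi0.
Definition connected : Prop := H0_eq0 (cone phi0).
End Phi0.

(* The absolute torsion of a signed symmetric Poincare complex. *)
Definition tau_sym n (C : scomplex R) (phi : sym_struct n C) : K1 R :=
  @tau_map R (sdual J n C) C (phi0 phi).

(* (f, sigma) is a morphism (C, phi) -> (C', phi'); only the components
   C'^p -> C'_q of sigma_s with p + q = n + 1 + s are used. *)
Definition sym_morphism n (C C' : complex R) (phi : sym_struct n C)
    (phi' : sym_struct n C') (f : chain_map C C') (sigma : hom_seq C') : Prop :=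
  forall s p r, p + r = n%:Z + s%:Z ->
    phi' s p r - f r *m phi s p r *m dag J (f p) = sym_diff n sigma s p r.

Section SymSum.
Variables (n : nat) (C D : complex R) (phi : sym_struct n C) (psi : sym_struct n D).
Definition sum_sym : hom_seq (dsum C D) :=
  fun s p q => block_mx (phi s p q) 0 0 (psi s p q).

Lemma sum_sym_deg s p q : p + q != n%:Z + s%:Z -> sum_sym s p q = 0.
Proof. by move=> h; rewrite /sum_sym !sym_deg // block_mx0. Qed.

Lemma sum_sym_eq s p r : p + r = n%:Z + s%:Z - 1 ->
  sym_diff n.+1 sum_sym s p r = 0.
Proof.
move=> e; have := sym_eq phi e; have := sym_eq psi e.
have -> : sym_diff n.+1 sum_sym s p r =
  block_mx (sym_diff n.+1 phi s p r) 0 0 (sym_diff n.+1 psi s p r); last first.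
  by move=> -> ->; rewrite block_mx0.
rewrite /sym_diff /transp /sum_sym /= /sum_df.
case: s e => [|s] e /=; rewrite ?dag0 ?dag_block !mulmx_block !dag0 !mulmx0 !mul0mx.
  by rewrite !scaler0 !addr0 scaler0 !scale_block_mx !addr0 !add0r add_block_mx !scaler0 !addr0.
by rewrite !addr0 !add0r !scale_block_mx !add_block_mx !scale_block_mx !add_block_mx
           !scaler0 !addr0 !scaler0 !addr0.
Qed.

Definition sym_dsum : sym_struct n (dsum C D) := SymStruct sum_sym_deg sum_sym_eq.
End SymSum.

Section SymOpp.
Variables (n : nat) (C : complex R) (phi : sym_struct n C).
Definition opp_sym : hom_seq C := fun s p q => - phi s p q.

Lemma opp_sym_deg s p q : p + q != n%:Z + s%:Z -> opp_sym s p q = 0.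
Proof. by move=> h; rewrite /opp_sym sym_deg // oppr0. Qed.

Lemma opp_sym_eq s p r : p + r = n%:Z + s%:Z - 1 ->
  sym_diff n.+1 opp_sym s p r = 0.
Proof.
move=> e; rewrite -[RHS]oppr0 -(sym_eq phi e) /sym_diff !opprD mulmxN mulNmx.
rewrite -!scalerN opprD -!scalerN; congr (_ + _ *: _).
by case: s e => [|s] e; rewrite /transp /= ?dag0 ?dagN ?scalerN ?scaler0 ?oppr0.
Qed.

Definition sym_opp : sym_struct n C := SymStruct opp_sym_deg opp_sym_eq.
End SymOpp.

End Symmetric.

Section Boundary.
Variables (R : pzRingType) (J : involution R).
Local Notation sg := (sg R).
Variables (n : nat) (C : complex R) (phi : sym_struct J n.+1 C).
Local Notation m := (n.+1%:Z).

Lemma sym_eq0 p p' r r' : p' = p + 1 -> r' = r + 1 -> p + r = n%:Z ->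
  df C r' r *m phi 0%N p r'
  + sg r *: (phi 0%N p' r *m dag J (df C p' p)) = 0.
Proof.
move=> -> -> e; rewrite -[RHS](@sym_eq _ _ _ _ phi 0%N p r); last by lia.
by rewrite /sym_diff /transp /= dag0 !(scaler0, addr0).
Qed.

Lemma sym_eqS s p p' r r' : p' = p + 1 -> r' = r + 1 -> p + r = n%:Z + s%:Z + 1 ->
  df C r' r *m phi s.+1 p r'
  + sg r *: (phi s.+1 p' r *m dag J (df C p' p))
  + sg (n%:Z + s%:Z + 1) *: (phi s p r - sg (s%:Z + p * r) *: dag J (phi s r p)) = 0.
Proof.
move=> -> -> e; rewrite -[RHS](@sym_eq _ _ _ _ phi s.+1 p r); last by lia.
rewrite /sym_diff /transp /=; congr (_ + _ *: (_ + _)); first by apply: sgE; lia.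
rewrite scalerA -sgD -scaleNr; congr (_ *: _); apply/esym/sgN.
by rewrite (_ : _ + _ = s%:Z + p * r + 1); lia.
Qed.

Lemma idm_mulr k (X : forall q, 'M[R]_(k, rk C q)) p q :
  p = q -> X q *m idm C p q = X p.
Proof. by move=> ->; rewrite idm1 mulmx1. Qed.

Lemma idm_mull k (X : forall q, 'M[R]_(rk C q, k)) p q :
  p = q -> idm C p q *m X p = X q.
Proof. by move=> ->; rewrite idm1 mul1mx. Qed.

Lemma block_mx_eq0 m1 m2 n1 n2 (A : 'M[R]_(m1, n1)) (B : 'M_(m1, n2))
    (A' : 'M_(m2, n1)) (B' : 'M_(m2, n2)) :
  A = 0 -> B = 0 -> A' = 0 -> B' = 0 -> block_mx A B A' B' = 0.
Proof. by move=> -> -> -> ->; rewrite block_mx0. Qed.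

(* For phi of dimension m = n + 1, the boundary complex in dimension n. *)
Definition bdry_rk (r : int) := (rk C (r + 1) + rk C (m - r))%N.

Definition bdry_df p q : 'M[R]_(bdry_rk q, bdry_rk p) :=
  block_mx (df C (p + 1) (q + 1)) (sg p *: phi 0%N (m - p) (q + 1))
           0                      (sg p *: dag J (df C (m - q) (m - p))).

Lemma bdry_bd r : (bd C + n.+1 < `|r|)%N -> bdry_rk r = 0%N.
Proof. by move=> h; rewrite /bdry_rk !rk_bd //; lia. Qed.

Lemma bdry_deg p q : q != p - 1 -> bdry_df p q = 0.
Proof.
move=> /eqP h; apply: block_mx_eq0 => //.
- by rewrite df_deg //; apply/eqP; lia.
- by rewrite sym_deg ?scaler0 //; apply/eqP; lia.
- by rewrite df_deg ?dag0 ?scaler0 //; apply/eqP; lia.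
Qed.

Lemma bdry_dfdf p q r : bdry_df q r *m bdry_df p q = 0.
Proof.
have [->|h] := eqVneq q (p - 1); last by rewrite (bdry_deg h) mulmx0.
have [->|h] := eqVneq r (p - 1 - 1); last by rewrite (bdry_deg h) mul0mx.
rewrite /bdry_df mulmx_block !mulmx_sg -!scalemxAl -dagM !mulmx0 !mul0mx.
rewrite !df_df dag0 !scaler0 !add0r; apply: block_mx_eq0 => //.
rewrite -scalerDr (@sgE _ (p - 1) (p - 1 - 1 + 1)); last by lia.
by rewrite sym_eq0 ?scaler0 //; lia.
Qed.

Definition bdry : complex R := Complex bdry_bd bdry_deg bdry_dfdf.

Definition bdry_phi (s : nat) (p q : int) : 'M[R]_(rk bdry q, rk bdry p) :=
  block_mx
    (sg (m - q + s%:Z - 1) *: transp J (phi s.+1) (p + 1) (q + 1))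
    (if s is 0%N then sg (q * m) *: idm C (m - p) (q + 1) else 0)
    (if s is 0%N then idm C (p + 1) (m - q) else 0)
    0.

Lemma bdry_phi_deg s p q : p + q != n%:Z + s%:Z -> bdry_phi s p q = 0.
Proof.
move=> /eqP h; apply: block_mx_eq0 => //.
- by rewrite /transp sym_deg ?dag0 ?scaler0 //; apply/eqP; lia.
- by case: s h => // h; rewrite idm0 ?scaler0 //; apply/eqP; lia.
- by case: s h => // h; rewrite idm0 //; apply/eqP; lia.
Qed.

Lemma sg_mulmx r m1 m2 m3 (A : 'M[R]_(m1, m2)) (B : 'M[R]_(m2, m3)) :
  (sg r *: A) *m B = sg r *: (A *m B).
Proof. by rewrite scalemxAl. Qed.

Lemma odd_addz (a b : int) : odd `|(a + b)%R|%N = odd `|a|%N (+) odd `|b|%N.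
Proof. lia. Qed.

Lemma odd_mulz (a b : int) : odd `|(a * b)%R|%N = odd `|a|%N && odd `|b|%N.
Proof. by rewrite abszM oddM. Qed.

Lemma odd_oppz (a : int) : odd `|(- a)%R|%N = odd `|a|%N.
Proof. by rewrite abszN. Qed.

Lemma addr4 (V : zmodType) (a b c d : V) : a + b + (c + d) = c + a + (d + b).
Proof. by rewrite addrACA [a + c]addrC [b + d]addrC. Qed.

Local Ltac parity s p pr :=
  rewrite !(odd_addz, odd_mulz, odd_oppz) ?pr ?absz_nat /= ?absz_nat /=;
  move: (odd n) (odd s) (odd `|p|%N); by do 3 case.

Lemma bdry_phi_eq s p r : p + r = n%:Z + s%:Z - 1 ->
  sym_diff J n.+1 bdry_phi s p r = 0.
Proof.
move=> e.
have pr : odd `|r|%N = ~~ (odd n (+) odd s (+) odd `|p|%N).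
  have -> : r = n%:Z + s%:Z - p - 1 by lia.
  rewrite !(odd_addz, odd_oppz) !absz_nat /=.
  by move: (odd n) (odd s) (odd `|p|%N); do 3 case.
have e1 : r + 1 + (p + 1) = n%:Z + s%:Z + 1 by lia.
have e2 : s = 0%N -> p + 1 = m - (r + 1) by move=> s_eq; move: e; rewrite s_eq; clear; lia.
have e3 : s = 0%N -> m - (p + 1) = r + 1 by move=> s_eq; move: e; rewrite s_eq; clear; lia.
have e4 : s = 0%N -> m - p = r + 1 + 1 by move=> s_eq; move: e; rewrite s_eq; clear; lia.
have e5 : s = 0%N -> p + 1 + 1 = m - r by move=> s_eq; move: e; rewrite s_eq; clear; lia.
have e6 : s = 1%N -> m - p = r + 1 by move=> s_eq; move: e; rewrite s_eq; clear; lia.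
have e7 : s = 1%N -> p + 1 = m - r by move=> s_eq; move: e; rewrite s_eq; clear; lia.
have := @sym_eqS s (r + 1) (r + 1 + 1) (p + 1) (p + 1 + 1) erefl erefl e1.
move/(congr1 (@dag _ J _ _)); rewrite !(dagD, dagN, dag_sg, dagM, dagK, dag0).
set k := sg (m - r + s%:Z - 1 + r + (p + 1 + 1) * (r + 1)).
move=> /(congr1 (fun A => k *: A)); rewrite scaler0 {}/k.
rewrite !(scalerDr, scalerN, scalerA) -!sgD => E.
rewrite /sym_diff /= /bdry_df !dag_block.
case: s e {e1} pr e2 e3 e4 e5 e6 e7 E => [|s] e pr e2 e3 e4 e5 e6 e7 E.
  rewrite /transp !dag0 !scaler0 !addr0 scaler0 addr0 !mulmx_block.
  rewrite !scale_block_mx add_block_mx.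
  rewrite !(sg_mulmx, mulmx_sg, dag_sg, dagK, mul0mx, mulmx0, scaler0, add0r, addr0).
  rewrite scalerDr !scalerA -!sgD.
  rewrite (@idm_mulr _ (fun q => phi 0%N q (r + 1))); last exact: e2.
  rewrite (@idm_mull _ (fun q => dag J (phi 0%N q (p + 1)))); last exact: e3.
  rewrite (@idm_mulr _ (fun q => df C q (r + 1))); last exact: e4.
  rewrite (@idm_mull _ (fun q => df C (m - p) q)); last exact: e3.
  rewrite (@idm_mulr _ (fun q => dag J (df C (m - r) q))); last exact: e2.
  rewrite (@idm_mull _ (fun q => dag J (df C q (p + 1)))); last exact: e5.
  apply: block_mx_eq0 => //.
  - rewrite -[RHS]E addr4; congr (_ + _ + (_ + _)).
    + by congr (_ *: _); apply: sgE; parity 0%N p pr.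
    + by congr (_ *: _); apply: sgE; parity 0%N p pr.
    + by congr (_ *: _); apply: sgE; parity 0%N p pr.
    + by rewrite -scaleNr; congr (_ *: _); apply: sgN; parity 0%N p pr.
  - rewrite -scalerDl (@sgN _ _ (r + r * m + (p + 1))) ?addNr ?scale0r //.
    by parity 0%N p pr.
  - rewrite -scalerDl (@sgN _ _ r) ?addNr ?scale0r //.
    by parity 0%N p pr.
rewrite [bdry_phi s.+1 p _]/bdry_phi [bdry_phi s.+1 (p + 1) _]/bdry_phi /=.
rewrite /transp [bdry_phi s r p]/bdry_phi [bdry_phi s p r]/bdry_phi /transp.
rewrite dag_block !mulmx_block !scale_block_mx !add_block_mx !scale_block_mx !add_block_mx.
rewrite !(sg_mulmx, mulmx_sg, dag_sg, dagK, mul0mx, mulmx0, scaler0, add0r, addr0, dag0).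
rewrite !(scalerDr, scalerA) -!sgD.
apply: block_mx_eq0 => //.
- rewrite -[RHS]E [X in X + _ = _]addrC; congr (_ + _ + (_ + _)).
  + by congr (_ *: _); apply: sgE; parity s p pr.
  + by congr (_ *: _); apply: sgE; parity s p pr.
  + by congr (_ *: _); apply: sgE; parity s p pr.
  + by rewrite -scaleNr; congr (_ *: _); apply: sgN; parity s p pr.
- case: s pr e6 {e e2 e3 e4 e5 e7 E} => [|s] pr e6; last by rewrite dag0 !scaler0 addr0.
  rewrite dag_idm scalerA -sgD -scalerDl (@sgN _ _ (m + 1%:Z + (1%:Z + p * r))).
    by rewrite addNr scale0r.
  by parity 0%N p pr.
- case: s pr e7 {e e2 e3 e4 e5 e6 E} => [|s] pr e7; last by rewrite dag0 !scaler0 addr0.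
  rewrite dag_sg dag_idm scalerA -sgD -scalerDl (@sgN _ _ (m + 1%:Z + (1%:Z + p * r) + p * m)).
    by rewrite addNr scale0r.
  by parity 0%N p pr.
Qed.

Definition bdry_sym : sym_struct J n bdry := SymStruct bdry_phi_deg bdry_phi_eq.
End Boundary.

Arguments SComplex {R} scx eta eta_sign.
Arguments tau_map {R} C D f.
Arguments tau_sym {R J n} C phi.

(* Main.v *)
Require Import Defs.
From mathcomp Require Import all_boot all_order all_algebra.
From mathcomp Require Import boolp zify.
From Stdlib Require Import Btauto.

(** The torsion [tau_map f] of a chain equivalence is the torsion of the odd-to-even matrix
    d + Gamma of its mapping cone, plus a sign. The signs are chosen so that it has the formal
    properties of a determinant, and all parts of the theorem follow from these properties:

    - it does not change under chain homotopies ([tau_map_htpy]);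
    - it is additive under composition ([tau_map_comp]);
    - the dual of a chain equivalence in dimension n has torsion (-1)^n tau(f)^*
      ([tau_map_dual]);
    - if the chain map is an isomorphism in each degree and the torsions of its components are
      signs, then it is the sum of these signs and of the signs of the two complexes
      ([tau_map_iso]).

    Duality: phi_1 is a homotopy between phi_0 and its transpose. The transpose is the dual of
    phi_0 followed by the identification of the double dual of C with C, whose torsion is the
    sign n(n + 1)/2 epsilon(chi(C), chi(C)) ([tau_sym_dual]). Homotopy invariance: sigma_0 is a
    homotopy between f phi_0 f^* and phi'_0 ([tau_sym_morphism]). Orientation change: - phi_0 is
    the composite of phi_0 and -1 ([tau_sym_opp]). Cobordism invariance: for a boundary, phi_0 is
    an isomorphism in each degree, given by an antidiagonal matrix up to one corner, so its
    torsion is a sign that can be computed ([tau_bdry]); homotopy invariance does the rest.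
    Additivity: the cone of a direct sum is a permutation of the direct sum of the cones
    ([tau_sym_dsum]). The sign of C occurs twice in the torsion of phi_0, once through C and once
    through its dual, and cancels ([tau_symE]).

    The formal properties rest on the torsion [utor] of a contractible complex without the
    added sign. It is independent of the contraction ([gtau_dGN], which uses that 1 + XY and
    1 + YX have the same torsion), and its behaviour under chain isomorphisms ([utor_iso]),
    extensions ([utor_ext]) and duals ([utor_dual]) is found by writing d + Gamma as a matrix
    in an explicitly listed basis and reordering the basis: each reordering contributes a sign
    that is bilinear in the ranks modulo 2. A composite is reduced to extensions and
    isomorphisms ([utor_comp]). That the signs from reorderings cancel those in the definitions
    is an identity between boolean polynomials in a few bilinear forms in the ranks, related
    to each other by [lowD] and [low_shift1]. *)

Set Implicit Arguments.
Unset Strict Implicit.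
Unset Printing Implicit Defensive.

Import Order.TTheory GRing.Theory Num.Theory.
Local Open Scope ring_scope.

(** * Signs in K_1 and torsion of block matrices *)

Section Sgb.
Variable R : pzRingType.

(** All sign terms are multiples of the torsion of -1, which has order at most 2; coding them
    by booleans turns every identity between signs into one between boolean polynomials. *)
Definition sgb (b : bool) : K1 R := if b then tau_m1 R else 0.

Lemma sgbD (b c : bool) : sgb (b (+) c) = sgb b + sgb c.
Proof. by case: b; case: c; rewrite /sgb /= ?addr0 ?add0r // tau_m1D. Qed.

Lemma sgbb b : sgb b + sgb b = 0.
Proof. by rewrite -sgbD addbb. Qed.

Lemma sgbN b : - sgb b = sgb b.
Proof. by apply/eqP; rewrite -subr_eq0 -opprD sgbb oppr0. Qed.

Lemma sgbMn b n : sgb b *+ n = sgb (odd n && b).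
Proof. by elim: n => [|n IH] //; rewrite mulrS IH -sgbD /=; case: odd; case: (b). Qed.

Lemma sgbMz b (k : int) : sgb b *~ k = sgb (odd `|k|%N && b).
Proof.
case: k => n; first exact: sgbMn.
by rewrite NegzE mulrNz -pmulrn sgbMn sgbN abszN.
Qed.

Lemma sgb_sign (x : K1 R) : is_sign x -> exists b, x = sgb b.
Proof. by case=> ->; [exists false | exists true]. Qed.

Lemma sgb_exp b n : sgb b *~ (-1) ^+ n = sgb b.
Proof. by rewrite sgbMz abszX exp1n. Qed.

Lemma epsE (a b : int) : eps R a b = sgb (odd `|a|%N && odd `|b|%N).
Proof. by rewrite /eps -[tau_m1 R]/(sgb true) sgbMz andbT abszM oddM. Qed.

Lemma k1_dag_sgb (J : involution R) b : k1_dag J (sgb b) = sgb b.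
Proof. by case: b; rewrite /sgb ?k1_dag_tau_m1 ?k1_dag0. Qed.

End Sgb.

Section TauTheory.
Variables (R : pzRingType) (hR : invariant_rank R).

(** Maps between modules of provably but not definitionally equal ranks have torsions too, so
    invertibility is stated for rectangular matrices. *)
Definition mxiso m n (A : 'M[R]_(m, n)) : Prop :=
  exists B : 'M[R]_(n, m), A *m B = 1%:M /\ B *m A = 1%:M.

Lemma mxiso_eq m n (A : 'M[R]_(m, n)) : mxiso A -> m = n.
Proof. by case=> B [e1 e2]; apply: (hR e1 e2). Qed.

Lemma mxiso1 n : mxiso (1%:M : 'M[R]_n).
Proof. by exists 1%:M; rewrite mulmx1. Qed.

Lemma mxisoM m n p (A : 'M[R]_(m, n)) (B : 'M[R]_(n, p)) :
  mxiso A -> mxiso B -> mxiso (A *m B).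
Proof.
move=> [A' [a1 a2]] [B' [b1 b2]]; exists (B' *m A'); split.
  by rewrite mulmxA -(mulmxA A) b1 mulmx1.
by rewrite mulmxA -(mulmxA B') a2 mulmx1.
Qed.

Lemma tau1 n : tau (1%:M : 'M[R]_n) = 0.
Proof.
rewrite (tauE (mx_inverse1 R n)) cls0; apply/clsP.
by apply: (@gl_congr_eq _ _ _ n) => //=; rewrite !stab1.
Qed.

Lemma tau_cast m n m' n' (e : (m = m') * (n = n')) (A : 'M[R]_(m, n)) :
  tau (castmx e A) = tau A.
Proof. by case: e => e1 e2; case: m' / e1; case: n' / e2; rewrite castmx_id. Qed.

Lemma mxiso_cast m n m' n' (e : (m = m') * (n = n')) (A : 'M[R]_(m, n)) :
  mxiso (castmx e A) <-> mxiso A.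
Proof. by case: e => e1 e2; case: m' / e1; case: n' / e2; rewrite castmx_id. Qed.

Lemma tau_mul m n p (A : 'M[R]_(m, n)) (B : 'M[R]_(n, p)) :
  mxiso A -> mxiso B -> tau (A *m B) = tau A + tau B.
Proof.
move=> iA iB; have en := mxiso_eq iA; have ep := mxiso_eq iB.
move: iA iB; subst n p => -[A' iA] [B' iB].
rewrite (tauE iA) (tauE iB) (tauE (mx_inverse_mul iA iB)) clsD.
apply/clsP/(@gl_congr_eq _ _ _ m) => //=; first by rewrite geq_max !leqnn.
by rewrite maxnn !stab_id.
Qed.

Lemma tau_inv m n (A : 'M[R]_(m, n)) (B : 'M[R]_(n, m)) :
  A *m B = 1%:M -> B *m A = 1%:M -> tau B = - tau A.
Proof.
move=> e1 e2; apply/eqP; rewrite -addr_eq0 -tau_mul; first by rewrite e2 tau1.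
  by exists A.
by exists B.
Qed.

Lemma tau_stab N n (A : 'M[R]_n) : (n <= N)%N -> mxiso A -> tau (stab N A) = tau A.
Proof.
move=> le [B iA]; rewrite (tauE iA) (tauE (stab_inverse le iA)).
by apply/clsP/(@gl_congr_eq _ _ _ N) => //=; rewrite stab_id.
Qed.

Lemma mxiso_diag m n m' n' (A : 'M[R]_(m, m')) (D : 'M[R]_(n, n')) :
  mxiso A -> mxiso D -> mxiso (block_mx A 0 0 D).
Proof.
move=> [A' [a1 a2]] [D' [d1 d2]]; exists (block_mx A' 0 0 D').
rewrite !mulmx_block !mulmx0 !mul0mx !addr0 !add0r a1 a2 d1 d2.
by rewrite -!scalar_mx_block.
Qed.

Lemma mul_swap m n m' n' (A : 'M[R]_(m, m')) (B : 'M_(m, n')) (C : 'M_(n, m'))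
   (D : 'M[R]_(n, n')) :
  block_mx A B C D *m block_mx 0 1%:M 1%:M 0 = block_mx B A D C.
Proof. by rewrite mulmx_block !mulmx0 !mulmx1 !addr0 !add0r. Qed.

Lemma mul_swapl m n m' n' (A : 'M[R]_(m, m')) (B : 'M_(m, n')) (C : 'M_(n, m'))
   (D : 'M[R]_(n, n')) :
  block_mx 0 1%:M 1%:M 0 *m block_mx A B C D = block_mx C D A B.
Proof. by rewrite mulmx_block !mul0mx !mul1mx !addr0 !add0r. Qed.

Definition swap_mx m n : 'M[R]_(m + n, n + m) := block_mx 0 1%:M 1%:M 0.

Lemma swap_mxK m n : swap_mx m n *m swap_mx n m = 1%:M.
Proof. by rewrite mul_swap -scalar_mx_block. Qed.

Lemma mxiso_swap m n : mxiso (swap_mx m n).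
Proof. by exists (swap_mx n m); rewrite !swap_mxK. Qed.

Lemma tau_unip m n (B : 'M[R]_(m, n)) : tau (block_mx 1%:M B 0 1%:M) = 0.
Proof.
set U := block_mx _ _ _ _.
have iU : mx_inverse U (block_mx 1%:M (- B) 0 1%:M).
  by split; rewrite mulmx_block !mulmx0 !mul0mx !mulmx1 !mul1mx ?mulmxN ?addr0 !add0r
    ?addNr ?addrN -scalar_mx_block.
(* The matrix is the commutator of P and Q, which need n extra coordinates. *)
pose P : 'M[R]_(m + n + n) := block_mx 1%:M (col_mx B 0) 0 1%:M.
pose P' : 'M[R]_(m + n + n) := block_mx 1%:M (- col_mx B 0) 0 1%:M.
pose Q : 'M[R]_(m + n + n) := block_mx 1%:M 0 (row_mx 0 1%:M) 1%:M.
pose Q' : 'M[R]_(m + n + n) := block_mx 1%:M 0 (- row_mx 0 1%:M) 1%:M.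
have iP : mx_inverse P P'.
  by split; rewrite mulmx_block !mulmx0 !mul0mx !mulmx1 !mul1mx !addr0 !add0r
    ?addNr ?addrN -scalar_mx_block.
have iQ : mx_inverse Q Q'.
  by split; rewrite mulmx_block !mulmx0 !mul0mx !mulmx1 !mul1mx !addr0 ?add0r
    ?addNr ?addrN -scalar_mx_block.
rewrite (tauE iU) cls0; apply/clsP; exists (m + n + n)%N, (P *m Q *m P' *m Q').
split=> /=; [exact: leq_addr | by [] | exact: Defs.comm1 |].
rewrite /= stab1 mulmx1 stabE.
set C : 'M[R]_(m + n, n) := col_mx B 0 in P P' iP *.
set r : 'M[R]_(n, m + n) := row_mx 0 1%:M in Q Q' iQ *.
have e0 : r *m C = 0 by rewrite mul_row_col mul0mx mulmx0 addr0.
have e1 : C *m r = block_mx 0 B 0 0 by rewrite mul_col_row !mulmx0 mulmx1 mul0mx.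
have -> : P *m Q *m P' = block_mx (1%:M + C *m r) 0 r 1%:M.
  rewrite !mulmx_block !mulmx1 !mul1mx !mulmx0 !addr0 ?mul0mx !add0r !mulmxN e0 ?oppr0 ?add0r.
  by rewrite mulmxDl mul1mx -mulmxA e0 mulmx0 addr0 addNr.
rewrite mulmx_block !mulmx1 !mul1mx !mulmx0 !mul0mx !addr0 ?add0r addrN e1.
by rewrite scalar_mx_block add_block_mx !addr0 !add0r.
Qed.

Lemma mxiso_unip m n (B : 'M[R]_(m, n)) : mxiso (block_mx 1%:M B 0 1%:M).
Proof.
exists (block_mx 1%:M (- B) 0 1%:M).
by split; rewrite mulmx_block !mulmx0 !mul0mx !mulmx1 !mul1mx ?mulmxN ?addr0 !add0r
  ?addNr ?addrN -scalar_mx_block.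
Qed.

Lemma tau_diag m n m' n' (A : 'M[R]_(m, m')) (D : 'M[R]_(n, n')) :
  mxiso A -> mxiso D -> tau (block_mx A 0 0 D) = tau A + tau D.
Proof.
move=> iA iD; have em := mxiso_eq iA; have en := mxiso_eq iD; subst m' n'.
have hA k (X : 'M[R]_k) l : mxiso X -> tau (block_mx X 0 0 (1%:M : 'M_l)) = tau X.
  by move=> iX; rewrite -stabE tau_stab // leq_addr.
have -> : block_mx A 0 0 D = block_mx A 0 0 1%:M *m
    (swap_mx m n *m block_mx D 0 0 1%:M *m swap_mx n m).
  rewrite mul_swapl mul_swap mulmx_block !mulmx0 !mul0mx !mulmx1 !mul1mx.
  by rewrite !addr0 !add0r.
have iD' := mxiso_diag iD (mxiso1 m); have iA' := mxiso_diag iA (mxiso1 n).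
have iS := mxiso_swap.
rewrite !tau_mul ?hA //; try by do ?apply: mxisoM.
rewrite [X in _ + X]addrAC (tau_inv (swap_mxK n m) (swap_mxK m n)).
by rewrite addNr add0r.
Qed.

Lemma mxiso_ublock m n m' n' (A : 'M[R]_(m, m')) (B : 'M[R]_(m, n')) (D : 'M[R]_(n, n')) :
  mxiso A -> mxiso D ->
  exists2 U, tau U = 0 /\ mxiso U & block_mx A B 0 D = block_mx A 0 0 D *m U.
Proof.
move=> [A' [a1 a2]] iD; exists (block_mx 1%:M (A' *m B) 0 1%:M).
  by split; [exact: tau_unip | exact: mxiso_unip].
by rewrite mulmx_block !mulmx0 !mul0mx !mulmx1 !addr0 !add0r mulmxA a1 mul1mx.
Qed.

Lemma tau_ublock m n m' n' (A : 'M[R]_(m, m')) (B : 'M[R]_(m, n')) (D : 'M[R]_(n, n')) :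
  mxiso A -> mxiso D ->
  mxiso (block_mx A B 0 D) /\ tau (block_mx A B 0 D) = tau A + tau D.
Proof.
move=> iA iD; have [U [tU iU] ->] := mxiso_ublock B iA iD.
have iAD := mxiso_diag iA iD.
by split; [exact: mxisoM | rewrite tau_mul // tau_diag // tU addr0].
Qed.

Lemma tau_lblock m n m' n' (A : 'M[R]_(m, m')) (B : 'M[R]_(n, m')) (D : 'M[R]_(n, n')) :
  mxiso A -> mxiso D ->
  mxiso (block_mx A 0 B D) /\ tau (block_mx A 0 B D) = tau A + tau D.
Proof.
move=> iA iD; have [iX eX] := tau_ublock B iD iA.
have -> : block_mx A 0 B D =
    swap_mx m n *m block_mx D B 0 A *m swap_mx n' m'.
  by rewrite mul_swapl mul_swap.
have iS := mxiso_swap; split; first by do 2?apply: mxisoM.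
rewrite !tau_mul ?eX //; last exact: mxisoM.
have em := mxiso_eq iA; have en := mxiso_eq iD; subst m' n'.
by rewrite addrAC (tau_inv (swap_mxK n m) (swap_mxK m n)) addNr add0r addrC.
Qed.

(** Whitehead's identity: both sides are the torsion of the block matrix with rows
    (1, X) and (-Y, 1), reduced by row operations in two ways. *)
Lemma tau_1DM m n (X : 'M[R]_(m, n)) (Y : 'M[R]_(n, m)) :
  mxiso (1%:M + X *m Y) -> mxiso (1%:M + Y *m X) ->
  tau (1%:M + X *m Y) = tau (1%:M + Y *m X).
Proof.
move=> iXY iYX; pose W := block_mx 1%:M X (- Y) 1%:M.
have [i1 t1] := tau_lblock (- Y) iXY (mxiso1 n).
have [i2 t2] := tau_lblock (- Y) (mxiso1 m) iYX.
have e1 : W = block_mx 1%:M X 0 1%:M *m block_mx (1%:M + X *m Y) 0 (- Y) 1%:M.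
  rewrite mulmx_block !mul1mx !mulmx1 !mul0mx ?mulmx0 !add0r mulmxN.
  by rewrite addrK.
have e2 : W = block_mx 1%:M 0 (- Y) (1%:M + Y *m X) *m block_mx 1%:M X 0 1%:M.
  rewrite mulmx_block !mul1mx !mulmx1 !mul0mx !mulmx0 !addr0 mulNmx.
  by rewrite addrC addrK.
have := congr1 (@tau R _ _) e2; rewrite {1}e1 !tau_mul ?t1 ?t2 ?tau_unip ?tau1 //;
  try exact: mxiso_unip.
by rewrite !add0r !addr0.
Qed.

End TauTheory.

(** * Matrices in listed bases and signs of reorderings *)

Section ListMatrix.
Variables (R : pzRingType) (hR : invariant_rank R).

(** The matrix of [F] in bases that are listed explicitly: direct sums become concatenations,
    and a change of the order of a basis is a permutation of a list, without casts between
    equal dimensions. *)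
Definition mxof (X Y : Type) (F : X -> Y -> R) (L : seq X) (M : seq Y) :
    'M[R]_(size L, size M) :=
  \matrix_(i, j) F (tnth (in_tuple L) i) (tnth (in_tuple M) j).

Definition ltau X Y (F : X -> Y -> R) L M : K1 R := tau (mxof F L M).
Definition liso X Y (F : X -> Y -> R) L M : Prop := mxiso (mxof F L M).

Lemma mxof_ext (X Y : eqType) (F G : X -> Y -> R) L M :
  {in L & M, forall x y, F x y = G x y} -> mxof F L M = mxof G L M.
Proof. by move=> h; apply/matrixP => i j; rewrite !mxE h ?mem_tnth. Qed.

Lemma ltau_ext (X Y : eqType) (F G : X -> Y -> R) L M :
  {in L & M, forall x y, F x y = G x y} -> ltau F L M = ltau G L M.
Proof. by move=> h; rewrite /ltau (mxof_ext h). Qed.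

Lemma liso_ext (X Y : eqType) (F G : X -> Y -> R) L M :
  {in L & M, forall x y, F x y = G x y} -> liso F L M -> liso G L M.
Proof. by move=> h; rewrite /liso (mxof_ext h). Qed.

Lemma mxof_mul X Y Z (F : X -> Y -> R) (G : Y -> Z -> R) L M N :
  mxof F L M *m mxof G M N = mxof (fun x z => \sum_(y <- M) F x y * G y z) L N.
Proof.
apply/matrixP => i j; rewrite !mxE [RHS]big_tnth.
by apply: eq_bigr => k _; rewrite !mxE.
Qed.

Lemma mxof_cat X Y (F : X -> Y -> R) L1 L2 M1 M2 :
  mxof F (L1 ++ L2) (M1 ++ M2) =
  castmx (esym (size_cat L1 L2), esym (size_cat M1 M2))
    (block_mx (mxof F L1 M1) (mxof F L1 M2) (mxof F L2 M1) (mxof F L2 M2)).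
Proof.
apply/matrixP => i j; rewrite castmxE !mxE.
have tnth_cat (T : Type) (l1 l2 : seq T) (k : 'I_(size (l1 ++ l2))) x0 :
    tnth (in_tuple (l1 ++ l2)) k = nth x0 (l1 ++ l2) k by rewrite (tnth_nth x0).
case: splitP => i' /= ei; rewrite !mxE; case: splitP => j' /= ej; rewrite !mxE.
- rewrite (tnth_nth (tnth (in_tuple L1) i')) (tnth_nth (tnth (in_tuple M1) j')) /=.
  by rewrite !nth_cat ei ej !ltn_ord -!(tnth_nth _ (in_tuple _)).
- rewrite (tnth_nth (tnth (in_tuple L1) i')) (tnth_nth (tnth (in_tuple M2) j')) /=.
  rewrite !nth_cat ei ej !ltn_ord -(tnth_nth _ (in_tuple _)).
  by rewrite ltnNge leq_addr addKn /= -(tnth_nth _ (in_tuple _)).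
- rewrite (tnth_nth (tnth (in_tuple L2) i')) (tnth_nth (tnth (in_tuple M1) j')) /=.
  rewrite !nth_cat ei ej !ltn_ord -(tnth_nth _ (in_tuple M1)).
  by rewrite ltnNge leq_addr addKn /= -(tnth_nth _ (in_tuple _)).
- rewrite (tnth_nth (tnth (in_tuple L2) i')) (tnth_nth (tnth (in_tuple M2) j')) /=.
  rewrite !nth_cat ei ej [in if (_ < size L1)%N then _ else _]ltnNge leq_addr /=.
  by rewrite ltnNge leq_addr !addKn /= -!(tnth_nth _ (in_tuple _)).
Qed.

Lemma mxof_map X Y X' Y' (h : X' -> X) (k : Y' -> Y) (F : X -> Y -> R) L M :
  mxof F (map h L) (map k M) =
  castmx (esym (size_map h L), esym (size_map k M)) (mxof (fun x y => F (h x) (k y)) L M).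
Proof.
have tnth_map (T U : Type) (f : T -> U) (l : seq T) e i :
    tnth (in_tuple (map f l)) i = f (tnth (in_tuple l) (cast_ord e i)).
  have x0 := tnth (in_tuple l) (cast_ord e i).
  rewrite (tnth_nth (f x0)) (tnth_nth x0) /= (nth_map x0) //.
  by rewrite -(size_map f) ltn_ord.
by apply/matrixP => i j; rewrite castmxE !mxE; congr (F _ _); apply: tnth_map.
Qed.

Lemma ltau_map X Y X' Y' (h : X' -> X) (k : Y' -> Y) (F : X -> Y -> R) L M :
  ltau F (map h L) (map k M) = ltau (fun x y => F (h x) (k y)) L M.
Proof. by rewrite /ltau mxof_map tau_cast. Qed.

Lemma liso_map X Y X' Y' (h : X' -> X) (k : Y' -> Y) (F : X -> Y -> R) L M :
  liso F (map h L) (map k M) <-> liso (fun x y => F (h x) (k y)) L M.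
Proof. by rewrite /liso mxof_map mxiso_cast. Qed.

Lemma mxof0 (X Y : eqType) (F : X -> Y -> R) L M :
  {in L & M, forall x y, F x y = 0} -> mxof F L M = 0.
Proof. by move=> h; apply/matrixP => i j; rewrite !mxE h ?mem_tnth. Qed.

Lemma ltau_ublock (X Y : eqType) (F : X -> Y -> R) L1 L2 M1 M2 :
  {in L2 & M1, forall x y, F x y = 0} -> liso F L1 M1 -> liso F L2 M2 ->
  liso F (L1 ++ L2) (M1 ++ M2) /\
  ltau F (L1 ++ L2) (M1 ++ M2) = ltau F L1 M1 + ltau F L2 M2.
Proof.
move=> h i1 i2; rewrite /liso /ltau mxof_cat mxiso_cast tau_cast.
by rewrite (mxof0 h); apply: tau_ublock.
Qed.

Lemma ltau_lblock (X Y : eqType) (F : X -> Y -> R) L1 L2 M1 M2 :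
  {in L1 & M2, forall x y, F x y = 0} -> liso F L1 M1 -> liso F L2 M2 ->
  liso F (L1 ++ L2) (M1 ++ M2) /\
  ltau F (L1 ++ L2) (M1 ++ M2) = ltau F L1 M1 + ltau F L2 M2.
Proof.
move=> h i1 i2; rewrite /liso /ltau mxof_cat mxiso_cast tau_cast.
by rewrite (mxof0 h); apply: tau_lblock.
Qed.

Lemma liso_nil X Y (F : X -> Y -> R) : liso F [::] [::].
Proof. by exists 0; split; apply/matrixP => -[]. Qed.

Lemma ltau_nil X Y (F : X -> Y -> R) : ltau F [::] [::] = 0.
Proof.
have e : mxof F [::] [::] = (1%:M : 'M_0) by apply/matrixP => -[].
by rewrite /ltau e tau1.
Qed.

Definition delta (X : eqType) (x y : X) : R := (x == y)%:R.

Lemma mxof_delta (X : eqType) (L : seq X) : uniq L -> mxof (@delta X) L L = 1%:M.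
Proof.
move=> uL; apply/matrixP => i j; rewrite !mxE /delta.
have x0 := tnth (in_tuple L) i.
by rewrite !(tnth_nth x0) /= nth_uniq.
Qed.

Lemma sum_delta (X : eqType) (L : seq X) (x : X) (G : X -> R) :
  uniq L -> x \in L -> \sum_(y <- L) delta x y * G y = G x.
Proof.
move=> uL xL; rewrite (bigD1_seq x) //= {1}/delta eqxx mul1r big1 ?addr0 // => y.
by rewrite /delta eq_sym => /negPf ->; rewrite mul0r.
Qed.

Lemma sum_deltar (X : eqType) (L : seq X) (x : X) (G : X -> R) :
  uniq L -> x \in L -> \sum_(y <- L) G y * delta y x = G x.
Proof.
move=> uL xL; rewrite (bigD1_seq x) //= {1}/delta eqxx mulr1 big1 ?addr0 // => y.
by rewrite /delta => /negPf ->; rewrite mulr0.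
Qed.

(** The sign of a reordering of a basis, as the torsion of the permutation matrix. *)
Definition psgn (X : eqType) (L L' : seq X) : K1 R := ltau (@delta X) L L'.

Section Reorder.
Variable X : eqType.
Implicit Types L A B : seq X.

Lemma delta_mull Y (F : X -> Y -> R) L L' M : uniq L' -> {subset L <= L'} ->
  mxof (@delta X) L L' *m mxof F L' M = mxof F L M.
Proof.
move=> u s; rewrite mxof_mul; apply/matrixP => i j; rewrite !mxE.
by rewrite (sum_delta (fun y => F y _)) // s // mem_tnth.
Qed.

Lemma delta_mulr Y (F : Y -> X -> R) L L' M : uniq L -> {subset L' <= L} ->
  mxof F M L *m mxof (@delta X) L L' = mxof F M L'.
Proof.
move=> u s; rewrite mxof_mul; apply/matrixP => i j; rewrite !mxE.
by rewrite (sum_deltar (fun y => F _ y)) // s // mem_tnth.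
Qed.

Lemma delta_iso L L' : uniq L -> perm_eq L L' ->
  mxof (@delta X) L L' *m mxof (@delta X) L' L = 1%:M /\
  mxof (@delta X) L' L *m mxof (@delta X) L L' = 1%:M.
Proof.
move=> u e; have u' : uniq L' by rewrite -(perm_uniq e).
have s := perm_mem e.
by split; rewrite delta_mull ?mxof_delta // => x; rewrite s.
Qed.

Lemma liso_delta L L' : uniq L -> perm_eq L L' -> liso (@delta X) L L'.
Proof. by move=> u e; exists (mxof (@delta X) L' L); apply: delta_iso. Qed.

Lemma liso_perm Y (F : X -> Y -> R) L L' M : uniq L -> perm_eq L L' ->
  liso F L' M -> liso F L M.
Proof.
move=> u e i; rewrite /liso -(@delta_mull _ _ _ L'); first 1 last.
- by rewrite -(perm_uniq e).
- by move=> x; rewrite (perm_mem e).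
by apply: mxisoM => //; apply: liso_delta.
Qed.

Lemma liso_permr Y (F : Y -> X -> R) L L' M : uniq L -> perm_eq L L' ->
  liso F M L -> liso F M L'.
Proof.
move=> u e i; rewrite /liso -(@delta_mulr _ _ L) //.
  by apply: mxisoM => //; apply: liso_delta.
by move=> x; rewrite (perm_mem e).
Qed.

Lemma ltau_perm Y (F : X -> Y -> R) L L' M : uniq L -> perm_eq L L' ->
  liso F L' M -> ltau F L M = psgn L L' + ltau F L' M.
Proof.
move=> u e i; rewrite /ltau -(@delta_mull _ _ _ L'); first 1 last.
- by rewrite -(perm_uniq e).
- by move=> x; rewrite (perm_mem e).
by rewrite tau_mul //; apply: liso_delta.
Qed.

Lemma ltau_permr Y (F : Y -> X -> R) L L' M : uniq L -> perm_eq L L' ->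
  liso F M L -> ltau F M L' = ltau F M L + psgn L L'.
Proof.
move=> u e i; rewrite /ltau -(@delta_mulr _ _ L) //.
  by rewrite tau_mul //; apply: liso_delta.
by move=> x; rewrite (perm_mem e).
Qed.

Lemma psgn_trans L L' L'' : uniq L -> perm_eq L L' -> perm_eq L' L'' ->
  psgn L L'' = psgn L L' + psgn L' L''.
Proof.
move=> u e e'; apply: ltau_perm => //; apply: liso_delta => //.
by rewrite -(perm_uniq e).
Qed.

Lemma psgn_id L : uniq L -> psgn L L = 0.
Proof. by move=> u; rewrite /psgn /ltau mxof_delta // tau1. Qed.

Lemma psgn_sym L L' : uniq L -> perm_eq L L' -> psgn L' L = - psgn L L'.
Proof. by move=> u e; have [e1 e2] := delta_iso u e; apply: tau_inv. Qed.

Lemma psgn_cat A A' B B' : uniq (A ++ B) -> perm_eq A A' -> perm_eq B B' ->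
  psgn (A ++ B) (A' ++ B') = psgn A A' + psgn B B'.
Proof.
rewrite cat_uniq => /and3P[uA /hasPn nAB uB] eA eB.
apply: (ltau_ublock _ (liso_delta uA eA) (liso_delta uB eB)).2 => x y xB yA.
rewrite /delta; case: eqP => // exy.
by have := nAB _ xB; rewrite exy /= (perm_mem eA) yA.
Qed.

Lemma psgn_swap1 (x y : X) : x != y -> psgn [:: x; y] [:: y; x] = tau_m1 R.
Proof.
move=> ne; rewrite /psgn /ltau.
have -> : mxof (@delta X) [:: x; y] [:: y; x] = swap_mx R 1 1.
  apply/matrixP => i j; rewrite /swap_mx !mxE /delta.
  case: (splitP (i : 'I_(1 + 1))) => i' ei; rewrite mxE; case: (splitP (j : 'I_(1 + 1))) => j' ej;
    rewrite !mxE !(tnth_nth x) /= ei ej !ord1 /= ?eqxx //; last by rewrite eq_sym (negPf ne).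
  by rewrite (negPf ne).
(* The quarter turn is a product of three elementary matrices; the transposition is its
   product with a diagonal matrix of torsion tau(-1). *)
pose E : 'M[R]_(1 + 1) := block_mx 1%:M (- 1%:M) 0 1%:M.
pose F : 'M[R]_(1 + 1) := block_mx 1%:M 0 1%:M 1%:M.
have i1 : mxiso (- 1%:M : 'M[R]_1) by exists (- 1%:M); rewrite mulNmx mulmxN opprK mulmx1.
have iE : mxiso E by apply: mxiso_unip.
have [iF tF] := tau_lblock hR (1%:M : 'M_1) (mxiso1 R 1) (mxiso1 R 1).
have [iD tD] := tau_ublock hR (0 : 'M_1) i1 (mxiso1 R 1).
have -> : swap_mx R 1 1 = block_mx (- 1%:M) 0 0 1%:M *m (E *m F *m E).
  rewrite /E /F !mulmx_block !(mulmx1, mul1mx, mulmx0, mul0mx, addr0, add0r).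
  by rewrite !(addrN, addNr, mulmxN, mulNmx, mul1mx, mulmx1, mul0mx, mulmx0, oppr0, opprK, addr0, add0r).
rewrite !tau_mul //; try by do ?apply: mxisoM.
by rewrite tF tD /E tau_unip // tau1 !addr0.
Qed.

Lemma perm_swap2 x y B : perm_eq [:: x, y & B] [:: y, x & B].
Proof. by apply/permP => p /=; rewrite addnCA. Qed.

Lemma psgn_cons_cat x B : uniq (x :: B) ->
  psgn (x :: B) (B ++ [:: x]) = sgb R (odd (size B)).
Proof.
elim: B => [|y B IH]; first by move=> u; rewrite psgn_id.
rewrite [x :: y :: B]/= => u; rewrite (@psgn_trans _ [:: y, x & B]) //; first 1 last.
- exact: perm_swap2.
- by rewrite /= perm_cons -cat1s perm_catC.
have uxB : uniq (x :: B) by move: u; rewrite /= !inE !negb_or; case/and3P=> /andP[_ ->] _ ->.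
rewrite (@psgn_cat [:: x; y] [:: y; x] B B) //; last exact: perm_swap2.
rewrite psgn_swap1; last by move: u; rewrite /= !inE !negb_or; case/and3P=> /andP[].
rewrite (@psgn_cat [:: y] [:: y] (x :: B) (B ++ [:: x])) //; first 1 last.
- by rewrite -(perm_uniq (perm_swap2 x y B)).
- by rewrite -cat1s perm_catC.
rewrite !psgn_id // ?IH // ?addr0 ?add0r.
  by rewrite -[tau_m1 R]/(sgb R true) -sgbD.
by move: uxB => /andP[].
Qed.

(** The two blocks are exchanged by moving the elements of [A] one at a time past [B]. *)
Lemma psgn_catC A B : uniq (A ++ B) ->
  psgn (A ++ B) (B ++ A) = sgb R (odd (size A) && odd (size B)).
Proof.
elim: A => [|x A IH]; first by rewrite cats0 => u; rewrite psgn_id.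
rewrite /= => u; have uAB : uniq (A ++ B) by case/andP: u.
rewrite (@psgn_trans _ (x :: (B ++ A))) //; first 1 last.
- by rewrite perm_cons perm_catC.
- by rewrite -cat1s -[x :: A]cat1s perm_catCA.
rewrite (@psgn_cat [:: x] [:: x] (A ++ B) (B ++ A)) //; last by rewrite perm_catC.
have uBA : uniq (x :: (B ++ A)).
  have e : perm_eq (x :: A ++ B) (x :: B ++ A) by rewrite perm_cons (permEl (perm_catC A B)).
  by rewrite -(perm_uniq e).
have uxB : uniq (x :: B).
  by move: uBA; rewrite -cat_cons cat_uniq => /and3P[].
have -> : B ++ x :: A = (B ++ [:: x]) ++ A by rewrite -catA.
rewrite -cat_cons (@psgn_cat (x :: B) (B ++ [:: x]) A A) //; last by rewrite -cat1s perm_catC.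
rewrite !psgn_id // ?IH ?psgn_cons_cat // ?add0r ?addr0; last first.
  by move: uAB; rewrite cat_uniq => /and3P[].
by rewrite -sgbD; case: (odd (size A)); case: (odd (size B)).
Qed.

End Reorder.
End ListMatrix.

(** * Torsion of graded maps *)

Section Graded.
Variables (R : pzRingType) (hR : invariant_rank R).

(** A basis element of a graded module is a pair (degree, index), so that the sum of the
    modules in a list of degrees has a basis that can be cut and reordered as a list. *)
Definition blk (p : int -> nat) (r : int) : seq (int * nat) :=
  [seq (r, k) | k <- iota 0 (p r)].

Definition basis (p : int -> nat) (l : seq int) : seq (int * nat) :=
  flatten [seq blk p r | r <- l].

Definition gmap (a b : int -> nat) := forall p q : int, 'M[R]_(b q, a p).

(** A total function on pairs of basis elements, so that [mxof] applies to it in all lists. *)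
Definition ent a b (f : gmap a b) (x y : int * nat) : R :=
  match insub x.2, insub y.2 with
  | Some i, Some j => f y.1 x.1 i j
  | _, _ => 0
  end.

Definition gid a : gmap a a :=
  fun p q => \matrix_(i, j) ((p == q) && (i == j :> nat))%:R.

Definition gmul a b c (l : seq int) (g : gmap b c) (f : gmap a b) : gmap a c :=
  fun p r => \sum_(q <- l) g q r *m f p q.

Lemma gid1 a p : gid a p p = 1%:M.
Proof. by apply/matrixP => i j; rewrite !mxE eqxx. Qed.

Lemma gid0 a p q : p != q -> gid a p q = 0.
Proof. by move=> /negPf ne; apply/matrixP => i j; rewrite !mxE ne. Qed.

Lemma basis_cons p r l : basis p (r :: l) = blk p r ++ basis p l.
Proof. by []. Qed.

Lemma mem_blk p r x : (x \in blk p r) = (x.1 == r) && (x.2 < p r)%N.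
Proof.
case: x => s k; apply/mapP/andP => /= [[j]|[/eqP -> lt]].
  by rewrite mem_iota => /andP[_ lt] [-> ->].
by exists k; rewrite ?mem_iota.
Qed.

Lemma mem_basis p l x : (x \in basis p l) = (x.1 \in l) && (x.2 < p x.1)%N.
Proof.
apply/flatten_mapP/andP => [[r rl]|[xl lt]].
  by rewrite mem_blk => /andP[/eqP -> ->].
by exists x.1 => //; rewrite mem_blk eqxx.
Qed.

Lemma basis_uniq p l : uniq l -> uniq (basis p l).
Proof.
elim: l => // r l IH /andP[nr ul]; rewrite basis_cons cat_uniq IH // andbT.
rewrite map_inj_uniq ?iota_uniq /=; last by move=> i j [].
apply/hasPn => x; rewrite mem_basis mem_blk => /andP[xl _].
by apply: contra nr => /andP[/eqP <-].
Qed.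

Lemma size_blk p r : size (blk p r) = p r.
Proof. by rewrite size_map size_iota. Qed.

Lemma odd_size_basis p l : odd (size (basis p l)) = \sum_(r <- l) odd (p r).
Proof.
elim: l => [|r l IH]; first by rewrite big_nil.
by rewrite basis_cons size_cat size_blk oddD IH big_cons.
Qed.

Lemma insub_geq n k : (n <= k)%N -> insub k = None :> option 'I_n.
Proof. by move=> le; rewrite insubN // -leqNgt. Qed.

Lemma entE a b (f : gmap a b) (p q : int) (i : 'I_(b q)) (j : 'I_(a p)) :
  ent f (q, i : nat) (p, j : nat) = f p q i j.
Proof. by rewrite /ent /= !valK. Qed.

Lemma ent_ext a b (f g : gmap a b) x y :
  f y.1 x.1 = g y.1 x.1 -> ent f x y = ent g x y.
Proof. by rewrite /ent => ->. Qed.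

Lemma ent0 a b (f : gmap a b) x y : f y.1 x.1 = 0 -> ent f x y = 0.
Proof. by rewrite /ent => ->; case: insub => // i; case: insub => // j; rewrite mxE. Qed.

Lemma sum_basis p l (F : int * nat -> R) :
  \sum_(x <- basis p l) F x = \sum_(r <- l) \sum_(i < p r) F (r, i : nat).
Proof.
rewrite /basis big_flatten big_map; apply: eq_bigr => r _.
by rewrite /blk big_map -{1}[p r]subn0 big_mkord.
Qed.

Lemma ent_mul a b c (l : seq int) (g : gmap b c) (f : gmap a b) x z :
  \sum_(y <- basis b l) ent g x y * ent f y z = ent (gmul l g f) x z.
Proof.
rewrite sum_basis; case: x z => [r i] [p j].
have [lti|lei] := ltnP i (c r); last first.
  have out d e (h : gmap d c) (s : int) m : @ent d c h (r, i) (s, m) = e -> e = 0.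
    by rewrite /ent /= insub_geq.
  rewrite (out _ _ _ _ _ (erefl (ent (gmul l g f) _ _))) big1 // => q _.
  by rewrite big1 // => k _; rewrite (out _ _ _ _ _ (erefl (ent g _ _))) mul0r.
have [ltj|lej] := ltnP j (a p); last first.
  rewrite big1 => [|q _]; last first.
    by rewrite big1 // => k _; rewrite [ent f _ _]/ent /= (insub_geq lej); case: insub => *; rewrite mulr0.
  by rewrite /ent /= (insub_geq lej); case: insub.
rewrite -[i]/(val (Ordinal lti)) -[j]/(val (Ordinal ltj)) entE /gmul summxE.
by apply: eq_bigr => q _; rewrite mxE; apply: eq_bigr => k _; rewrite !entE.
Qed.

Lemma mxof_gmul a b c l l' l'' (g : gmap b c) (f : gmap a b) :
  mxof (ent g) (basis c l'') (basis b l') *m mxof (ent f) (basis b l') (basis a l)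
  = mxof (ent (gmul l' g f)) (basis c l'') (basis a l).
Proof. by rewrite mxof_mul; apply: mxof_ext => x z _ _; apply: ent_mul. Qed.

Definition gtau a b (f : gmap a b) (l' l : seq int) := ltau (ent f) (basis b l') (basis a l).
Definition giso a b (f : gmap a b) (l' l : seq int) := liso (ent f) (basis b l') (basis a l).

Lemma gtau_ext a b (f g : gmap a b) l' l :
  {in l & l', forall p q, f p q = g p q} -> gtau f l' l = gtau g l' l.
Proof.
move=> h; apply: ltau_ext => x y; rewrite !mem_basis => /andP[xl _] /andP[yl _].
by apply: ent_ext; apply: h.
Qed.

Lemma gtau_mul a b c l l' l'' (g : gmap b c) (f : gmap a b) :
  giso g l'' l' -> giso f l' l ->
  giso (gmul l' g f) l'' l /\ gtau (gmul l' g f) l'' l = gtau g l'' l' + gtau f l' l.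
Proof.
move=> ig jf; rewrite /giso /liso /gtau /ltau -mxof_gmul.
by split; [exact: mxisoM | exact: tau_mul].
Qed.

Lemma mxof_blk a b (f : gmap a b) p q :
  mxof (ent f) (blk b q) (blk a p) = castmx (esym (size_blk b q), esym (size_blk a p)) (f p q).
Proof.
apply/matrixP => i j; rewrite castmxE !mxE.
have tnth_blk c r k : tnth (in_tuple (blk c r)) k = (r, cast_ord (size_blk c r) k : nat).
  rewrite (tnth_nth (r, 0%N)) /= (nth_map 0%N) ?nth_iota ?add0n //.
    by rewrite -(size_blk c) ltn_ord.
  by rewrite size_iota -(size_blk c) ltn_ord.
by rewrite !tnth_blk entE; congr (f p q _ _); apply: val_inj.
Qed.

Lemma gtau_blk a b (f : gmap a b) p q : gtau f [:: q] [:: p] = tau (f p q).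
Proof. by rewrite /gtau /basis /= !cats0 /ltau mxof_blk tau_cast. Qed.

Lemma giso_blk a b (f : gmap a b) p q : giso f [:: q] [:: p] <-> mxiso (f p q).
Proof. by rewrite /giso /basis /= !cats0 /liso mxof_blk mxiso_cast. Qed.

(** In increasing order of the degrees the matrix is block triangular. *)
Lemma gtau_up a b (f : gmap a b) l : sorted <%R l ->
  {in l, forall r, mxiso (f r r)} -> {in l & l, forall p q, q < p -> f p q = 0} ->
  giso f l l /\ gtau f l l = \sum_(r <- l) tau (f r r).
Proof.
elim: l => [|r l IH]; first by move=> *; rewrite big_nil; split; [exact: liso_nil|exact: ltau_nil].
move=> sl hd hz; have allr := order_path_min lt_trans sl.
have [iI tI] : giso f l l /\ gtau f l l = \sum_(r <- l) tau (f r r).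
  apply: IH; first exact: path_sorted sl.
    by move=> s sl'; apply: hd; rewrite inE sl' orbT.
  by move=> s t sl' tl'; apply: hz; rewrite inE ?sl' ?tl' orbT.
rewrite big_cons -tI -(gtau_blk f) /gtau /giso !(basis_cons _ r) {2 5}/basis /= !cats0.
have i1 : liso (ent f) (blk b r) (blk a r).
  by have /giso_blk := hd r (mem_head _ _); rewrite /giso /basis /= !cats0.
apply: ltau_lblock => // x y; rewrite mem_blk mem_basis => /andP[/eqP ex _] /andP[yl _].
apply: ent0; rewrite ex; apply: hz; rewrite ?mem_head // ?inE ?yl ?orbT //.
by move/allP: allr; apply.
Qed.

Lemma gtau_down a b (f : gmap a b) l : sorted <%R l ->
  {in l, forall r, mxiso (f r r)} -> {in l & l, forall p q, p < q -> f p q = 0} ->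
  giso f l l /\ gtau f l l = \sum_(r <- l) tau (f r r).
Proof.
elim: l => [|r l IH]; first by move=> *; rewrite big_nil; split; [exact: liso_nil|exact: ltau_nil].
move=> sl hd hz; have allr := order_path_min lt_trans sl.
have [iI tI] : giso f l l /\ gtau f l l = \sum_(r <- l) tau (f r r).
  apply: IH; first exact: path_sorted sl.
    by move=> s sl'; apply: hd; rewrite inE sl' orbT.
  by move=> s t sl' tl'; apply: hz; rewrite inE ?sl' ?tl' orbT.
rewrite big_cons -tI -(gtau_blk f) /gtau /giso !(basis_cons _ r) {2 5}/basis /= !cats0.
have i1 : liso (ent f) (blk b r) (blk a r).
  by have /giso_blk := hd r (mem_head _ _); rewrite /giso /basis /= !cats0.
apply: ltau_ublock => // x y; rewrite mem_blk mem_basis => /andP[xl _] /andP[/eqP ey _].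
apply: ent0; rewrite ey; apply: hz; rewrite ?mem_head // ?inE ?xl ?orbT //.
by move/allP: allr; apply.
Qed.

End Graded.

(** * Signs of shuffles of blocks *)

Section BlockOrders.
Variables (R : pzRingType) (hR : invariant_rank R).

(** The number of inversions, modulo 2, of the shuffle that moves all elements counted by [a]
    in front of all elements counted by [b], when both are listed by increasing degree. *)
Definition lowsum (l : seq int) (a b : int -> bool) : bool :=
  \sum_(i <- l) \sum_(j <- l) ((j < i) && (a i && b j)).

Lemma sum_andl (I : Type) (l : seq I) (F : I -> bool) (c : bool) :
  \sum_(i <- l) (F i && c) = (\sum_(i <- l) F i) && c.
Proof.
by elim: l => [|r l IH]; rewrite ?big_nil // !big_cons IH -[RHS]/(_ * c) mulrDl.
Qed.

Lemma sum_andr (I : Type) (l : seq I) (F : I -> bool) (c : bool) :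
  \sum_(i <- l) (c && F i) = c && (\sum_(i <- l) F i).
Proof. by rewrite andbC -sum_andl; apply: eq_bigr => i _; rewrite andbC. Qed.

Lemma sorted_gt (r : int) l : sorted <%R (r :: l) -> {in l, forall s, r < s}.
Proof. by move=> s; apply/allP/(order_path_min lt_trans s). Qed.

Lemma lowsum_cons r l a b : sorted <%R (r :: l) ->
  lowsum (r :: l) a b = ((\sum_(i <- l) a i) && b r) + lowsum l a b.
Proof.
move=> /sorted_gt h; rewrite /lowsum !big_cons ltxx /= add0r.
rewrite [X in X + _]big1_seq => [|j /andP[_ jl]]; last first.
  by rewrite ltNge ltW //= h.
rewrite add0r -sum_andl -big_split /=; apply: eq_big_seq => i il.
by rewrite big_cons h.
Qed.

Section Orders.
Variable X : eqType.
Implicit Types A B : int -> seq X.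
Local Notation fl A l := (flatten [seq A r | r <- l]).
Local Notation opar A := (fun r => odd (size (A r))).

Lemma odd_size_fl A l : odd (size (fl A l)) = \sum_(r <- l) odd (size (A r)).
Proof.
by elim: l => [|r l IH]; rewrite ?big_nil //= size_cat oddD IH big_cons.
Qed.

Lemma perm_interleave A B l :
  perm_eq (fl (fun r => A r ++ B r) l) (fl A l ++ fl B l).
Proof.
elim: l => //= r l IH; apply/permP => p; move/permP/(_ p): IH.
by rewrite !count_cat => ->; lia.
Qed.

Lemma perm_twist A B l :
  perm_eq (fl (fun r => A r ++ B r) l) (fl (fun r => B r ++ A r) l).
Proof.
elim: l => //= r l IH; apply/permP => p; move/permP/(_ p): IH.
by rewrite !count_cat => ->; lia.
Qed.

Lemma psgn_interleave A B l : sorted <%R l -> uniq (fl (fun r => A r ++ B r) l) ->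
  psgn R (fl (fun r => A r ++ B r) l) (fl A l ++ fl B l)
  = sgb R (lowsum l (opar A) (opar B)).
Proof.
elim: l => [|r l IH] sl u; first by rewrite /lowsum big_nil psgn_id.
rewrite lowsum_cons // sgbD.
have e := perm_interleave A B l.
have e1 : perm_eq (fl (fun r => A r ++ B r) (r :: l)) ((A r ++ B r) ++ (fl A l ++ fl B l)).
  by rewrite /= perm_cat2l.
rewrite (psgn_trans hR u e1); last first.
  by apply/permP => p /=; rewrite !count_cat; lia.
have u1 : uniq ((A r ++ B r) ++ (fl A l ++ fl B l)) by rewrite -(perm_uniq e1).
have [uAB uF] : uniq (A r ++ B r) /\ uniq (fl (fun r => A r ++ B r) l).
  by move: u; rewrite /= cat_uniq => /and3P[].
have -> : fl A (r :: l) ++ fl B (r :: l) = A r ++ (fl A l ++ B r) ++ fl B l.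
  by rewrite /= -!catA.
have -> : psgn R (fl (fun r => A r ++ B r) (r :: l)) ((A r ++ B r) ++ (fl A l ++ fl B l))
    = sgb R (lowsum l (opar A) (opar B)).
  rewrite (_ : fl (fun r => A r ++ B r) (r :: l) = (A r ++ B r) ++ fl (fun r => A r ++ B r) l) //.
  rewrite (psgn_cat hR (A := A r ++ B r)) // psgn_id // add0r.
  by rewrite IH //; apply: path_sorted sl.
rewrite addrC; congr (_ + _).
have -> : (A r ++ B r) ++ fl A l ++ fl B l = A r ++ (B r ++ fl A l) ++ fl B l.
  by rewrite -!catA.
have u2 : uniq ((B r ++ fl A l) ++ fl B l).
  by move: u1; rewrite -catA cat_uniq catA => /and3P[].
have uA : uniq (A r) by move: uAB; rewrite cat_uniq => /and3P[].
have p1 : perm_eq (B r ++ fl A l) (fl A l ++ B r) by rewrite perm_catC.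
rewrite (psgn_cat hR (A := A r)) //; first 1 last.
- by move: u1; rewrite -!catA.
- by rewrite perm_cat2r.
rewrite (psgn_id R uA) add0r (psgn_cat hR (A := B r ++ fl A l)) //.
move: u2; rewrite cat_uniq => /and3P[u2 _ u3].
by rewrite (psgn_catC hR) // psgn_id // addr0 odd_size_fl andbC.
Qed.

Lemma psgn_twist A B l : uniq (fl (fun r => A r ++ B r) l) ->
  psgn R (fl (fun r => A r ++ B r) l) (fl (fun r => B r ++ A r) l)
  = sgb R (\sum_(r <- l) (odd (size (A r)) && odd (size (B r)))).
Proof.
elim: l => [|r l IH] u; first by rewrite big_nil psgn_id.
rewrite big_cons sgbD /= (psgn_cat hR) //; last exact: perm_twist.
  by move: u; rewrite /= cat_uniq => /and3P[u1 _ u2]; rewrite psgn_catC // IH.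
by rewrite perm_catC.
Qed.

Lemma perm_rev_fl A l : perm_eq (fl A (rev l)) (fl A l).
Proof. by apply/perm_flatten/perm_map; rewrite perm_rev. Qed.

Lemma psgn_rev A l : sorted <%R l -> uniq (fl A l) ->
  psgn R (fl A (rev l)) (fl A l) = sgb R (lowsum l (opar A) (opar A)).
Proof.
elim: l => [|r l IH] sl u; first by rewrite /lowsum big_nil psgn_id.
rewrite lowsum_cons // sgbD rev_cons -cats1 map_cat flatten_cat /= cats0.
have e := perm_rev_fl A l.
have u1 : uniq (fl A (rev l) ++ A r).
  rewrite (perm_uniq (_ : perm_eq _ (fl A (r :: l)))) //=.
  by rewrite perm_catC perm_cat2l.
have [uA uF] : uniq (A r) /\ uniq (fl A l) by move: u; rewrite /= cat_uniq => /and3P[].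
rewrite (@psgn_trans _ hR _ _ (A r ++ fl A (rev l))) //; first 1 last.
- by rewrite perm_catC.
- by rewrite perm_cat2l.
rewrite psgn_catC // (psgn_cat hR) //; last by rewrite (perm_uniq (_ : perm_eq _ (fl A (rev l) ++ A r))) // perm_catC.
rewrite psgn_id // add0r IH //; last exact: path_sorted sl.
by rewrite !odd_size_fl (perm_big l) //= perm_rev.
Qed.

End Orders.
End BlockOrders.

(** * Independence of the torsion from the contraction *)

Notation oddz r := (odd (absz r%R)).

Section Covers.

(** The torsion of a complex is computed on the sums of the [C_r] over all [r] of a given parity.
    Any list of degrees that contains the nonzero ones may serve, but it must be increasing, as
    reordering it changes torsions by a sign. *)
Definition covers (c : bool) (p : int -> nat) (l : seq int) : Prop :=
  [/\ sorted <%R l, {in l, forall r, oddz r = c}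
    & forall r, oddz r = c -> p r != 0%N -> r \in l].

Lemma basis_filter p l : basis p l = basis p [seq r <- l | p r != 0%N].
Proof.
elim: l => //= r l IH; case: eqVneq => [e|_]; rewrite /= !basis_cons -IH //.
by rewrite /blk e.
Qed.

Lemma basis_sorted_eq p l l' : sorted <%R l -> sorted <%R l' ->
  (forall r, p r != 0%N -> (r \in l) = (r \in l')) -> basis p l = basis p l'.
Proof.
move=> sl sl' h; rewrite basis_filter [RHS]basis_filter.
congr basis; apply: (irr_sorted_eq lt_trans ltxx).
- exact: sorted_filter lt_trans _ _ sl.
- exact: sorted_filter lt_trans _ _ sl'.
by move=> r; rewrite !mem_filter; case: (p r != 0%N) (h r) => //= ->.
Qed.

Lemma covers_basis c p l l' : covers c p l -> covers c p l' -> basis p l = basis p l'.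
Proof.
move=> [sl cl hl] [sl' cl' hl']; apply: basis_sorted_eq => // r pr.
by apply/idP/idP => m; [apply: hl' => //; apply: cl | apply: hl => //; apply: cl'].
Qed.

Lemma covers_uniq c p l : covers c p l -> uniq l.
Proof. by case=> s _ _; apply: lt_sorted_uniq. Qed.

Definition evl (N : nat) : seq int := [seq 2 * (i%:Z - N%:Z) | i <- iota 0 N.*2.+1].
Definition odl (N : nat) : seq int := [seq 2 * (i%:Z - N%:Z) + 1 | i <- iota 0 N.*2.+1].

Lemma sorted_map_iota (g : nat -> int) m k : {homo g : i j / (i < j)%N >-> i < j} ->
  sorted <%R [seq g i | i <- iota m k].
Proof. by move=> h; apply: (homo_sorted h); apply: iota_ltn_sorted. Qed.

Lemma covers_evl N p : (forall r, (N < `|r|)%N -> p r = 0%N) -> covers false p (evl N).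
Proof.
move=> h; split.
- by apply: sorted_map_iota => i j; lia.
- by move=> r /mapP[i _ ->]; lia.
move=> r er /eqP pr; have le : (`|r| <= N)%N by rewrite leqNgt; apply/negP => /h.
apply/mapP; exists `|((r %/ 2)%Z + N%:Z)%R|%N; first by rewrite mem_iota; lia.
by lia.
Qed.

Lemma covers_odl N p : (forall r, (N < `|r|)%N -> p r = 0%N) -> covers true p (odl N).
Proof.
move=> h; split.
- by apply: sorted_map_iota => i j; lia.
- by move=> r /mapP[i _ ->]; lia.
move=> r er /eqP pr; have le : (`|r| <= N)%N by rewrite leqNgt; apply/negP => /h.
apply/mapP; exists `|((r %/ 2)%Z + N%:Z)%R|%N; first by rewrite mem_iota; lia.
by lia.
Qed.

End Covers.

Section Unsigned.
Variables (R : pzRingType) (hR : invariant_rank R).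

Lemma mx_rk0l m n (A : 'M[R]_(m, n)) : m = 0%N -> A = 0.
Proof. by move=> em; subst; apply/matrixP => -[]. Qed.

Lemma mxiso_factor m n (A : 'M[R]_(m, n)) (B : 'M[R]_(n, m)) :
  mxiso (A *m B) -> mxiso (B *m A) -> mxiso A.
Proof.
move=> [X [x1 _]] [Y [_ y2]]; exists (Y *m B).
have e : Y *m B = B *m X.
  by rewrite -[LHS]mulmx1 -x1 !mulmxA -(mulmxA Y) y2 mul1mx.
by split; [rewrite e mulmxA x1 | rewrite -mulmxA y2].
Qed.

Definition dG (C : complex R) (G : gmap R (rk C) (rk C)) : gmap R (rk C) (rk C) :=
  fun p q => df C p q + G p q.

Section Contraction.
Variables (C : complex R) (G G' : gmap R (rk C) (rk C)).
Hypotheses (cG : chain_contraction G) (cG' : chain_contraction G').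

Lemma sum_neighbours c (l : seq int) (V : nmodType) (p : int) (F : int -> V) :
  covers (~~ c) (rk C) l -> oddz p = c ->
  (forall q, rk C q = 0%N -> F q = 0) ->
  (forall q, q != p - 1 -> q != p + 1 -> F q = 0) ->
  \sum_(q <- l) F q = F (p - 1) + F (p + 1).
Proof.
move=> cl ep h0 hF; have ul := covers_uniq cl; case: cl => _ _ hl.
have pick q : oddz q = ~~ c -> q \notin l -> F q = 0.
  by move=> eq nq; apply: h0; apply/eqP; apply: contraNT nq => /hl; apply.
have e1 : oddz (p - 1) = ~~ c by lia.
have e2 : oddz (p + 1) = ~~ c by lia.
have ne : p - 1 != p + 1 by lia.
have sum1 q l' : uniq l' -> (q \notin l' -> F q = 0) ->
    \sum_(i <- l') F i = F q + \sum_(i <- l' | i != q) F i.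
  move=> u hq; have [qi|qi] := boolP (q \in l'); first by rewrite (bigD1_seq q).
  rewrite hq // add0r big_seq_cond [RHS]big_seq_cond; apply: eq_bigl => i.
  by case: eqVneq => [->|]; rewrite ?andbT // (negPf qi).
rewrite (sum1 (p - 1)) //; last exact: pick e1.
congr (_ + _); rewrite -big_filter (sum1 (p + 1)) ?filter_uniq //; last first.
  by rewrite mem_filter eq_sym ne /=; apply: pick e2.
by rewrite big_filter_cond big1 ?addr0 // => q /andP[q1 q2]; apply: hF.
Qed.

(** The part of degree 0 of (d + G')(d + G), which is block triangular with respect to degrees
    because its part of degree -2 is d d = 0. *)
Definition diag0 p : 'M[R]_(rk C p) :=
  1%:M + (G' (p - 1) p - G (p - 1) p) *m df C p (p - 1).

Lemma contraction_dh p :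
  df C p (p - 1) *m (G' (p - 1) p - G (p - 1) p)
  = - ((G' (p - 1 - 1) (p - 1) - G (p - 1 - 1) (p - 1)) *m df C (p - 1) (p - 1 - 1)).
Proof.
have := cG.2 (p - 1); have := cG'.2 (p - 1); rewrite !subrK => <- /eqP.
rewrite -subr_eq0 => /eqP e; apply/eqP; rewrite -addr_eq0 mulmxBr mulmxBl.
by apply/eqP; rewrite -[RHS]oppr0 -e opprB opprD addrACA.
Qed.

(** With [h = G' - G] this is 1 + h d, and (h d)^2 = 0 since d h = - h d. Hence its inverse in
    degree p - 1 is 1 - h d = 1 + d h, whose torsion is that of 1 + h d in degree p by
    Whitehead's identity. *)
Lemma diag0_iso p : mxiso (diag0 p) /\ tau (diag0 p) = - tau (diag0 (p - 1)).
Proof.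
pose h q := G' (q - 1) q - G (q - 1) q.
have nil q : (h q *m df C q (q - 1)) *m (h q *m df C q (q - 1)) = 0.
  rewrite -mulmxA (mulmxA (df C _ _)) contraction_dh mulNmx mulmxN -mulmxA df_df.
  by rewrite !mulmx0 oppr0.
have inv q : diag0 q *m (1%:M - h q *m df C q (q - 1)) = 1%:M /\
    (1%:M - h q *m df C q (q - 1)) *m diag0 q = 1%:M.
  rewrite /diag0 -/(h q); split.
    by rewrite mulmxDl !mulmxBr nil !mul1mx mulmx1 subr0 subrK.
  by rewrite mulmxBl !mulmxDr nil !mul1mx mulmx1 addr0 addrK.
have iso q : mxiso (diag0 q) by exists (1%:M - h q *m df C q (q - 1)); apply: inv.
split=> //; have [i1 i2] := inv (p - 1).
have i3 : mxiso (1%:M + df C p (p - 1) *m h p).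
  by rewrite contraction_dh -/(h (p - 1)); exists (diag0 (p - 1)); split.
rewrite -(tau_inv hR i1 i2) [X in tau X = _]/diag0 -/(h p) (tau_1DM hR) //.
by rewrite contraction_dh.
Qed.

(** By [diag0_iso] the torsion is determined up to sign by the one in the degree below, and it
    vanishes in low degrees. *)
Lemma tau_diag0 p : tau (diag0 p) = 0.
Proof.
have base q : (bd C < `|q|)%N -> tau (diag0 q) = 0.
  move=> /rk_bd e; rewrite (_ : diag0 q = 1%:M) ?tau1 //.
  by rewrite [LHS]mx_rk0l // [RHS]mx_rk0l.
have step k : tau (diag0 (k%:Z - (bd C)%:Z - 1)) = 0.
  elim: k => [|k IH]; first by apply: base; lia.
  rewrite (diag0_iso _).2 (_ : _ - 1 - 1 = k%:Z - (bd C)%:Z - 1) ?IH ?oppr0 //.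
  by lia.
have [le|lt] := leqP `|p| (bd C); last exact: base.
rewrite -(step `|(p + (bd C)%:Z + 1)%R|%N); congr (tau (diag0 _)).
by lia.
Qed.

Lemma gmul_dG c l p : covers (~~ c) (rk C) l -> oddz p = c ->
  gmul l (dG G') (dG G) p p = diag0 p.
Proof.
move=> cl ep; rewrite /gmul (sum_neighbours cl ep); first 1 last.
- by move=> q e; rewrite [dG G _ _](mx_rk0l _ e) mulmx0.
- by move=> q n1 n2; rewrite /dG (df_deg C n1) cG.1 // addr0 mulmx0.
rewrite /= /dG (cG.1 p (p - 1)) ?(@df_deg _ _ (p - 1) p) ?(@df_deg _ _ p (p + 1)); try lia.
rewrite (cG'.1 (p + 1) p); last by lia.
rewrite !(addr0, add0r) /diag0 -(cG.2 p) mulmxBl addrC -!addrA; congr (_ + _).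
by rewrite addrC subrK.
Qed.

Lemma gmul_dG0 c l p r : covers (~~ c) (rk C) l -> oddz p = c -> oddz r = c -> r < p ->
  gmul l (dG G') (dG G) p r = 0.
Proof.
move=> cl ep er lt; rewrite /gmul (sum_neighbours cl ep); first 1 last.
- by move=> q e; rewrite [dG G _ _](mx_rk0l _ e) mulmx0.
- by move=> q n1 n2; rewrite /dG (df_deg C n1) cG.1 // addr0 mulmx0.
rewrite /= /dG (cG.1 p (p - 1)) ?(@df_deg _ _ (p + 1) r) ?(@df_deg _ _ p (p + 1)); try lia.
rewrite (cG'.1 (p + 1) r) ?(cG'.1 (p - 1) r); try lia.
by rewrite !(addr0, add0r) df_df mul0mx addr0.
Qed.

Lemma gtau_square c l l' : covers c (rk C) l -> covers (~~ c) (rk C) l' ->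
  giso (gmul l' (dG G') (dG G)) l l /\ gtau (gmul l' (dG G') (dG G)) l l = 0.
Proof.
move=> cl cl'; have [sl el _] := cl.
have [|p q pl ql|i ->] := @gtau_up _ hR _ _ (gmul l' (dG G') (dG G)) l sl.
- by move=> p pl; rewrite (gmul_dG cl' (el _ pl)); apply: (diag0_iso _).1.
- by move=> lt; apply: (gmul_dG0 cl'); rewrite ?el.
split=> //; rewrite big1_seq // => p /andP[_ pl].
by rewrite (gmul_dG cl' (el _ pl)) tau_diag0.
Qed.

End Contraction.

Lemma giso_dG (C : complex R) (G : gmap R (rk C) (rk C)) c l l' : chain_contraction G ->
  covers c (rk C) l -> covers (~~ c) (rk C) l' -> giso (dG G) l' l.
Proof.
move=> cG cl cl'; rewrite /giso /liso; have cl2 : covers (~~ ~~ c) (rk C) l by rewrite negbK.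
have [i1 _] := gtau_square cG cG cl cl'; have [i2 _] := gtau_square cG cG cl' cl2.
by apply: (mxiso_factor (B := mxof (ent (dG G)) (basis (rk C) l) (basis (rk C) l')));
  rewrite mxof_gmul.
Qed.

(** The odd-to-even matrix of d + G and the even-to-odd matrix of d + G' are inverse to each
    other up to a matrix of torsion 0. As this holds for all pairs of contractions, the torsion
    of d + G does not depend on G. *)
Lemma gtau_dGN (C : complex R) (G G' : gmap R (rk C) (rk C)) c l l' :
  chain_contraction G -> chain_contraction G' ->
  covers c (rk C) l -> covers (~~ c) (rk C) l' -> gtau (dG G') l l' = - gtau (dG G) l' l.
Proof.
move=> cG cG' cl cl'; have cl2 : covers (~~ ~~ c) (rk C) l by rewrite negbK.
have [_ e] := gtau_square cG cG' cl cl'; apply/eqP; rewrite -addr_eq0 -e.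
have [_ ->] := gtau_mul hR (giso_dG cG' cl' cl2) (giso_dG cG cl cl').
by [].
Qed.

Lemma gtau_dG (C : complex R) (G G' : gmap R (rk C) (rk C)) c l l' m m' :
  chain_contraction G -> chain_contraction G' ->
  covers c (rk C) l -> covers (~~ c) (rk C) l' ->
  covers c (rk C) m -> covers (~~ c) (rk C) m' -> gtau (dG G') l' l = gtau (dG G) m' m.
Proof.
move=> cG cG' cl cl' cm cm'.
rewrite /gtau -(covers_basis cl cm) -(covers_basis cl' cm') -!/(gtau _ _ _).
have cl2 : covers (~~ ~~ c) (rk C) l by rewrite negbK.
by rewrite (gtau_dGN cG cG' cl' cl2) (gtau_dGN cG cG cl' cl2).
Qed.

(** Compares the numbering of the rows of a matrix of blocks with the order of [basis]. *)
Lemma nth_basis_sig k (p : int -> nat) (g : 'I_k -> int) (s : 'I_(\sum_i p (g i))) x0 :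
  nth x0 (basis p [seq g i | i <- enum 'I_k]) s =
  (g (tagnat.sig1 s), tagnat.sig2 s : nat).
Proof.
set sh := shape [seq blk p r | r <- [seq g i | i <- enum 'I_k]].
have shE : sh = [seq p (g i) | i <- enum 'I_k].
  by rewrite /sh /shape -!map_comp; apply: eq_map => i /=; rewrite size_blk.
have lt : (tagnat.sig1 s < size (enum 'I_k))%N by rewrite size_enum_ord.
have nthi x : nth x (enum 'I_k) (tagnat.sig1 s) = tagnat.sig1 s by rewrite nth_ord_enum.
have es : s = flatten_index sh (tagnat.sig1 s) (tagnat.sig2 s) :> nat.
  rewrite [LHS]tagnat.rect /flatten_index; congr addn.
  rewrite shE -map_take sumnE big_map.
  have -> : take (tagnat.sig1 s) (enum 'I_k) = [seq i : 'I_k <- enum 'I_k | (i < tagnat.sig1 s)%N].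
    apply: (inj_map (@ord_inj k)); rewrite map_take.
    have -> : [seq (i : nat) | i : 'I_k <- enum 'I_k & (i < tagnat.sig1 s)%N]
        = [seq i <- [seq (j : nat) | j : 'I_k <- enum 'I_k] | (i < tagnat.sig1 s)%N] by rewrite filter_map.
    have le : (tagnat.sig1 s <= k)%N by rewrite ltnW.
    rewrite val_enum_ord take_iota (minn_idPl le).
    by rewrite -(filter_iota_ltn 0 le).
  by rewrite big_filter big_enum_cond; apply: eq_bigl.
have lt2 : (tagnat.sig2 s < nth 0 sh (tagnat.sig1 s))%N.
  by rewrite shE (nth_map (tagnat.sig1 s)) // nthi.
rewrite es nth_flatten -/sh flatten_indexKl // flatten_indexKr //.
rewrite (nth_map 0); last by rewrite size_map.
rewrite (nth_map (tagnat.sig1 s)) // nthi.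
by rewrite (nth_map 0%N) ?nth_iota ?size_iota.
Qed.

Lemma tau_mxblock k k' a b (f : gmap R a b) (g : 'I_k -> int) (h : 'I_k' -> int) :
  tau (\mxblock_(i, j) f (h j) (g i))
  = gtau f [seq g i | i <- enum 'I_k] [seq h j | j <- enum 'I_k'].
Proof.
have sz n (p : int -> nat) (e : 'I_n -> int) :
    size (basis p [seq e i | i <- enum 'I_n]) = (\sum_i p (e i))%N.
  rewrite /basis -map_comp size_flatten /shape -map_comp sumnE big_map big_enum /=.
  by apply: eq_bigr => i _; rewrite size_blk.
rewrite /gtau /ltau -(tau_cast (sz k b g, sz k' a h)); congr tau.
apply/matrixP => i j; rewrite castmxE !mxE.
rewrite !(tnth_nth (0, 0%N)) /= !nth_basis_sig.
by rewrite -entE.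
Qed.

Lemma tau_odd_even (C : complex R) (G : gmap R (rk C) (rk C)) :
  tau (odd_even G) = gtau (dG G) (evl (bd C)) (odl (bd C)).
Proof.
rewrite /odd_even (tau_mxblock (dG G)); congr gtau.
  by rewrite /evl -val_enum_ord -map_comp.
by rewrite /odl -val_enum_ord -map_comp.
Qed.

(** The torsion of a contractible complex before the sign is added. *)
Definition utor (C : complex R) : K1 R :=
  match pselect (contractible C) with
  | left h => tau (odd_even (projT1 (cid h)))
  | right _ => 0
  end.

Lemma utorE (C : complex R) (G : gmap R (rk C) (rk C)) l l' : chain_contraction G ->
  covers true (rk C) l -> covers false (rk C) l' -> utor C = gtau (dG G) l' l.
Proof.
move=> cG cl cl'; rewrite /utor; case: pselect => [h|[]]; last by exists G.
rewrite tau_odd_even; apply: (gtau_dG (c := true)) => //.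
- exact: (projT2 (cid h)).
- by apply: covers_odl; apply: rk_bd.
- by apply: covers_evl; apply: rk_bd.
Qed.

Lemma tau_newE (C : scomplex R) : contractible C -> tau_new C = utor C + eta C.
Proof. by rewrite /tau_new /utor; case: pselect. Qed.

End Unsigned.

(** * Bilinear forms in ranks modulo 2 *)

Section FiniteSums.

Definition supported (V : nmodType) (l : seq int) (F : int -> V) : Prop :=
  forall r, F r != 0 -> r \in l.

Lemma sum_supported (V : nmodType) (l l' : seq int) (F : int -> V) :
  uniq l -> uniq l' -> supported l F -> supported l' F ->
  \sum_(r <- l) F r = \sum_(r <- l') F r.
Proof.
move=> u u' s s'; have h m : \sum_(r <- m) F r = \sum_(r <- m | F r != 0) F r.
  by rewrite [LHS](bigID (fun r => F r == 0)) /= big1 ?add0r // => r /eqP.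
rewrite h [RHS]h -[LHS]big_filter -[RHS]big_filter; apply: perm_big; apply: uniq_perm; rewrite ?filter_uniq // => r.
by rewrite !mem_filter; case: eqVneq => //= /[dup] /s -> /s' ->.
Qed.

Definition zl (N : nat) : seq int := [seq i%:Z - N%:Z | i <- iota 0 N.*2.+1].

Lemma mem_zl N r : (r \in zl N) = (`|r| <= N)%N.
Proof.
apply/mapP/idP => [[i]|le]; first by rewrite mem_iota => h ->; lia.
by exists `|(r + N%:Z)%R|%N; rewrite ?mem_iota; lia.
Qed.

Lemma sorted_zl N : sorted <%R (zl N).
Proof. by apply: sorted_map_iota => i j; lia. Qed.

Lemma zl_uniq N : uniq (zl N).
Proof. by apply: lt_sorted_uniq; apply: sorted_zl. Qed.

Lemma zsumE (V : nmodType) N (F : int -> V) : zsum N F = \sum_(r <- zl N) F r.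
Proof. by rewrite /zsum /zl big_map -(big_mkord xpredT (fun i => F (i%:Z - N%:Z))) /index_iota subn0. Qed.

Lemma bool_neq0 (b : bool) : (b != 0) = b.
Proof. by case: b. Qed.

Definition bsupported (l : seq int) (F : int -> bool) : Prop := forall r, F r -> r \in l.

Lemma bsum_supported (l l' : seq int) (F : int -> bool) :
  uniq l -> uniq l' -> bsupported l F -> bsupported l' F ->
  \sum_(r <- l) F r = \sum_(r <- l') F r.
Proof.
by move=> u u' s s'; apply: sum_supported => // r; rewrite bool_neq0; [apply: s | apply: s'].
Qed.

End FiniteSums.

(** All signs depend on the ranks of the complexes modulo 2 only, that is on finitely supported
    functions from degrees to [bool]. Shifted, dual and mapping cone complexes have ranks that
    are obtained by the operations below. *)
Record parity := Parity {
  pfun :> int -> bool;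
  pfunP : exists2 l, uniq l & bsupported l pfun
}.

Section ParityCalculus.
Implicit Types a b c : parity.

Lemma parityP a b : (forall r, a r = b r) -> a = b.
Proof.
case: a b => [f hf] [g hg] /= e; have {}e : f = g by apply/funext.
by subst g; rewrite (Prop_irrelevance hf hg).
Qed.

Definition psupp a : seq int := projT1 (cid2 (pfunP a)).

Lemma psupp_uniq a : uniq (psupp a).
Proof. by rewrite /psupp; case: cid2. Qed.

Lemma psuppP a : bsupported (psupp a) a.
Proof. by rewrite /psupp; case: cid2. Qed.

Lemma finite_and a (F : int -> bool) :
  exists2 l, uniq l & bsupported l (fun r => F r && a r).
Proof.
by exists (psupp a) => [|r /andP[_]]; [exact: psupp_uniq | exact: psuppP].
Qed.

Definition pres (F : int -> bool) a : parity := Parity (finite_and a F).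

Lemma finite_add a b : exists2 l, uniq l & bsupported l (fun r => a r (+) b r).
Proof.
exists (undup (psupp a ++ psupp b)) => [|r h]; first exact: undup_uniq.
rewrite mem_undup mem_cat; move: (psuppP (a := a) (r := r)) (psuppP (a := b) (r := r)) h.
by case: (a r) => [-> //|_]; case: (b r) => [-> //|_]; rewrite ?orbT.
Qed.

Definition padd a b : parity := Parity (finite_add a b).

Lemma finite_pre (h h' : int -> int) (K : cancel h h') a :
  exists2 l, uniq l & bsupported l (fun r => a (h r)).
Proof.
exists (undup [seq h' r | r <- psupp a]) => [|r /psuppP ar]; first exact: undup_uniq.
by rewrite mem_undup; apply/mapP; exists (h r).
Qed.

Definition pshift (k : int) a : parity := Parity (finite_pre (@subrK _ k) a).

Lemma flipK (k : int) : involutive (fun r => k - r).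
Proof. by move=> r; rewrite opprB addrCA subrr addr0. Qed.

Definition pflip (k : int) a : parity := Parity (finite_pre (flipK k) a).

(** The bilinear form with matrix [K] on finitely supported functions modulo 2. *)
Definition ker (K : int -> int -> bool) a b : bool :=
  \sum_(i <- psupp a) \sum_(j <- psupp b) (K i j && (a i && b j)).

Lemma kerE K a b l l' : uniq l -> uniq l' -> bsupported l a -> bsupported l' b ->
  ker K a b = \sum_(i <- l) \sum_(j <- l') (K i j && (a i && b j)).
Proof.
move=> u u' s s'; rewrite /ker.
rewrite (@bsum_supported _ l) ?psupp_uniq //.
- apply: eq_bigr => i _; apply: bsum_supported; rewrite ?psupp_uniq // => j /and3P[_ _].
    exact: psuppP.
  exact: s'.
- move=> i; apply: contraTT => ni; rewrite big1 // => j _.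
  by case: (a i) (@psuppP a i) ni => [->|] //; rewrite andbF.
- move=> i; apply: contraTT => ni; rewrite big1 // => j _.
  by case: (a i) (s i) ni => [->|] //; rewrite andbF.
Qed.

Lemma common_supp a b c :
  exists l, [/\ uniq l, bsupported l a, bsupported l b & bsupported l c].
Proof.
exists (undup (psupp a ++ psupp b ++ psupp c)); split; first exact: undup_uniq.
- by move=> r /psuppP; rewrite mem_undup !mem_cat => ->.
- by move=> r /psuppP; rewrite mem_undup !mem_cat => ->; rewrite orbT.
- by move=> r /psuppP; rewrite mem_undup !mem_cat => ->; rewrite !orbT.
Qed.

Lemma ker_sym K a b : ker K a b = ker (fun i j => K j i) b a.
Proof.
have [l [u sa sb _]] := common_supp a b a.
rewrite !(@kerE _ _ _ l l) // exchange_big; apply: eq_bigr => i _; apply: eq_bigr => j _.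
by rewrite [a j && _]andbC.
Qed.

Lemma ker_ext K K' a b : (forall i j, K i j = K' i j) -> ker K a b = ker K' a b.
Proof. by move=> h; apply: eq_bigr => i _; apply: eq_bigr => j _; rewrite h. Qed.

Lemma kerDK K K' a b : ker (fun i j => K i j (+) K' i j) a b = ker K a b (+) ker K' a b.
Proof.
rewrite /ker -[RHS]big_split; apply: eq_bigr => i _.
by rewrite -[RHS]big_split; apply: eq_bigr => j _; rewrite andb_addl.
Qed.

Lemma kerDl K a b c : ker K (padd a b) c = ker K a c (+) ker K b c.
Proof.
have [l [u sa sb sc]] := common_supp a b c; have [l' [u' sd _ _]] := common_supp (padd a b) a a.
have [m [um s1 s2 s3]] := common_supp (padd a b) a b.
rewrite (@kerE _ (padd a b) _ m l) // !(@kerE _ _ c m l) // -[RHS]big_split.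
apply: eq_bigr => i _; rewrite -[RHS]big_split; apply: eq_bigr => j _ /=.
by case: (K i j); case: (a i); case: (b i); case: (c j).
Qed.

Lemma kerDr K a b c : ker K a (padd b c) = ker K a b (+) ker K a c.
Proof. by rewrite !(ker_sym K a) kerDl. Qed.

Lemma ker_pre (h h' : int -> int) (K : cancel h h') (K' : cancel h' h) k a a' b :
  (forall r, a' r = a (h r)) -> ker k a' b = ker (fun i j => k (h' i) j) a b.
Proof.
move=> e; have sb := psuppP (a := b); have ub := psupp_uniq b.
have inj : injective h' := can_inj K'.
rewrite (@kerE _ _ _ [seq h' i | i <- psupp a] (psupp b)) ?map_inj_uniq ?psupp_uniq //.
  by rewrite big_map; apply: eq_bigr => i _; apply: eq_bigr => j _; rewrite e K'.
by move=> r; rewrite e => /psuppP ar; apply/mapP; exists (h r).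
Qed.

Lemma ker_shiftl K k a b : ker K (pshift k a) b = ker (fun i j => K (i + k) j) a b.
Proof. exact: (ker_pre (@subrK _ k) (@addrK _ k)). Qed.

Lemma ker_shiftr K k a b : ker K a (pshift k b) = ker (fun i j => K i (j + k)) a b.
Proof. by rewrite ker_sym ker_shiftl ker_sym. Qed.

Lemma ker_flipl K k a b : ker K (pflip k a) b = ker (fun i j => K (k - i) j) a b.
Proof. exact: (ker_pre (@flipK k) (@flipK k)). Qed.

Lemma ker_flipr K k a b : ker K a (pflip k b) = ker (fun i j => K i (k - j)) a b.
Proof. by rewrite ker_sym ker_flipl ker_sym. Qed.

Definition psum (F : int -> bool) a : bool := \sum_(i <- psupp a) (F i && a i).

Lemma psumE F a l : uniq l -> bsupported l a -> psum F a = \sum_(i <- l) (F i && a i).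
Proof.
move=> u s; apply: bsum_supported; rewrite ?psupp_uniq // => i /andP[_].
  exact: psuppP.
exact: s.
Qed.

Lemma psum_ext F F' a : (forall i, F i = F' i) -> psum F a = psum F' a.
Proof. by move=> h; apply: eq_bigr => i _; rewrite h. Qed.

Lemma psumDF F F' a : psum (fun i => F i (+) F' i) a = psum F a (+) psum F' a.
Proof. by rewrite /psum -[RHS]big_split; apply: eq_bigr => i _; rewrite andb_addl. Qed.

Lemma psumD F a b : psum F (padd a b) = psum F a (+) psum F b.
Proof.
have [l [u s1 s2 s3]] := common_supp (padd a b) a b.
rewrite !(@psumE _ _ l) // -[RHS]big_split; apply: eq_bigr => i _ /=.
by rewrite andb_addr.
Qed.

Lemma psum_pre (h h' : int -> int) (K : cancel h h') (K' : cancel h' h) F a a' :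
  (forall r, a' r = a (h r)) -> psum F a' = psum (fun i => F (h' i)) a.
Proof.
move=> e; have inj : injective h' := can_inj K'.
rewrite (@psumE _ _ [seq h' i | i <- psupp a]) ?map_inj_uniq ?psupp_uniq //.
  by rewrite big_map; apply: eq_bigr => i _; rewrite e K'.
by move=> r; rewrite e => /psuppP ar; apply/mapP; exists (h r).
Qed.

Lemma psum_shift F k a : psum F (pshift k a) = psum (fun i => F (i + k)) a.
Proof. exact: (psum_pre (@subrK _ k) (@addrK _ k)). Qed.

Lemma psum_flip F k a : psum F (pflip k a) = psum (fun i => F (k - i)) a.
Proof. exact: (psum_pre (@flipK k) (@flipK k)). Qed.

Lemma psum_res F G a : psum F (pres G a) = psum (fun i => F i && G i) a.
Proof.
rewrite (@psumE _ _ (psupp a)) ?psupp_uniq //=; last by move=> r /andP[_] /psuppP.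
by apply: eq_bigr => i _; rewrite andbA.
Qed.

Lemma ker_sep F G a b : ker (fun i j => F i && G j) a b = psum F a && psum G b.
Proof.
rewrite /ker /psum -sum_andl; apply: eq_bigr => i _; rewrite -sum_andr.
by apply: eq_bigr => j _; rewrite -!andbA; congr (_ && _); rewrite andbCA.
Qed.

(** For the ranks modulo 2 of complexes C and D, [low] is the coefficient of tau(-1) in
    beta(C, D), [tots] is the parity of chi(C), and [ods] is the parity of the rank of C_odd. *)
Definition low a b := ker (fun i j => (j < i) && (oddz i == oddz j)) a b.
Definition dotp a b := ker (fun i j => i == j) a b.
Definition tots a := psum xpredT a.
Definition ods a := psum (fun i => oddz i) a.

Lemma evs_tots a : psum (fun i => ~~ oddz i) a = tots a (+) ods a.
Proof. by rewrite -psumDF; apply: psum_ext. Qed.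

(** A pair of degrees (i, j) of equal parity has j < i, i < j or i = j; together these pairs give
    the product of the ranks in odd degrees and the product of those in even degrees. *)
Lemma lowD a b : low a b (+) low b a (+) dotp a b = (ods a && ods b) (+) ((tots a (+) ods a) && (tots b (+) ods b)).
Proof.
rewrite -!evs_tots -!ker_sep -kerDK /low (ker_sym _ b) -!kerDK; apply: ker_ext => i j.
by case: (ltgtP i j) => [_|_|->]; case: (oddz i); case: (oddz j).
Qed.

(** After the shift, the pairs (i, j) with i odd, j even and j < i, and the pairs with i < j read
    in the other order, are exactly the pairs on the left. *)
Lemma low_shift1 a : low a (pshift 1 a) (+) dotp a (pshift 1 a) = ods a && (tots a (+) ods a).
Proof.
rewrite /low /dotp !ker_shiftr -kerDK -evs_tots -ker_sep.
have -> : ker (fun i j => oddz i && ~~ oddz j) a a =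
   ker (fun i j => (j < i) && (oddz i && ~~ oddz j)) a a (+)
   ker (fun i j => (i < j) && (oddz i && ~~ oddz j)) a a.
  rewrite -kerDK; apply: ker_ext => i j.
  by case: (ltgtP i j) => [_|_|->]; case: (oddz i); case: (oddz j).
rewrite [X in _ (+) X]ker_sym -kerDK; apply: ker_ext => i j.
have -> : (j + 1 < i) = (j < i) && (i != j + 1) by lia.
have -> : oddz (j + 1) = ~~ oddz j by lia.
case: (ltgtP j i) => [lt|lt|->]; last by have -> : (i == i + 1) = false by lia.
  have [e|ne] := eqVneq i (j + 1); last by case: (oddz i); case: (oddz j).
  have -> : oddz i = ~~ oddz j by lia.
  by case: (oddz j).
by have -> : (i == j + 1) = false by lia.
Qed.

Lemma low_shift k a b : low (pshift k a) (pshift k b) = low a b.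
Proof. rewrite /low ker_shiftl ker_shiftr; apply: ker_ext => i j.
rewrite ltrD2r; have -> : oddz (i + k) = oddz i (+) oddz k by lia.
have -> : oddz (j + k) = oddz j (+) oddz k by lia.
by case: (oddz k); case: (oddz i); case: (oddz j). Qed.

Lemma low_flip k a b : low (pflip k a) (pflip k b) = low b a.
Proof. rewrite /low ker_flipl ker_flipr ker_sym; apply: ker_ext => i j.
rewrite ltrD2l ltrN2; have -> : oddz (k - i) = oddz i (+) oddz k by lia.
have -> : oddz (k - j) = oddz j (+) oddz k by lia.
by case: (oddz k); case: (oddz i); case: (oddz j). Qed.

Lemma lowDl a b c : low (padd a b) c = low a c (+) low b c.
Proof. exact: kerDl. Qed.

Lemma lowDr a b c : low a (padd b c) = low a b (+) low a c.
Proof. exact: kerDr. Qed.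

End ParityCalculus.

(** * Signs of complexes as bilinear forms *)

Section Signs.
Variables (R : pzRingType).

Lemma sgb_sum I (l : seq I) (F : I -> bool) :
  \sum_(i <- l) sgb R (F i) = sgb R (\sum_(i <- l) F i).
Proof. by elim: l => [|i l IH]; rewrite ?big_nil // !big_cons IH -sgbD. Qed.

Lemma par_finite (C : complex R) : exists2 l, uniq l & bsupported l (fun r => odd (rk C r)).
Proof.
exists (zl (bd C)) => [|r]; first exact: zl_uniq.
by rewrite mem_zl leqNgt; apply: contraTN => /rk_bd ->.
Qed.

Definition par (C : complex R) : parity := Parity (par_finite C).

Lemma par_supp (C : complex R) N : (bd C <= N)%N -> bsupported (zl N) (par C).
Proof.
by move=> le r; rewrite mem_zl leqNgt; apply: contraTN => /(leq_ltn_trans le)/(@rk_bd _ C) /= ->.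
Qed.

Lemma par_cone (C D : complex R) (f : chain_map C D) :
  par (cone f) = padd (par D) (pshift 1 (par C)).
Proof. by apply: parityP => r /=; rewrite oddD. Qed.

Lemma par_shift (C : complex R) : par (shift C) = pshift 1 (par C).
Proof. exact: parityP. Qed.

Lemma par_dsum (C D : complex R) : par (dsum C D) = padd (par C) (par D).
Proof. by apply: parityP => r /=; rewrite oddD. Qed.

Lemma par_dual J n (C : complex R) : par (dual J n C) = pflip n%:Z (par C).
Proof. exact: parityP. Qed.

Lemma odd_chi (C : complex R) : odd `|chi C|%N = tots (par C).
Proof.
rewrite /chi zsumE /tots (@psumE _ _ (zl (bd C))) ?zl_uniq //; last exact: par_supp.
elim: (zl _) => [|r l IH]; first by rewrite !big_nil.
rewrite !big_cons -IH /= -[RHS]/(_ (+) _); move: (\sum_(j <- l) _) => s.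
by rewrite odd_addz odd_mulz absz_nat abszX exp1n.
Qed.

Lemma odd_rk_odd (C : complex R) : odd (rk_odd C) = ods (par C).
Proof.
have c1 : covers true (rk C) (odl (bd C)) by apply: covers_odl; apply: rk_bd.
have c0 : covers false (rk C) (evl (bd C)) by apply: covers_evl; apply: rk_bd.
rewrite /rk_odd zsumE /ods (@psumE _ _ (odl (bd C) ++ evl (bd C))).
- rewrite big_cat /= [X in _ + X]big1_seq ?addr0 => [|r /andP[_ rl]]; last first.
    by case: c0 => _ -> .
  rewrite (_ : odl _ = [seq 2 * r + 1 | r <- zl (bd C)]); last first.
    by rewrite /odl /zl -map_comp.
  elim: (zl _) => [|r l IH]; first by rewrite !big_nil.
  by rewrite /= !big_cons -IH oddD; have -> : oddz (2 * r + 1) = true by lia.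
- rewrite cat_uniq (covers_uniq c0) (covers_uniq c1) andbT; apply/hasPn => r rl.
  by apply/negP => rl'; case: c0 => _ /(_ _ rl) + _; case: c1 => _ /(_ _ rl') + _ => ->.
- move=> r h; have ne : rk C r != 0%N by move: h => /=; case: (rk C r).
  rewrite mem_cat; case: c0 c1 => _ _ c0 [_ _ c1].
  by case e: (oddz r); [rewrite c1 | rewrite c0 ?orbT].
Qed.

(** Degrees of different parities do not contribute, so the two parities can be summed over
    separate lists, as they occur in torsions. *)
Lemma low_split (a b : parity) l0 l1 m0 m1 :
  uniq l0 -> uniq l1 -> uniq m0 -> uniq m1 ->
  {in l0, forall r, oddz r = false} -> {in l1, forall r, oddz r = true} ->
  {in m0, forall r, oddz r = false} -> {in m1, forall r, oddz r = true} ->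
  (forall r, a r -> r \in (if oddz r then l1 else l0)) ->
  (forall r, b r -> r \in (if oddz r then m1 else m0)) ->
  low a b = \sum_(i <- l0) \sum_(j <- m0) ((j < i) && (a i && b j)) +
            \sum_(i <- l1) \sum_(j <- m1) ((j < i) && (a i && b j)).
Proof.
move=> u0 u1 v0 v1 e0 e1 f0 f1 ha hb.
have dj s0 s1 : uniq s0 -> uniq s1 -> {in s0, forall r, oddz r = false} ->
    {in s1, forall r, oddz r = true} -> uniq (s0 ++ s1).
  move=> w0 w1 h0 h1; rewrite cat_uniq w0 w1 andbT; apply/hasPn => r rl.
  by apply/negP => rl'; move: (h0 _ rl'); rewrite h1.
rewrite /low (@kerE _ _ _ (l0 ++ l1) (m0 ++ m1)) ?dj //; first 1 last.
- by move=> r /ha; rewrite mem_cat; case: odd => ->; rewrite ?orbT.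
- by move=> r /hb; rewrite mem_cat; case: odd => ->; rewrite ?orbT.
rewrite big_cat /=; congr (_ + _); apply: eq_big_seq => i il; rewrite big_cat /=.
  rewrite [X in _ + X]big1_seq ?addr0 => [|j /andP[_ jl]]; last by rewrite (e0 _ il) (f1 _ jl) !andbF.
  by apply: eq_big_seq => j jl; rewrite (e0 _ il) (f0 _ jl) andbT.
rewrite [X in X + _]big1_seq ?add0r => [|j /andP[_ jl]]; last by rewrite (e1 _ il) (f0 _ jl) !andbF.
by apply: eq_big_seq => j jl; rewrite (e1 _ il) (f1 _ jl) andbT.
Qed.

Lemma covers_mem (C : complex R) l0 l1 : covers false (rk C) l0 -> covers true (rk C) l1 ->
  forall r, par C r -> r \in (if oddz r then l1 else l0).
Proof.
move=> [_ _ c0] [_ _ c1] r pr; have ne : rk C r != 0%N by move: pr => /=; case: (rk C r).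
by case e: (oddz r); [apply: c1 | apply: c0].
Qed.

Lemma covers_evl_rk (C : complex R) N : (bd C <= N)%N -> covers false (rk C) (evl N).
Proof. by move=> le; apply: covers_evl => r h; apply: rk_bd; apply: leq_ltn_trans h. Qed.

Lemma covers_odl_rk (C : complex R) N : (bd C <= N)%N -> covers true (rk C) (odl N).
Proof. by move=> le; apply: covers_odl => r h; apply: rk_bd; apply: leq_ltn_trans h. Qed.

Lemma betaE (C D : complex R) : beta C D = sgb R (low (par C) (par D)).
Proof.
have c0 := covers_evl_rk (leqnn (bd C)); have c1 := covers_odl_rk (leqnn (bd C)).
have d0 := covers_evl_rk (leqnn (bd D)); have d1 := covers_odl_rk (leqnn (bd D)).
have [u0 u1] := (covers_uniq c0, covers_uniq c1).
have [v0 v1] := (covers_uniq d0, covers_uniq d1).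
have [mC mD] := (covers_mem c0 c1, covers_mem d0 d1).
have [[_ e0 _] [_ e1 _] [_ f0 _] [_ f1 _]] := And4 c0 c1 d0 d1.
rewrite (low_split u0 u1 v0 v1 e0 e1 f0 f1 mC mD).
have evE N : evl N = [seq 2 * r | r <- zl N] by rewrite /evl /zl -map_comp.
have odE N : odl N = [seq 2 * r + 1 | r <- zl N] by rewrite /odl /zl -map_comp.
rewrite !evE !odE /beta zsumE; under eq_bigr => i _ do rewrite zsumE.
move: (zl (bd C)) (zl (bd D)) => lc ld.
rewrite !big_map -big_split -sgb_sum; apply: eq_bigr => i _.
rewrite !big_map -[X in sgb R X]big_split -sgb_sum; apply: eq_bigr => j _ /=.
have -> : (2 * j < 2 * i) = (j < i) by lia.
have -> : (2 * j + 1 < 2 * i + 1) = (j < i) by lia.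
by case: (j < i) => //=; rewrite !epsE !absz_nat sgbN -sgbD.
Qed.

Definition alpha_deg (n : nat) (r : int) : bool :=
  (r == n%:Z + 2 %[mod 4])%Z || (r == n%:Z + 3 %[mod 4])%Z.

Lemma alphaE n (C : complex R) : alpha n C = sgb R (psum (alpha_deg n) (par C)).
Proof.
rewrite /alpha zsumE (@psumE _ _ (zl (bd C))) ?zl_uniq //; last exact: par_supp.
rewrite -sgb_sum; apply: eq_bigr => r _; rewrite -/(alpha_deg n r).
by case: alpha_deg => //=; rewrite epsE !absz_nat andbb.
Qed.

Lemma sum_etaE (C D : scomplex R) : sum_eta C D = eta C + eta D +
  sgb R (low (par C) (par D) (+) (ods (par C) && tots (par D))).
Proof.
by rewrite /sum_eta betaE sgbN epsE odd_chi absz_nat odd_rk_odd -addrA -sgbD.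
Qed.

Lemma eta_scone (C D : scomplex R) (f : chain_map C D) : eta (scone f) = eta D + eta C +
  sgb R (low (par D) (pshift 1 (par C)) (+) (ods (par D) && tots (par C))).
Proof.
rewrite /= sum_etaE /= par_shift; congr (_ + _ + sgb R (_ (+) (_ && _))).
  by case: (sgb_sign (eta_sign C)) => b ->; rewrite sgbN.
by rewrite /tots psum_shift.
Qed.

Lemma dual_etaE J n (C : scomplex R) : dual_eta J n C = eta C +
  sgb R (low (par C) (par C) (+) psum (alpha_deg n) (par C)).
Proof.
rewrite /dual_eta betaE alphaE; case: (sgb_sign (eta_sign C)) => b ->.
by rewrite !k1_dag_sgb !sgb_exp sgbD addrA.
Qed.

End Signs.

(** * Torsion of isomorphic complexes and of extensions *)

Section ChainIso.
Variables (R : pzRingType) (hR : invariant_rank R).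

(** A map of degree 0 as a graded map, so that it can be composed with d + G. *)
Definition gdiag (a b : int -> nat) (g : forall r, 'M[R]_(b r, a r)) : gmap R a b :=
  fun p q => @gid R b p q *m g p.

Lemma gdiag1 a b (g : forall r, 'M[R]_(b r, a r)) r : gdiag g r r = g r.
Proof. by rewrite /gdiag gid1 mul1mx. Qed.

Lemma gdiag0 a b (g : forall r, 'M[R]_(b r, a r)) p q : p != q -> gdiag g p q = 0.
Proof. by move=> ne; rewrite /gdiag gid0 // mul0mx. Qed.

Lemma gmul_diagl a b c (g : forall r, 'M[R]_(c r, b r)) (f : gmap R a b) l p r :
  uniq l -> r \in l -> gmul l (gdiag g) f p r = g r *m f p r.
Proof.
move=> ul rl; rewrite /gmul (bigD1_seq r) //= gdiag1 big1 ?addr0 // => q ne.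
by rewrite gdiag0 // mul0mx.
Qed.

Lemma gmul_diagr a b c (g : forall r, 'M[R]_(b r, a r)) (f : gmap R b c) l p r :
  uniq l -> p \in l -> gmul l f (gdiag g) p r = f p r *m g p.
Proof.
move=> ul rl; rewrite /gmul (bigD1_seq p) //= gdiag1 big1 ?addr0 // => q ne.
by rewrite gdiag0 1?eq_sym // mulmx0.
Qed.

Lemma gtau_diag a b (g : forall r, 'M[R]_(b r, a r)) l : sorted <%R l ->
  (forall r, mxiso (g r)) ->
  giso (gdiag g) l l /\ gtau (gdiag g) l l = \sum_(r <- l) tau (g r).
Proof.
move=> sl ig; have [r _|p q _ _ lt|i ->] := @gtau_up _ hR _ _ (gdiag g) l sl.
- by rewrite gdiag1.
- by rewrite gdiag0 // gt_eqF.
by split=> //; apply: eq_bigr => r _; rewrite gdiag1.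
Qed.

Lemma covers_rk c (a b : int -> nat) l : (forall r, a r = b r) -> covers c a l -> covers c b l.
Proof. by move=> e [s h1 h2]; split=> // r; rewrite -e; apply: h2. Qed.

Lemma sum_covers (t : parity) (p : int -> nat) l0 l1 :
  covers false p l0 -> covers true p l1 -> (forall r, t r -> p r != 0%N) ->
  tots t = (\sum_(r <- l0) t r) (+) (\sum_(r <- l1) t r).
Proof.
move=> c0 c1 h; rewrite /tots (@psumE _ _ (l0 ++ l1)); first exact: big_cat.
- rewrite cat_uniq (covers_uniq c0) (covers_uniq c1) andbT; apply/hasPn => r rl.
  by apply/negP => rl'; case: c0 c1 => _ /(_ _ rl') + _ [_ /(_ _ rl) + _] => ->.
move=> r tr; rewrite mem_cat; case: c0 c1 => _ _ c0 [_ _ c1].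
by case e: (oddz r); [rewrite c1 ?orbT // h | rewrite c0 // h].
Qed.

Section Iso.
Variables (C C' : complex R).
Variables (g : forall r, 'M[R]_(rk C' r, rk C r)) (g' : forall r, 'M[R]_(rk C r, rk C' r)).
Hypothesis gK : forall r, g r *m g' r = 1%:M.
Hypothesis gK' : forall r, g' r *m g r = 1%:M.
Hypothesis g_df : forall p q, df C' p q *m g p = g q *m df C p q.

Lemma iso_contraction (G : gmap R (rk C) (rk C)) : chain_contraction G ->
  chain_contraction (fun p q => g q *m G p q *m g' p : 'M_(rk C' q, rk C' p)).
Proof.
move=> [dG eG]; split=> [p q ne|r]; first by rewrite dG // mulmx0 mul0mx.
rewrite !mulmxA g_df -!mulmxA.
have e p q : g' p *m df C' q p = df C q p *m g' q.
  by rewrite -[LHS]mulmx1 -(gK q) mulmxA -(mulmxA (g' p)) g_df mulmxA gK' mul1mx.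
by rewrite e -mulmxDr !(mulmxA _ _ (g' r)) -mulmxDl eG mul1mx gK.
Qed.

Lemma iso_contractible : contractible C -> contractible C'.
Proof. by case=> G cG; exists (fun p q => g q *m G p q *m g' p); apply: iso_contraction. Qed.

(** The isomorphism [g] turns d + G into g (d + G) g^-1, so the torsion changes by the
    alternating sum of the torsions of the [g r]. These are signs, so the alternation does not
    matter. *)
Lemma utor_iso (t : parity) : contractible C -> (forall r, t r -> rk C r != 0%N) ->
  (forall r, tau (g r) = sgb R (t r)) -> utor C' = utor C + sgb R (tots t).
Proof.
move=> [G cG] ht tg; have cG' := iso_contraction cG.
have c0 := covers_evl_rk (leqnn (bd C)); have c1 := covers_odl_rk (leqnn (bd C)).
set l0 := evl _ in c0; set l1 := odl _ in c1.
have er r : rk C r = rk C' r by rewrite (hR (gK' r) (gK r)).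
have d0 := covers_rk er c0; have d1 := covers_rk er c1.
have [s0 _ _] := c0; have [s1 _ _] := c1.
have [u0 u1] := (covers_uniq c0, covers_uniq c1).
have ig r : mxiso (g r) by exists (g' r).
have ig' r : mxiso (g' r) by exists (g r).
rewrite (utorE hR cG' d1 d0) (utorE hR cG c1 c0).
have [i1 t1] := gtau_diag s0 ig; have [i2 t2] := gtau_diag s1 ig'.
have i3 := giso_dG hR cG c1 c0.
have [i4 t4] := gtau_mul hR i1 i3; have [i5 t5] := gtau_mul hR i4 i2.
rewrite (@gtau_ext _ _ _ _ (gmul l1 (gmul l0 (gdiag g) (dG G)) (gdiag g'))); last first.
  move=> p q pl ql; rewrite gmul_diagr // gmul_diagl // /dG mulmxDr mulmxDl.
  by rewrite -g_df -(mulmxA (df C' _ _)) gK mulmx1.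
rewrite t5 t4 t1 t2 (eq_bigr (fun r => sgb R (t r))) => [|r _]; last exact: tg.
have -> : \sum_(r <- l1) tau (g' r) = \sum_(r <- l1) sgb R (t r).
  by apply: eq_bigr => r _; rewrite (tau_inv hR (gK r) (gK' r)) tg sgbN.
by rewrite !sgb_sum (sum_covers c0 c1 ht) sgbD [X in X + _]addrC addrA.
Qed.

End Iso.
End ChainIso.

Section Extension.
Variables (R : pzRingType) (hR : invariant_rank R).

Section BlockEntries.
Variables (a1 a2 b1 b2 : int -> nat).
Variables (f11 : gmap R a1 b1) (f12 : gmap R a2 b1) (f21 : gmap R a1 b2) (f22 : gmap R a2 b2).

Definition gblock : gmap R (fun r => a1 r + a2 r)%N (fun r => b1 r + b2 r)%N :=
  fun p q => block_mx (f11 p q) (f12 p q) (f21 p q) (f22 p q).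

(** The basis of a direct sum lists in each degree the first summand before the second one;
    the tag tells the summands apart. *)
Definition inj_basis (p : int -> nat) (x : bool * (int * nat)) : int * nat :=
  if x.1 then (x.2.1, p x.2.1 + x.2.2)%N else x.2.

Lemma ent_block11 x y : (x.2 < b1 x.1)%N -> (y.2 < a1 y.1)%N ->
  ent gblock (inj_basis b1 (false, x)) (inj_basis a1 (false, y)) = ent f11 x y.
Proof.
case: x y => q i [p j] /= li lj; pose i' := Ordinal li; pose j' := Ordinal lj.
have -> := entE gblock (lshift _ i' : 'I_(_ q + _ q)) (lshift _ j' : 'I_(_ p + _ p)).
by rewrite /gblock block_mxEul -entE.
Qed.

Lemma ent_block22 x y : (x.2 < b2 x.1)%N -> (y.2 < a2 y.1)%N ->
  ent gblock (inj_basis b1 (true, x)) (inj_basis a1 (true, y)) = ent f22 x y.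
Proof.
case: x y => q i [p j] /= li lj; pose i' := Ordinal li; pose j' := Ordinal lj.
have -> := entE gblock (rshift _ i' : 'I_(_ q + _ q)) (rshift _ j' : 'I_(_ p + _ p)).
by rewrite /gblock block_mxEdr -entE.
Qed.

Lemma ent_block21 x y : (x.2 < b2 x.1)%N -> (y.2 < a1 y.1)%N ->
  ent gblock (inj_basis b1 (true, x)) (inj_basis a1 (false, y)) = ent f21 x y.
Proof.
case: x y => q i [p j] /= li lj; pose i' := Ordinal li; pose j' := Ordinal lj.
have -> := entE gblock (rshift _ i' : 'I_(_ q + _ q)) (lshift _ j' : 'I_(_ p + _ p)).
by rewrite /gblock block_mxEdl -entE.
Qed.

Lemma ent_block12 x y : (x.2 < b1 x.1)%N -> (y.2 < a2 y.1)%N ->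
  ent gblock (inj_basis b1 (false, x)) (inj_basis a1 (true, y)) = ent f12 x y.
Proof.
case: x y => q i [p j] /= li lj; pose i' := Ordinal li; pose j' := Ordinal lj.
have -> := entE gblock (lshift _ i' : 'I_(_ q + _ q)) (rshift _ j' : 'I_(_ p + _ p)).
by rewrite /gblock block_mxEur -entE.
Qed.
End BlockEntries.

Definition tagl (c : bool) (p : int -> nat) (r : int) := [seq (c, x) | x <- blk p r].

Lemma basis_sum (p q : int -> nat) l : basis (fun r => p r + q r)%N l =
  [seq inj_basis p x | x <- flatten [seq tagl false p r ++ tagl true q r | r <- l]].
Proof.
elim: l => // r l IH; rewrite basis_cons /= map_cat -IH map_cat; congr (_ ++ _).
have e : iota (p r) (q r) = [seq (p r + k)%N | k <- iota 0 (q r)] by rewrite -iotaDl addn0.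
by rewrite /blk iotaD map_cat add0n e /tagl /blk -!map_comp.
Qed.

Lemma flatten_tagl c p l : flatten [seq tagl c p r | r <- l] = [seq (c, x) | x <- basis p l].
Proof. by rewrite /basis map_flatten -map_comp. Qed.

Lemma uniq_tagl p q l : uniq l -> uniq (flatten [seq tagl false p r ++ tagl true q r | r <- l]).
Proof.
by move=> ul; apply: (@map_uniq _ _ (inj_basis p)); rewrite -basis_sum basis_uniq.
Qed.

(** Reordering both bases so that all elements of the first summand come first turns the matrix
    into a block triangular one; these reorderings have the signs counted by [lowsum]. *)
Lemma gtau_block (a1 a2 b1 b2 : int -> nat) (f11 : gmap R a1 b1) (f12 : gmap R a2 b1)
    (f21 : gmap R a1 b2) (f22 : gmap R a2 b2) l' l :
  sorted <%R l -> sorted <%R l' -> {in l & l', forall p q, f21 p q = 0} ->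
  giso f11 l' l -> giso f22 l' l ->
  gtau (gblock f11 f12 f21 f22) l' l = gtau f11 l' l + gtau f22 l' l +
    sgb R (lowsum l' (fun r => odd (b1 r)) (fun r => odd (b2 r)) (+)
           lowsum l (fun r => odd (a1 r)) (fun r => odd (a2 r))).
Proof.
move=> sl sl' h0 i1 i2; rewrite /gtau !basis_sum ltau_map.
have [ul ul'] := (lt_sorted_uniq sl, lt_sorted_uniq sl').
set F := fun x y => _.
have uA := uniq_tagl a1 a2 ul; have uB := uniq_tagl b1 b2 ul'.
have pA := perm_interleave (tagl false a1) (tagl true a2) l.
have pB := perm_interleave (tagl false b1) (tagl true b2) l'.
have sA := psgn_interleave hR sl uA; have sB := psgn_interleave hR sl' uB.
have szt c p (r : int) : odd (size (tagl c p r)) = odd (p r) by rewrite size_map size_blk.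
have lowE (m : seq int) c d (p q : int -> nat) :
    lowsum m (fun r => odd (size (tagl c p r))) (fun r => odd (size (tagl d q r)))
    = lowsum m (fun r => odd (p r)) (fun r => odd (q r)).
  by apply: eq_bigr => i _; apply: eq_bigr => j _; rewrite !szt.
rewrite lowE in sA; rewrite lowE in sB; rewrite !flatten_tagl in pA pB sA sB.
have [j1 t1] : liso F [seq (false, x) | x <- basis b1 l'] [seq (false, x) | x <- basis a1 l] /\
   ltau F [seq (false, x) | x <- basis b1 l'] [seq (false, x) | x <- basis a1 l] = gtau f11 l' l.
  rewrite liso_map ltau_map /F.
  have e : {in basis b1 l' & basis a1 l, forall x y, ent f11 x y =
      ent (gblock f11 f12 f21 f22) (inj_basis b1 (false, x)) (inj_basis a1 (false, y))}.
    move=> x y; rewrite !mem_basis => /andP[_ xl] /andP[_ yl].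
    by rewrite ent_block11.
  by split; [apply: liso_ext e i1 | rewrite /gtau (ltau_ext e)].
have [j2 t2] : liso F [seq (true, x) | x <- basis b2 l'] [seq (true, x) | x <- basis a2 l] /\
   ltau F [seq (true, x) | x <- basis b2 l'] [seq (true, x) | x <- basis a2 l] = gtau f22 l' l.
  rewrite liso_map ltau_map /F.
  have e : {in basis b2 l' & basis a2 l, forall x y, ent f22 x y =
      ent (gblock f11 f12 f21 f22) (inj_basis b1 (true, x)) (inj_basis a1 (true, y))}.
    move=> x y; rewrite !mem_basis => /andP[_ xl] /andP[_ yl].
    by rewrite ent_block22.
  by split; [apply: liso_ext e i2 | rewrite /gtau (ltau_ext e)].
have z : {in [seq (true, x) | x <- basis b2 l'] & [seq (false, x) | x <- basis a1 l],
    forall x y, F x y = 0}.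
  move=> _ _ /mapP[x + ->] /mapP[y + ->]; rewrite !mem_basis => /andP[x1 xl] /andP[y1 yl].
  by rewrite /F ent_block21 // ent0 // h0.
have [iF tF] := ltau_ublock hR z j1 j2.
have pA' := pA; rewrite perm_sym in pA'.
have uA' : uniq ([seq (false, x) | x <- basis a1 l] ++ [seq (true, x) | x <- basis a2 l]).
  by rewrite -(perm_uniq pA).
have iF' := liso_permr uA' pA' iF.
rewrite (ltau_perm hR uB pB iF') (ltau_permr hR uA' pA' iF) tF t1 t2.
by rewrite (psgn_sym hR uA pA) sA sB sgbN sgbD addrC -addrA [sgb _ _ + sgb _ _]addrC.
Qed.

(** The extension of [D] by [C] with connecting map [X]: [C] is a subcomplex with quotient [D]. *)
Section Ext.
Variables (C D : complex R) (X : gmap R (rk D) (rk C)).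
Hypothesis X_deg : forall p q, q != p - 1 -> X p q = 0.
Hypothesis X_df : forall p q r, df C q r *m X p q + X q r *m df D p q = 0.

Definition ext_rk r := (rk C r + rk D r)%N.
Definition ext_df : gmap R ext_rk ext_rk := fun p q => block_mx (df C p q) (X p q) 0 (df D p q).

Lemma ext_bd r : (maxn (bd C) (bd D) < `|r|)%N -> ext_rk r = 0%N.
Proof. by rewrite gtn_max /ext_rk => /andP[h1 h2]; rewrite !rk_bd. Qed.

Lemma ext_deg p q : q != p - 1 -> ext_df p q = 0.
Proof. by move=> h; rewrite /ext_df !df_deg // X_deg // block_mx0. Qed.

Lemma ext_dfdf p q r : ext_df q r *m ext_df p q = 0.
Proof.
by rewrite /ext_df mulmx_block !mulmx0 !mul0mx !df_df !add0r X_df block_mx0.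
Qed.

Definition ext : complex R := Complex ext_bd ext_deg ext_dfdf.

Definition ext_G (G : gmap R (rk C) (rk C)) (H : gmap R (rk D) (rk D)) : gmap R ext_rk ext_rk :=
  fun p q => block_mx (G p q) (- (G p q *m X (p + 1) p *m H p (p + 1))) 0 (H p q).

Lemma ext_contraction G H : chain_contraction G -> chain_contraction H ->
  @chain_contraction R ext (ext_G G H).
Proof.
move=> [dG eG] [dH eH]; split=> [p q ne|r].
  by rewrite /ext_G (dG _ _ ne) (dH _ _ ne) !mul0mx oppr0 block_mx0.
rewrite [df ext _ _]/(ext_df _ _) [df ext _ _]/(ext_df _ _) /ext_df /ext_G.
rewrite !mulmx_block !mulmx0 !mul0mx !add0r !addr0 add_block_mx eG eH addr0.
rewrite subrK [RHS]scalar_mx_block; congr block_mx.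
have eG' := eG r; have eH' := eH r.
have x1 : df C (r + 1) r *m G r (r + 1) = 1%:M - G (r - 1) r *m df C r (r - 1).
  by rewrite -eG' addrK.
have x2 : H (r - 1) r *m df D r (r - 1) = 1%:M - df D (r + 1) r *m H r (r + 1).
  by rewrite -eH' addrAC subrr add0r.
have x3 : G (r - 1) r *m df C r (r - 1) *m X (r + 1) r *m H r (r + 1)
   + G (r - 1) r *m X r (r - 1) *m df D (r + 1) r *m H r (r + 1) = 0.
  by rewrite -mulmxDl -!(mulmxA (G _ _)) -mulmxDr X_df mulmx0 mul0mx.
rewrite mulmxN !mulmxA x1 mulNmx -(mulmxA _ _ (df D r _)) x2.
rewrite !mulmxBl mul1mx mulmxBr mulmx1 !mulmxA opprB opprB.
by rewrite subrK [X in _ + X]addrCA subrr addr0 x3.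
Qed.

Lemma ext_contractible : contractible C -> contractible D -> contractible ext.
Proof. by move=> [G cG] [H cH]; exists (ext_G G H); apply: ext_contraction. Qed.

(** The contraction [ext_G] is block triangular, so [gtau_block] applies in odd and in even degrees
    and gives the two parts of beta(C, D). *)
Lemma utor_ext : contractible C -> contractible D ->
  utor ext = utor C + utor D + sgb R (low (par C) (par D)).
Proof.
move=> [G cG] [H cH]; have cE := ext_contraction cG cH.
pose N := maxn (bd C) (bd D).
have [leC leD] : (bd C <= N)%N /\ (bd D <= N)%N by rewrite leq_maxl leq_maxr.
have c0 := covers_evl_rk leC; have c1 := covers_odl_rk leC.
have d0 := covers_evl_rk leD; have d1 := covers_odl_rk leD.
have e0 := @covers_evl_rk _ ext N (leqnn _); have e1 := @covers_odl_rk _ ext N (leqnn _).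
have [s0 p0 _] := c0; have [s1 p1 _] := c1.
rewrite (utorE hR cE e1 e0) (utorE hR cG c1 c0) (utorE hR cH d1 d0).
rewrite (@gtau_ext _ _ _ _ (gblock (dG G)
   (fun p q => X p q - (G p q *m X (p + 1) p *m H p (p + 1))) (fun p q => 0) (dG H))); last first.
  move=> p q _ _; rewrite /dG [df ext p q]/(ext_df p q) /ext_df /ext_G /gblock.
  by rewrite add_block_mx addr0.
rewrite gtau_block //; [|exact: (giso_dG hR cG c1 c0)|exact: (giso_dG hR cH d1 d0)].
congr (_ + _ + sgb R _).
have [u0 u1] := (covers_uniq c0, covers_uniq c1).
rewrite (low_split u0 u1 u0 u1 p0 p1 p0 p1 (covers_mem c0 c1) (covers_mem d0 d1)).
by [].
Qed.

Lemma ext_split : (forall p q, X p q = 0) -> contractible ext -> contractible C /\ contractible D.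
Proof.
move=> X0 [G [dG eG]]; have e r := eG r; split.
  exists (fun p q => ulsubmx (G p q : 'M_(rk C q + rk D q, rk C p + rk D p))).
  split=> [p q ne|r]; first by rewrite dG //; apply/matrixP => i j; rewrite !mxE.
  have := congr1 (fun A : 'M_(rk C r + rk D r) => ulsubmx A) (e r).
  rewrite [df ext _ _]/(ext_df _ _) [df ext _ _]/(ext_df _ _) /ext_df !X0.
  rewrite -[G r (r + 1)]submxK -[G (r - 1) r]submxK !mulmx_block !mul0mx !mulmx0 !addr0 !add0r.
  by rewrite add_block_mx scalar_mx_block !block_mxKul.
exists (fun p q => drsubmx (G p q : 'M_(rk C q + rk D q, rk C p + rk D p))).
split=> [p q ne|r]; first by rewrite dG //; apply/matrixP => i j; rewrite !mxE.
have := congr1 (fun A : 'M_(rk C r + rk D r) => drsubmx A) (e r).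
rewrite [df ext _ _]/(ext_df _ _) [df ext _ _]/(ext_df _ _) /ext_df !X0.
rewrite -[G r (r + 1)]submxK -[G (r - 1) r]submxK !mulmx_block !mul0mx !mulmx0 !addr0 !add0r.
by rewrite add_block_mx scalar_mx_block !block_mxKdr.
Qed.

End Ext.
End Extension.

(** * The cone of an identity map *)

Lemma dotpE (a b : parity) : dotp a b = tots (pres a b).
Proof.
have [l [u sa sb st]] := common_supp a b (pres a b).
rewrite /dotp (@kerE _ _ _ l l) // /tots (@psumE _ _ l) //; apply: eq_big_seq => i il.
rewrite (bigD1_seq i) //= eqxx big1 ?[LHS]addbF //= => j.
by rewrite eq_sym => /negPf ->.
Qed.

Section ScalarTorsion.
Variables (R : pzRingType) (hR : invariant_rank R).

Lemma mxisoN m n (A : 'M[R]_(m, n)) : mxiso A -> mxiso (- A).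
Proof. by case=> B [e1 e2]; exists (- B); rewrite !mulNmx !mulmxN !opprK. Qed.

Lemma tauN1 n : tau (- 1%:M : 'M[R]_n) = sgb R (odd n).
Proof.
elim: n => [|n IH].
  by rewrite (_ : - 1%:M = 1%:M) ?tau1 //; apply/matrixP => -[].
transitivity (tau (block_mx (- 1%:M) 0 0 (- 1%:M) : 'M[R]_(1 + n))).
  by congr tau; rewrite -[LHS]/(- 1%:M : 'M_(1 + n)) scalar_mx_block opp_block_mx !oppr0.
rewrite (tau_diag hR); try exact/mxisoN/mxiso1.
by rewrite IH -[tau _]/(sgb R true) -sgbD.
Qed.

Lemma mxiso_sg m n (A : 'M[R]_(m, n)) r : mxiso A -> mxiso (sg R r *: A).
Proof. by move=> i; rewrite scale_sg; case: odd => //; apply: mxisoN. Qed.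

Lemma tau_sg m n (A : 'M[R]_(m, n)) r : mxiso A ->
  tau (sg R r *: A) = tau A + sgb R (oddz r && odd m).
Proof.
move=> iA; rewrite scale_sg; case: odd => /=; last by rewrite addr0.
have -> : - A = - 1%:M *m A by rewrite mulNmx mul1mx.
by rewrite (tau_mul hR) ?tauN1 1?addrC //; exact/mxisoN/mxiso1.
Qed.

End ScalarTorsion.

Lemma oddzS (r : int) : oddz (r + 1) = ~~ oddz r.
Proof. lia. Qed.

Section ConeId.
Variables (R : pzRingType) (hR : invariant_rank R) (C : complex R).
Local Notation c := (rk C).

Lemma id_df p q : df C p q *m 1%:M = 1%:M *m df C p q.
Proof. by rewrite mulmx1 mul1mx. Qed.

Definition id_map : chain_map C C := ChainMap id_df.

(** The contraction that maps C_r, as a submodule of the cone in degree r, to its copy in degree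
    r + 1. *)
Definition id_G : gmap R (cone_rk C C) (cone_rk C C) :=
  fun p q => block_mx 0 0 (sg R p *: idm C p (q - 1)) 0.

Lemma id_contraction : @chain_contraction R (cone id_map) id_G.
Proof.
split=> [p q ne|r].
  by rewrite /id_G idm0 ?scaler0 ?block_mx0 //; apply: contra ne => /eqP ->; rewrite subrK.
rewrite [df (cone _) _ _]/(cone_df id_map _ _) [df (cone _) _ _]/(cone_df id_map _ _).
rewrite /cone_df /id_G /= !mulmx1 !mulmx_block !mulmx0 !mul0mx !add0r !addr0.
rewrite add_block_mx addrK !idm1 !(mulmx_sg, sg_mulmx, mulmx1, mul1mx, addr0, add0r).
rewrite -scalerDl !scalerA -!sgD [RHS]scalar_mx_block; congr block_mx.
- by rewrite sg_odd (_ : odd _ = false) ?scale1r //; lia.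
- by rewrite (@sgN _ r (r - 1)) ?addNr ?scale0r //; lia.
- by rewrite sg_odd (_ : odd _ = false) ?scale1r //; lia.
Qed.

(** The cone of the identity of C is C_r + C_(r-1) in degree r. Hence its odd and its even part
    both consist of one copy of every [C_r], and [dbl l] lists the degrees [r] that are met when
    the cone is taken over the degrees in [l]. *)
Definition dbl (l : seq int) : seq int := flatten [seq [:: r - 1; r] | r <- l].

Definition tag_of (e : bool) (x : int * nat) : bool * (int * nat) :=
  if oddz x.1 == e then (false, x) else (true, (x.1 + 1, x.2)).

Lemma map_tag_of e l : {in l, forall r, oddz r = e} ->
  flatten [seq tagl true (fun r => c (r - 1)) r ++ tagl false c r | r <- l]
  = [seq tag_of e x | x <- basis c (dbl l)].
Proof.
elim: l => // r l IH h; rewrite /dbl /= -/(dbl l) !basis_cons !map_cat -IH; last first.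
  by move=> s sl; apply: h; rewrite inE sl orbT.
rewrite -catA; congr (_ ++ (_ ++ _)).
  rewrite /tagl /blk -!map_comp; apply: eq_map => k /=; rewrite /tag_of /=.
  have -> : oddz (r - 1) == e = false by have := h r (mem_head _ _); lia.
  by rewrite subrK.
rewrite /tagl /blk -!map_comp; apply: eq_map => k /=; rewrite /tag_of /=.
by rewrite (h r (mem_head _ _)) eqxx.
Qed.

Lemma sorted_dbl e l : sorted <%R l -> {in l, forall r, oddz r = e} -> sorted <%R (dbl l).
Proof.
elim: l => // r l IH sl h; have gt := sorted_gt sl.
have hl : {in l, forall s, oddz s = e} by move=> s sl'; apply: h; rewrite inE sl' orbT.
have {}IH := IH (path_sorted sl) hl; rewrite /dbl /= -/(dbl l).
have -> : r - 1 < r by lia.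
rewrite /= path_sortedE; last exact: lt_trans.
rewrite IH andbT; apply/allP => s /flatten_mapP[t tl]; rewrite !inE.
have := gt t tl; have := hl t tl; have := h r (mem_head _ _).
by move=> e1 e2 lt /orP[/eqP ->|/eqP ->]; lia.
Qed.

Lemma mem_dbl l r : (r \in dbl l) = (r + 1 \in l) || (r \in l).
Proof.
apply/flatten_mapP/orP => [[s sl]|[rl|rl]].
- by rewrite !inE => /orP[/eqP ->|/eqP ->]; [left; rewrite subrK | right].
- by exists (r + 1) => //; rewrite !inE addrK eqxx.
- by exists r => //; rewrite !inE eqxx orbT.
Qed.

(** The matrix of d + G when the odd and the even part of the cone are both identified with the
    sum of all [C_r]; it is triangular with signs on the diagonal. *)
Definition id_mat : gmap R c c := fun p q => df C p q + sg R p *: idm C p q.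

Lemma id_mat_diff p q : oddz q = ~~ oddz p -> id_mat p q = df C p q.
Proof. by move=> e; rewrite /id_mat idm0 ?scaler0 ?addr0 //; apply/eqP => pq; move: e; rewrite pq; case: (odd _). Qed.

Lemma id_mat_same p q : oddz q = oddz p -> id_mat p q = sg R p *: idm C p q.
Proof. by move=> e; rewrite /id_mat df_deg ?add0r //; lia. Qed.

(** The identification of each parity part of the cone with the sum of all [C_r] exchanges
    C_r and C_(r-1) inside each degree of the cone, which gives the term [dotp]; the diagonal of
    [id_mat] gives the term [ods]. *)
Lemma utor_cone_id : utor (cone id_map) =
  sgb R (dotp (par C) (pshift 1 (par C)) (+) ods (par C)).
Proof.
pose K := cone id_map; pose N := (bd K).
have d0 := covers_evl_rk (leqnn (bd K)); have d1 := covers_odl_rk (leqnn (bd K)).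
set l0 := evl _ in d0; set l1 := odl _ in d1.
rewrite (utorE hR id_contraction d1 d0).
pose c' := fun r => c (r - 1).
pose f11 : gmap R c c := fun p q => df C p q.
pose f12 : gmap R c' c := fun p q => sg R (p + 1) *: idm C (p - 1) q.
pose f21 : gmap R c c' := fun p q => sg R p *: idm C p (q - 1).
pose f22 : gmap R c' c' := fun p q => df C (p - 1) (q - 1).
rewrite (@gtau_ext _ _ _ _ (gblock f11 f12 f21 f22)); last first.
  move=> p q _ _; rewrite /dG [df (cone _) p q]/(cone_df id_map p q) /cone_df /id_G /gblock.
  by rewrite add_block_mx !addr0 add0r /= mulmx1.
rewrite /gtau.
have [u0 u1] := (covers_uniq d0, covers_uniq d1).
have [s0 p0 q0] := d0; have [s1 p1 q1] := d1.
rewrite !(basis_sum c (fun r => c (r - 1))) ltau_map.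
set F := fun x y => _.
have v0 := uniq_tagl c (fun r => c (r - 1)) u0; have v1 := uniq_tagl c (fun r => c (r - 1)) u1.
have e0 := perm_twist (tagl false c) (tagl true (fun r => c (r - 1))) l0.
have e1 := perm_twist (tagl false c) (tagl true (fun r => c (r - 1))) l1.
have t0 := psgn_twist hR v0; have t1 := psgn_twist hR v1.
rewrite !(map_tag_of p0) in e0 t0; rewrite !(map_tag_of p1) in e1 t1.
have szt e p (r : int) : odd (size (tagl e p r)) = odd (p r) by rewrite size_map size_blk.
have szE l : \sum_(r <- l) (odd (size (tagl false c r)) && odd (size (tagl true (fun r => c (r - 1)) r)))
   = \sum_(r <- l) (odd (c r) && odd (c (r - 1))) by apply: eq_bigr => r _; rewrite !szt.
rewrite !szE in t0 t1.
have b0 : basis c (dbl l0) = basis c (zl (bd C)).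
  apply: basis_sorted_eq; [exact: sorted_dbl s0 p0 | exact: sorted_zl |].
  move=> r; rewrite mem_dbl mem_zl => nr.
  have -> : (`|r| <= bd C)%N by rewrite leqNgt; apply: contra nr => /rk_bd ->.
  have h s : oddz s = false -> (rk K s != 0%N) -> s \in l0 by exact: q0.
  case er: (oddz r); apply/orP; [left|right]; apply: h; rewrite //= ?/cone_rk ?addrK ?oddzS ?er //.
    by rewrite addnC addn_eq0 negb_and nr.
  by rewrite addn_eq0 negb_and nr.
have b1 : basis c (dbl l1) = basis c (zl (bd C)).
  apply: basis_sorted_eq; [exact: sorted_dbl s1 p1 | exact: sorted_zl |].
  move=> r; rewrite mem_dbl mem_zl => nr.
  have -> : (`|r| <= bd C)%N by rewrite leqNgt; apply: contra nr => /rk_bd ->.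
  have h s : oddz s = true -> (rk K s != 0%N) -> s \in l1 by exact: q1.
  case er: (oddz r); apply/orP; [right|left]; apply: h; rewrite //= ?/cone_rk ?addrK ?oddzS ?er //.
    by rewrite addn_eq0 negb_and nr.
  by rewrite addnC addn_eq0 negb_and nr.
rewrite b0 in e0 t0; rewrite b1 in e1 t1.
have eF : {in basis c (zl (bd C)) & basis c (zl (bd C)),
   forall x y, F (tag_of false x) (tag_of true y) = ent id_mat x y}.
  move=> [q i] [p j]; rewrite !mem_basis => /andP[_ /= li] /andP[_ /= lj].
  have li' : (i < c' (q + 1)%R)%N by rewrite /c' addrK.
  have lj' : (j < c' (p + 1)%R)%N by rewrite /c' addrK.
  rewrite /F /tag_of /=; case eq: (oddz q); case ep: (oddz p) => /=.
  - rewrite (@ent_block21 _ c c' c c' f11 f12 f21 f22 (q + 1, i) (p, j)) //.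
    rewrite -[LHS]/(ent (fun p q => sg R p *: idm C p q) (q + 1 - 1, i) (p, j)) addrK.
    by apply: ent_ext => /=; rewrite id_mat_same // eq ep.
  - rewrite (@ent_block22 _ c c' c c' f11 f12 f21 f22 (q + 1, i) (p + 1, j)) //.
    rewrite -[LHS]/(ent (df C) (q + 1 - 1, i) (p + 1 - 1, j)) !addrK.
    by apply: ent_ext => /=; rewrite id_mat_diff // eq ep.
  - rewrite (@ent_block11 _ c c' c c' f11 f12 f21 f22 (q, i) (p, j)) //.
    by apply: ent_ext => /=; rewrite id_mat_diff // eq ep.
  - rewrite (@ent_block12 _ c c' c c' f11 f12 f21 f22 (q, i) (p + 1, j)) //.
    rewrite -[LHS]/(ent (fun p' q' => sg R (p + 1 + 1) *: idm C p' q') (q, i) (p + 1 - 1, j)) addrK.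
    apply: ent_ext => /=; rewrite id_mat_same ?eq ?ep //.
    by congr (_ *: _); apply: sgE; rewrite !oddzS negbK.
have [iz tz] : giso id_mat (zl (bd C)) (zl (bd C)) /\
   gtau id_mat (zl (bd C)) (zl (bd C)) = sgb R (ods (par C)).
  have z r : id_mat r r = sg R r *: 1%:M.
    by rewrite id_mat_same ?idm1.
  have [r _|p q _ _ lt|i ->] := @gtau_down _ hR _ _ id_mat _ (sorted_zl (bd C)).
  - by rewrite z; apply/mxiso_sg/mxiso1.
  - by rewrite /id_mat df_deg ?idm0 ?scaler0 ?addr0 //; lia.
  split=> //; rewrite /ods (@psumE _ _ (zl (bd C))) ?zl_uniq //; last exact: par_supp.
  rewrite -sgb_sum; apply: eq_bigr => r _; by rewrite z (tau_sg hR) ?tau1 ?add0r //; apply: mxiso1.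
have iF : liso F (map (tag_of false) (basis c (zl (bd C)))) (map (tag_of true) (basis c (zl (bd C)))).
  rewrite liso_map; apply: liso_ext iz => x y xl yl; by rewrite eF.
have w1 : uniq (map (tag_of true) (basis c (zl (bd C)))) by rewrite -(perm_uniq e1).
have e1' := e1; rewrite perm_sym in e1'.
have iF' := liso_permr w1 e1' iF.
rewrite (ltau_perm hR v0 e0 iF') (ltau_permr hR w1 e1' iF) (psgn_sym hR v1 e1).
rewrite t0 t1 ltau_map (ltau_ext eF) -[ltau _ _ _]/(gtau id_mat _ _) tz sgbN.
rewrite dotpE (sum_covers (p := rk K) d0 d1) => [|r /andP[/= h _]]; last first.
  by rewrite /cone_rk; move: h; case: (c r).
by rewrite !sgbD -addrA; congr (_ + _); rewrite addrC.
Qed.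

End ConeId.

(** * Cones of homotopic maps, isomorphisms and composites *)

Section BlockTorsion.
Variables (R : pzRingType) (hR : invariant_rank R).

(** The exchange of two blocks is the matrix of a reordering of a basis. *)
Lemma tau_swap m n : tau (swap_mx R m n) = sgb R (odd m && odd n).
Proof.
pose A := [seq (false, i) | i <- iota 0 m]; pose B := [seq (true, i) | i <- iota 0 n].
have uA : uniq A by rewrite map_inj_uniq ?iota_uniq // => i j [].
have uB : uniq B by rewrite map_inj_uniq ?iota_uniq // => i j [].
have nAB x : x \in A -> x \in B -> False by move=> /mapP[i _ ->] /mapP[].
have uAB : uniq (A ++ B).
  by rewrite cat_uniq uA uB andbT; apply/hasPn => x xB; apply/negP => xA; apply: nAB xA xB.
have := psgn_catC hR uAB; rewrite /psgn /ltau mxof_cat tau_cast.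
rewrite !mxof_delta // (mxof0 (L := A)) ?(mxof0 (L := B)); first 1 last.
- by move=> x y xB yA; rewrite /delta; case: eqP => // e; case: (@nAB y); rewrite // -e.
- by move=> x y xA yB; rewrite /delta; case: eqP => // e; case: (@nAB y); rewrite // -e.
by rewrite -/(swap_mx R (size A) (size B)) !size_map !size_iota.
Qed.

Lemma tau_antidiag m n m' n' (X : 'M[R]_(m, n')) (A : 'M[R]_(m, m')) (B : 'M[R]_(n, n')) :
  mxiso A -> mxiso B ->
  mxiso (block_mx X A B 0) /\
  tau (block_mx X A B 0) = tau A + tau B + sgb R (odd m && odd n).
Proof.
move=> iA iB; have [i1 t1] := tau_ublock hR X iA iB.
have e : block_mx X A B 0 = block_mx A X 0 B *m swap_mx R m' n' by rewrite mul_swap.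
have iS := mxiso_swap R m' n'; rewrite e tau_mul // t1 tau_swap.
by split; [exact: mxisoM | have em := mxiso_eq hR iA; have en := mxiso_eq hR iB; subst m' n'].
Qed.

Lemma tau_swap_mid c d e d' :
  let W : 'M[R]_((c + d) + (e + d'), (c + e) + (d + d')) :=
    block_mx (block_mx 1%:M 0 0 0) (block_mx 0 0 1%:M 0)
             (block_mx 0 1%:M 0 0) (block_mx 0 0 0 1%:M) in
  mxiso W /\ tau W = sgb R (odd d && odd e).
Proof.
move=> W.
have e1 : W = block_mx (block_mx 1%:M 0 0 0) (col_mx 0 (row_mx 1%:M 0))
     (row_mx 0 (col_mx 1%:M 0)) (block_mx 0 0 0 1%:M).
  by rewrite /W [block_mx 0 0 1%:M 0]block_mxEv row_mx0 [block_mx 0 1%:M 0 0]block_mxEh col_mx0.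
pose V : 'M[R]_(d + (e + d'), e + (d + d')) :=
  block_mx 0 (row_mx 1%:M 0) (col_mx 1%:M 0) (block_mx 0 0 0 1%:M).
have [iV tV] : mxiso V /\ tau V = sgb R (odd d && odd e).
  rewrite /V block_mxA mxiso_cast tau_cast col_mx0 row_mx0 -/(swap_mx R d e).
  have [i t] := tau_ublock hR 0 (mxiso_swap R d e) (mxiso1 R d').
  by rewrite t tau1 addr0 tau_swap.
have e2 := @block_mxA R c d (e + d') c e (d + d') 1%:M 0 0 0 0
  (row_mx 1%:M 0) 0 (col_mx 1%:M 0) (block_mx 0 0 0 1%:M).
rewrite /= row_mx0 col_mx0 -e1 -/V in e2.
have [i t] := tau_ublock hR 0 (mxiso1 R c) iV.
rewrite e2 in i t; move: i t; rewrite mxiso_cast tau_cast => i ->.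
by rewrite tau1 add0r tV.
Qed.

End BlockTorsion.

Section Cones.
Variables (R : pzRingType) (hR : invariant_rank R).

(** d G + G d commutes with d, so a homotopy from 0 to an automorphism becomes a
    contraction when it is composed with the inverse of that automorphism. *)
Lemma contraction_unit (X : complex R) (G : gmap R (rk X) (rk X)) (U V : forall r, 'M[R]_(rk X r)) :
  (forall p q, q != p + 1 -> G p q = 0) ->
  (forall r, df X (r + 1) r *m G r (r + 1) + G (r - 1) r *m df X r (r - 1) = U r) ->
  (forall r, U r *m V r = 1%:M) -> (forall r, V r *m U r = 1%:M) -> contractible X.
Proof.
move=> dG eG UV VU; exists (fun p q => G p q *m V p); split=> [p q ne|r].
  by rewrite dG // mul0mx.
have comm : df X r (r - 1) *m U r = U (r - 1) *m df X r (r - 1).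
  rewrite -!eG mulmxDr mulmxDl !subrK !mulmxA df_df mul0mx add0r.
  by rewrite -(mulmxA _ (df X (r - 1) _)) df_df mulmx0 addr0.
have comm' : V (r - 1) *m df X r (r - 1) = df X r (r - 1) *m V r.
  by rewrite -[LHS]mulmx1 -(UV r) mulmxA -(mulmxA (V _)) comm mulmxA VU mul1mx.
by rewrite -!mulmxA comm' !mulmxA -mulmxDl eG UV.
Qed.

(** The homotopy inverse and the two homotopies form a map G of degree 1 on the cone for which
    d G + G d is unipotent; it need not be 1, as the two homotopies need not be compatible. *)
Lemma equiv_contractible (C D : complex R) (f : chain_map C D) :
  chain_equivalence f -> contractible (cone f).
Proof.
move=> [g [[H eH] [K eK]]].
pose G : gmap R (cone_rk C D) (cone_rk C D) := fun p q =>
  block_mx (if q == p + 1 then - K p q else 0) 0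
    (sg R p *: (idm C p (q - 1) *m g p)) (if q == p + 1 then - H (p - 1) (q - 1) else 0).
pose N r : 'M_(rk D r, rk C (r - 1)) :=
  sg R r *: (K (r - 1) r *m f (r - 1) - f r *m H (r - 1) r).
pose U b r : 'M_(rk D r + rk C (r - 1)) := block_mx 1%:M (if b then N r else - N r) 0 1%:M.
apply: (@contraction_unit (cone f) G (U true) (U false)) => [p q ne|r|r|r].
- rewrite /G (negPf ne) idm0 ?mul0mx ?scaler0 ?block_mx0 //.
  by apply: contra ne => /eqP ->; rewrite subrK.
- rewrite [df (cone f) _ _]/(cone_df f _ _) [df (cone f) _ _]/(cone_df f _ _).
  rewrite /cone_df /G eqxx subrK eqxx !mulmx_block !mulmx0 !mul0mx !add0r.
  rewrite add_block_mx addrK !idm1 !(mulmx_sg, sg_mulmx, mulmx1, mul1mx, addr0, add0r).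
  rewrite !(mulmxN, mulNmx) /U; congr block_mx.
  + have := eK r; move/eqP; rewrite subr_eq => /eqP e.
    rewrite scalerA -sgD sg_odd (_ : odd _ = false) ?scale1r /=; last by lia.
    by rewrite e -!addrA addKr addrCA addrN addr0.
  + rewrite /N scalerBr !scalerN [LHS]addrC; congr (_ - _).
      by rewrite -scaleNr; congr (_ *: _); symmetry; apply: sgN; lia.
    by congr (_ *: _); apply: sgE; lia.
  + by rewrite cm_df -scalerDl (@sgN _ r (r - 1)) ?addNr ?scale0r //; lia.
  + have := eH (r - 1); rewrite subrK => /eqP; rewrite subr_eq => /eqP e.
    rewrite scalerA -sgD sg_odd (_ : odd _ = false) ?scale1r /=; last by lia.
    by rewrite e -!addrA addKr addrCA addrN addr0.
- by rewrite mulmx_block !(mulmx1, mul1mx, mulmx0, mul0mx, addr0, add0r) addNr -scalar_mx_block.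
- by rewrite mulmx_block !(mulmx1, mul1mx, mulmx0, mul0mx, addr0, add0r) addrN -scalar_mx_block.
Qed.

Section Homotopy.
Variables (C D : complex R) (f f' : chain_map C D) (S : gmap R (rk C) (rk D)).
Hypothesis ff' : forall r,
  f' r - f r = df D (r + 1) r *m S r (r + 1) + S (r - 1) r *m df C r (r - 1).

Definition htpy_iso (b : bool) r : 'M[R]_(rk D r + rk C (r - 1), rk D r + rk C (r - 1)) :=
  block_mx 1%:M ((-1) ^+ b *: (sg R r *: S (r - 1) r)) 0 1%:M.

Lemma htpy_isoK b r : htpy_iso b r *m htpy_iso (~~ b) r = 1%:M.
Proof.
rewrite mulmx_block !(mulmx1, mul1mx, mulmx0, mul0mx, addr0, add0r) -scalerDl.
by case: b; rewrite ?addNr ?addrN scale0r -scalar_mx_block.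
Qed.

(** A homotopy between two chain maps is an isomorphism between their cones that is the identity
    on the subcomplex and on the quotient complex. *)
Lemma htpy_iso_df p q :
  cone_df f' p q *m htpy_iso false p = htpy_iso false q *m cone_df f p q.
Proof.
have [->|h] := eqVneq q (p - 1); last by rewrite !cone_deg // mulmx0 mul0mx.
rewrite /cone_df /htpy_iso !scale1r !idm1 !mul1mx.
rewrite !mulmx_block !(mulmx1, mul1mx, mulmx0, mul0mx, addr0, add0r); congr block_mx.
have := ff' (p - 1); rewrite subrK => /eqP; rewrite subr_eq => /eqP ->.
rewrite mulmx_sg sg_mulmx !scalerDr.
rewrite (@sgN _ (p + 1) p) 1?(@sgN _ (p - 1) p); try lia.
by rewrite !scaleNr -[X in _ + X = _]addrA addNKr [LHS]addrC.
Qed.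

Lemma htpy_contractible : contractible (cone f) -> contractible (cone f').
Proof.
apply: (@iso_contractible _ (cone f) (cone f') (htpy_iso false) (htpy_iso true)).
- exact: htpy_isoK.
- exact: htpy_isoK.
- exact: htpy_iso_df.
Qed.

Lemma no_parity : exists2 l, uniq l & bsupported l (fun _ => false).
Proof. by exists [::]. Qed.

Lemma utor_htpy : contractible (cone f) -> utor (cone f') = utor (cone f).
Proof.
move=> cf; rewrite (@utor_iso _ hR (cone f) (cone f') (htpy_iso false) (htpy_iso true)
  (htpy_isoK false) (htpy_isoK true) htpy_iso_df (Parity no_parity)) //.
  by rewrite /tots /psum big1 ?addr0 // => i _; rewrite andbF.
by move=> r; rewrite tau_unip.
Qed.
End Homotopy.

Section ChainIsoCone.
Variables (C D : complex R) (f : chain_map C D) (f' : forall r, 'M[R]_(rk C r, rk D r)).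
Hypotheses (fK : forall r, f r *m f' r = 1%:M) (fK' : forall r, f' r *m f r = 1%:M).

(** The cone of an isomorphism [f : C -> D] is isomorphic to the cone of the identity of [C], by [f]
    on one of the summands. *)
Lemma iso_cone (t : parity) : (forall r, t r -> rk C r != 0%N) ->
  (forall r, tau (f r) = sgb R (t r)) ->
  contractible (cone f) /\ utor (cone f) =
    sgb R (dotp (par C) (pshift 1 (par C)) (+) ods (par C) (+) tots t).
Proof.
move=> ht tf; have ci : contractible (cone (id_map C)).
  by exists (@id_G R C); apply: id_contraction.
pose g r : 'M_(rk D r + rk C (r - 1), rk C r + rk C (r - 1)) := block_mx (f r) 0 0 1%:M.
pose g' r : 'M_(rk C r + rk C (r - 1), rk D r + rk C (r - 1)) := block_mx (f' r) 0 0 1%:M.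
have k1 r : g r *m g' r = 1%:M.
  by rewrite mulmx_block !(mulmx1, mulmx0, mul0mx, addr0, add0r) fK -scalar_mx_block.
have k2 r : g' r *m g r = 1%:M.
  by rewrite mulmx_block !(mulmx1, mulmx0, mul0mx, addr0, add0r) fK' -scalar_mx_block.
have k3 p q : cone_df f p q *m g p = g q *m cone_df (id_map C) p q.
  have [->|h] := eqVneq q (p - 1); last by rewrite !cone_deg // mulmx0 mul0mx.
  rewrite /cone_df !idm1 !mulmx_block !(mulmx1, mul1mx, mulmx0, mul0mx, addr0, add0r) cm_df.
  by rewrite mulmx_sg mulmx1.
split; first exact: (@iso_contractible _ (cone (id_map C)) (cone f) g g').
rewrite (@utor_iso _ hR (cone (id_map C)) (cone f) g g' k1 k2 k3 t) //.
- by rewrite (utor_cone_id hR) -sgbD.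
- by move=> r /ht /=; rewrite /cone_rk; case: (rk C r).
by move=> r; rewrite (tau_diag hR) ?tau1 ?addr0 //; [exists (f' r) | exact: mxiso1].
Qed.

End ChainIsoCone.

(** Let [f : C -> D] and [g : D -> E]. The cones of [f] and [g] form an extension [ext_fg] whose
    connecting map is the identity of D up to signs, and base changes by [f] and [g] make it
    isomorphic to the direct sum [ext_gf] of the cones of the composite and of -1 : D -> D.
    Comparing the torsions of both gives additivity under composition. *)
Section Composition.
Variables (C D E : complex R) (f : chain_map C D) (g : chain_map D E).

Lemma comp_df p q : df E p q *m (g p *m f p) = g q *m f q *m df C p q.
Proof. by rewrite mulmxA cm_df -mulmxA cm_df mulmxA. Qed.

Definition comp_map : chain_map C E := @ChainMap R C E (fun r => g r *m f r) comp_df.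

Lemma opp_df p q : df D p q *m (- 1%:M) = - 1%:M *m df D p q.
Proof. by rewrite mulmxN mulNmx mulmx1 mul1mx. Qed.

Definition opp_map : chain_map D D := @ChainMap R D D (fun r => - 1%:M) opp_df.

Definition conn : gmap R (rk (cone g)) (rk (cone f)) := fun p q =>
  block_mx 0 (sg R p *: idm D (p - 1) q) 0 0 : 'M_(rk D q + rk C (q - 1), rk E p + rk D (p - 1)).

Lemma conn_deg p q : q != p - 1 -> conn p q = 0.
Proof. by move=> ne; rewrite /conn idm0 1?eq_sym // scaler0 block_mx0. Qed.

Lemma conn_df p q r : df (cone f) q r *m conn p q + conn q r *m df (cone g) p q = 0.
Proof.
have [->|h] := eqVneq q (p - 1); last first.
  by rewrite (conn_deg h) (@df_deg _ (cone g)) // !mulmx0 addr0.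
have [->|h] := eqVneq r (p - 1 - 1); last first.
  by rewrite (conn_deg h) (@df_deg _ (cone f)) // !mul0mx addr0.
rewrite [df (cone f) _ _]/(cone_df f _ _) [df (cone g) _ _]/(cone_df g _ _) /cone_df /conn.
rewrite !idm1 !mulmx_block !(mulmx1, mul1mx, mulmx0, mul0mx, addr0, add0r) add_block_mx.
rewrite !(mulmx_sg, sg_mulmx, mulmx1, mul1mx, mulmx0, mul0mx, addr0, add0r, scaler0).
by rewrite -scalerDl (@sgN _ p (p - 1)) ?addNr ?scale0r ?block_mx0 //; lia.
Qed.

Definition zero_conn : gmap R (rk (cone opp_map)) (rk (cone comp_map)) := fun p q => 0.

Lemma zero_conn_deg p q : q != p - 1 -> zero_conn p q = 0.
Proof. by []. Qed.

Lemma zero_conn_df p q r :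
  df (cone comp_map) q r *m zero_conn p q + zero_conn q r *m df (cone opp_map) p q = 0.
Proof. by rewrite mulmx0 mul0mx addr0. Qed.

Definition ext_fg := ext conn_deg conn_df.
Definition ext_gf := ext zero_conn_deg zero_conn_df.

(** The rows are D_r, C_(r-1), E_r, D_(r-1), the columns E_r, C_(r-1), D_r, D_(r-1). *)
Definition comp_iso r :
    'M[R]_((rk D r + rk C (r - 1)) + (rk E r + rk D (r - 1)),
           (rk E r + rk C (r - 1)) + (rk D r + rk D (r - 1))) :=
  block_mx (block_mx 0 0 0 1%:M) (block_mx 1%:M 0 0 0)
           (block_mx 1%:M 0 0 (f (r - 1))) (block_mx (- g r) 0 0 1%:M).

Definition comp_iso' r :
    'M[R]_((rk E r + rk C (r - 1)) + (rk D r + rk D (r - 1)),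
           (rk D r + rk C (r - 1)) + (rk E r + rk D (r - 1))) :=
  block_mx (block_mx (g r) 0 0 1%:M) (block_mx 1%:M 0 0 0)
           (block_mx 1%:M 0 0 (- f (r - 1))) (block_mx 0 0 0 1%:M).

Lemma comp_isoK r : comp_iso r *m comp_iso' r = 1%:M.
Proof.
rewrite /comp_iso /comp_iso' !mulmx_block !(mulmx1, mul1mx, mulmx0, mul0mx, addr0, add0r, mulmxN, mulNmx).
rewrite !add_block_mx !(mulmx1, mul1mx, mulmx0, mul0mx, addr0, add0r, mulmxN, mulNmx, oppr0).
by rewrite ?addrN ?addNr !scalar_mx_block !block_mx0.
Qed.

Lemma comp_isoK' r : comp_iso' r *m comp_iso r = 1%:M.
Proof.
rewrite /comp_iso /comp_iso' !mulmx_block !(mulmx1, mul1mx, mulmx0, mul0mx, addr0, add0r, mulmxN, mulNmx).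
rewrite !add_block_mx !(mulmx1, mul1mx, mulmx0, mul0mx, addr0, add0r, mulmxN, mulNmx, oppr0).
by rewrite ?addrN ?addNr !scalar_mx_block !block_mx0.
Qed.

Lemma comp_iso_df p q : df ext_fg p q *m comp_iso p = comp_iso q *m df ext_gf p q.
Proof.
have [->|h] := eqVneq q (p - 1); last first.
  by rewrite (@df_deg _ ext_fg) // (@df_deg _ ext_gf) // mulmx0 mul0mx.
rewrite [df ext_fg _ _]/(ext_df _ _ _) [df ext_gf _ _]/(ext_df _ _ _) /ext_df.
rewrite [df (cone _) _ _]/(cone_df _ _ _) [df (cone g) _ _]/(cone_df _ _ _).
rewrite [df (cone comp_map) _ _]/(cone_df _ _ _) [df (cone opp_map) _ _]/(cone_df _ _ _).
rewrite /cone_df /conn /zero_conn /comp_iso /= !idm1.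
rewrite !mulmx_block !(mulmx1, mul1mx, mulmx0, mul0mx, addr0, add0r, mulmxN, mulNmx).
rewrite !add_block_mx !(mulmx_sg, sg_mulmx, mulmx1, mul1mx, mulmx0, mul0mx, addr0, add0r, mulmxN, mulNmx, oppr0, scaler0).
rewrite (@sgN _ (p + 1) p); last by lia.
by rewrite !(scaleNr, scalerN, opprK) addNr !cm_df.
Qed.

Lemma tau_comp_iso r : tau (comp_iso r) =
  sgb R (odd (rk E r) && odd (rk C (r - 1)) (+) odd (rk E r) && odd (rk D r)
         (+) odd (rk C (r - 1)) && odd (rk D r)).
Proof.
set e := rk E r; set c := rk C (r - 1); set d := rk D r; set d' := rk D (r - 1).
have [iW tW] := tau_swap_mid hR c d e d'; set W := block_mx _ _ _ _ in iW tW.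
have [i1 t1] := tau_ublock hR 0 (mxiso_swap R d c) (mxiso1 R (e + d')).
have [i2 t2] := tau_ublock hR 0 (mxiso_swap R c e) (mxiso1 R (d + d')).
pose U : 'M[R]_((e + c) + (d + d')) := block_mx 1%:M (block_mx (- g r) 0 0 0) 0 1%:M.
pose L : 'M[R]_((e + c) + (d + d')) := block_mx 1%:M 0 (block_mx 0 0 0 (f (r - 1))) 1%:M.
have [i3 t3] := tau_ublock hR (block_mx (- g r) 0 0 0) (mxiso1 R (e + c)) (mxiso1 R (d + d')).
have [i4 t4] := tau_lblock hR (block_mx 0 0 0 (f (r - 1))) (mxiso1 R (e + c)) (mxiso1 R (d + d')).
have -> : comp_iso r = block_mx (swap_mx R d c) 0 0 1%:M *m W *m
    block_mx (swap_mx R c e) 0 0 1%:M *m L *m U.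
  rewrite /comp_iso /W /L /U /swap_mx !(@scalar_mx_block R e c) !(@scalar_mx_block R e d').
  rewrite !(@scalar_mx_block R d d').
  by rewrite !(mulmx_block, add_block_mx, mulmx1, mul1mx, mulmx0, mul0mx, addr0, add0r).
rewrite !(tau_mul hR) //; try by do ?apply: mxisoM.
rewrite t1 t2 t3 t4 tW !tau1 !(tau_swap hR) !addr0 -!sgbD; congr sgb.
by case: (odd e); case: (odd c); case: (odd d).
Qed.

Hypotheses (cf : contractible (cone f)) (cg : contractible (cone g)).

Lemma ext_gf_contractible : contractible ext_gf.
Proof.
apply: (@iso_contractible _ ext_fg ext_gf comp_iso' comp_iso comp_isoK' comp_isoK).
  move=> p q; rewrite -[LHS]mul1mx -(comp_isoK' q) -!mulmxA (mulmxA (comp_iso q)).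
  by rewrite -comp_iso_df -!mulmxA comp_isoK mulmx1.
exact: ext_contractible.
Qed.

Lemma comp_contractible : contractible (cone comp_map).
Proof. by have [] := ext_split (fun p q => erefl) ext_gf_contractible. Qed.

Definition comp_sign : parity :=
  padd (padd (pres (par E) (pshift 1 (par C))) (pres (par E) (par D))) (pres (pshift 1 (par C)) (par D)).

Lemma utor_comp : utor (cone f) + utor (cone g) =
  utor (cone comp_map) + utor (cone opp_map) + sgb R
   (low (par (cone f)) (par (cone g)) (+) low (par (cone comp_map)) (par (cone opp_map))
    (+) tots comp_sign).
Proof.
have [c1 c2] := ext_split (fun p q => erefl) ext_gf_contractible.
have e1 := utor_ext hR conn_deg conn_df cf cg.
have e2 := utor_ext hR zero_conn_deg zero_conn_df c1 c2.
have e3 := @utor_iso _ hR ext_gf ext_fg comp_iso comp_iso' comp_isoK comp_isoK' comp_iso_df comp_sign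
   ext_gf_contractible.
have e1' : utor (cone f) + utor (cone g) =
    utor ext_fg + sgb R (low (par (cone f)) (par (cone g))) by rewrite e1 -addrA sgbb addr0.
rewrite e1' e3; first by rewrite e2 !sgbD -!addrA; congr (_ + (_ + _)); rewrite addrA addrC.
  move=> r /=; rewrite -[ext_rk _ _ _]/((rk E r + rk C (r - 1)) + (rk D r + rk D (r - 1)))%N.
  by case: (rk E r) => [|e]; case: (rk C (r - 1)) => [|c] //=; rewrite ?addn0 ?add0n // andbF.
by move=> r; rewrite tau_comp_iso.
Qed.

End Composition.

End Cones.

(** * Torsion of chain equivalences *)

Lemma addb_xorb a b : a (+) b = xorb a b.
Proof. by case: a; case: b. Qed.

Lemma addb_move a b c : a (+) b = c -> a = c (+) b.
Proof. by move=> <-; rewrite addbK. Qed.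

Lemma dotp_sym a b : dotp a b = dotp b a.
Proof. by rewrite /dotp ker_sym; apply: ker_ext => i j; rewrite eq_sym. Qed.

(** Decides an equality between boolean polynomials. *)
Ltac bool_ring := rewrite ?addb_xorb; btauto.

Section Signed.
Variables (R : pzRingType) (hR : invariant_rank R).

(** The isomorphism d + G shows that the ranks in odd and in even degrees have the same sum. *)
Lemma contractible_tots (X : complex R) : contractible X -> tots (par X) = false.
Proof.
move=> [G cG]; have c0 := covers_evl_rk (leqnn (bd X)); have c1 := covers_odl_rk (leqnn (bd X)).
rewrite (sum_covers c0 c1) => [|r]; last by rewrite /=; case: (rk X r).
have := mxiso_eq hR (giso_dG hR cG c1 c0) => /(congr1 odd).
by rewrite !odd_size_basis => ->; rewrite addbb.
Qed.

Lemma tots_shift k a : tots (pshift k a) = tots a.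
Proof. exact: psum_shift. Qed.

Lemma tots_flip k a : tots (pflip k a) = tots a.
Proof. exact: psum_flip. Qed.

Lemma tots_add a b : tots (padd a b) = tots a (+) tots b.
Proof. exact: psumD. Qed.

Lemma ods_add a b : ods (padd a b) = ods a (+) ods b.
Proof. exact: psumD. Qed.

Lemma ods_shift1 a : ods (pshift 1 a) = tots a (+) ods a.
Proof. by rewrite -evs_tots /ods psum_shift; apply: psum_ext => i; lia. Qed.

Lemma equiv_tots (C D : complex R) (f : chain_map C D) : contractible (cone f) ->
  tots (par D) = tots (par C).
Proof.
move=> /contractible_tots; rewrite par_cone tots_add tots_shift.
by case: (tots (par D)); case: (tots (par C)).
Qed.

Lemma tau_mapE (C D : scomplex R) (f : chain_map C D) : contractible (cone f) ->
  tau_map C D f = utor (cone f) + (eta D + eta C) +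
    sgb R (low (par D) (pshift 1 (par C)) (+) (ods (par D) && tots (par C))).
Proof. by move=> cf; rewrite /tau_map tau_newE // eta_scone !addrA. Qed.

Lemma tau_map_htpy (C D : scomplex R) (f f' : chain_map C D) (S : gmap R (rk C) (rk D)) :
  (forall r, f' r - f r = df D (r + 1) r *m S r (r + 1) + S (r - 1) r *m df C r (r - 1)) ->
  contractible (cone f) -> tau_map C D f' = tau_map C D f.
Proof.
move=> h cf; rewrite !tau_mapE ?(utor_htpy hR h) //.
exact: htpy_contractible h cf.
Qed.

Lemma eta2 (C : scomplex R) : eta C + eta C = 0.
Proof. by have [b ->] := sgb_sign (eta_sign C); rewrite sgbb. Qed.

Lemma eta_sgb (C : scomplex R) : exists b, eta C = sgb R b.
Proof. exact: sgb_sign (eta_sign C). Qed.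

(** For an isomorphism the sign terms of the cone cancel those of [iso_cone], by [low_shift1]. *)
Lemma tau_map_iso (C D : scomplex R) (f : chain_map C D) (f' : forall r, 'M[R]_(rk C r, rk D r))
    (t : parity) :
  (forall r, f r *m f' r = 1%:M) -> (forall r, f' r *m f r = 1%:M) ->
  (forall r, t r -> rk C r != 0%N) -> (forall r, tau (f r) = sgb R (t r)) ->
  contractible (cone f) /\ tau_map C D f = sgb R (tots t) + (eta D + eta C).
Proof.
move=> k k' ht tf; have [cf uf] := iso_cone hR k k' ht tf; split=> //.
have e : par D = par C by apply: parityP => r /=; rewrite (hR (k r) (k' r)).
rewrite tau_mapE // uf e addrAC -sgbD; congr (sgb R _ + _).
have h := low_shift1 (par C).
move: h; case: (low _ _); case: (dotp _ _); case: (ods _); case: (tots (par C)); case: (tots t) => //.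
Qed.

(** The sign in the definition of the cone is made for this: the terms of [utor_comp] are brought
    to normal form by [lowD] and [low_shift1], and cancel because chain equivalent complexes have
    the same Euler characteristic modulo 2. *)
Lemma tau_map_comp (C D E : scomplex R) (f : chain_map C D) (g : chain_map D E) :
  contractible (cone f) -> contractible (cone g) ->
  contractible (cone (comp_map f g)) /\
  tau_map C E (comp_map f g) = tau_map C D f + tau_map D E g.
Proof.
move=> cf cg; have cgf := comp_contractible cf cg; split=> //.
have ed := equiv_tots cf; have ee := equiv_tots cg.
have := utor_comp hR cf cg.
rewrite !tau_mapE // addrACA [utor (cone f) + _ + _]addrACA => ->.
have k : - 1%:M *m - 1%:M = 1%:M :> 'M[R]_0 by apply/matrixP => -[].
have kk r : (- 1%:M : 'M[R]_(rk D r)) *m - 1%:M = 1%:M by rewrite mulmxN mulNmx opprK mulmx1.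
have ht r : par D r -> rk D r != 0%N by rewrite /=; case: (rk D r).
have [_ ->] := @iso_cone _ hR D D (opp_map D) (fun r => - 1%:M) kk kk (par D) ht
   (fun r => tauN1 hR (rk D r)).
have [bC ->] := eta_sgb C; have [bD ->] := eta_sgb D; have [bE ->] := eta_sgb E.
rewrite -!addrA -!sgbD; congr (_ + sgb R _).
rewrite !par_cone !(lowDl, lowDr) /comp_sign !tots_add -!dotpE !low_shift ?ee ed.
rewrite (dotp_sym (par E) (par D)) (dotp_sym (par E)).
have /addb_move/addb_move h1 := lowD (par D) (par E).
have /addb_move/addb_move h2 := lowD (pshift 1 (par C)) (par E).
have /addb_move/addb_move h3 := lowD (pshift 1 (par C)) (par D).
have /addb_move h4 := low_shift1 (par D).
rewrite ?(ods_shift1, tots_shift, ee, ed) in h1 h2 h3 h4.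
rewrite h1 h2 h3 h4.
bool_ring.
Qed.

End Signed.

(** * Torsion of dual complexes *)

Section DualTorsion.
Variables (R : pzRingType) (hR : invariant_rank R) (J : involution R).

Lemma liso_scale_diag (X : eqType) (s : X -> bool) (L : seq X) : uniq L ->
  liso (fun x y => (-1) ^+ s x * delta R x y) L L /\
  ltau (fun x y => (-1) ^+ s x * delta R x y) L L = sgb R (\sum_(x <- L) s x).
Proof.
elim: L => [|x L IH] u; first by rewrite big_nil; split; [exact: liso_nil | exact: ltau_nil].
have {IH} [iL tL] := IH (subseq_uniq (subseq_cons L x) u).
pose F := fun x y : X => (-1) ^+ s x * delta R x y : R.
have e : mxof F [:: x] [:: x] = (-1) ^+ s x *: 1%:M.
  apply/matrixP => i j; rewrite !mxE !(tnth_nth x) !ord1 /= /F /delta eqxx.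
  by rewrite mulr1n.
have i1 : liso F [:: x] [:: x].
  rewrite /liso e; case: (s x); rewrite ?scaleN1r ?scale1r; last exact: mxiso1.
  exact/mxisoN/mxiso1.
have t1 : ltau F [:: x] [:: x] = sgb R (s x).
  rewrite /ltau e; case: (s x); rewrite ?scaleN1r ?scale1r ?tau1 //.
have z : {in L & [:: x], forall y z, F y z = 0}.
  move=> y z yL; rewrite inE => /eqP ->; rewrite /F /delta; case: eqP => [e'|_]; last by rewrite mulr0.
  by move: u; rewrite /= -e' yL.
have [i t] := ltau_ublock hR z i1 iL.
by rewrite big_cons sgbD -tL -t1.
Qed.

Lemma ltau_scale (X Y : eqType) (s : X -> bool) (t : Y -> bool) (F : X -> Y -> R) L M :
  uniq L -> uniq M -> liso F L M ->
  ltau (fun x y => (-1) ^+ s x * F x y * (-1) ^+ t y) L M =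
  ltau F L M + sgb R ((\sum_(x <- L) s x) (+) (\sum_(y <- M) t y)).
Proof.
move=> uL uM iF; have [i1 t1] := liso_scale_diag s uL; have [i2 t2] := liso_scale_diag t uM.
rewrite sgbD -t1 -t2 addrCA addrA /ltau -!(tau_mul hR) //; last exact: mxisoM.
congr tau; rewrite !mxof_mul; apply: mxof_ext => x y xL yM.
rewrite (eq_bigr (fun y' => (-1) ^+ s x * F x y' * (-1) ^+ t y' * delta R y' y)); last first.
  move=> y' _; rewrite !mulrA; congr (_ * _ * _).
  rewrite (eq_bigr (fun x' => delta R x x' * ((-1) ^+ s x * F x' y'))); last first.
    by move=> x' _; rewrite !mulrA; congr (_ * _); rewrite /delta; case: eqP; rewrite ?mulr1 ?mul1r ?mulr0 ?mul0r.
  by rewrite (sum_delta (fun x' => (-1) ^+ s x * F x' y')).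
by rewrite (sum_deltar (fun y' => (-1) ^+ s x * F x y' * (-1) ^+ t y')).
Qed.

(** The entries of the dual map are those of the map, transposed and conjugated. *)
Lemma ltau_dag (X Y : Type) (F : X -> Y -> R) L M : liso F L M ->
  liso (fun y x => J (F x y)) M L /\
  ltau (fun y x => J (F x y)) M L = k1_dag J (ltau F L M).
Proof.
have e : mxof (fun y x => J (F x y)) M L = dag J (mxof F L M).
  by apply/matrixP => i j; rewrite !mxE.
rewrite /liso /ltau e; move: (mxof F L M) => A [B [e1 e2]].
have em := hR e1 e2; move: A B e1 e2; rewrite -em => A B e1 e2.
split; first by exists (dag J B); rewrite -!dagM e1 e2 dag1.
by rewrite -(@k1_dag_tau R J _ A B) //.
Qed.

Lemma sum_basis_parity (p : int -> nat) l (d : int -> bool) :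
  \sum_(x <- basis p l) d x.1 = \sum_(r <- l) (d r && odd (p r)).
Proof.
elim: l => [|r l IH]; first by rewrite !big_nil.
rewrite basis_cons big_cat big_cons IH; congr (_ + _); rewrite /blk big_map /=.
elim: (p r) 0%N => [|k IHk] j; first by rewrite big_nil andbF.
by rewrite /= big_cons IHk /=; case: (d r); case: odd.
Qed.

Lemma basis_flip (p : int -> nat) (m : int) l :
  basis (fun r => p (m - r)) l = [seq (m - x.1, x.2) | x <- basis p [seq m - r | r <- l]].
Proof.
elim: l => // r l IH; rewrite /= !basis_cons map_cat IH; congr (_ ++ _).
by rewrite /blk -map_comp; apply: eq_map => k /=; rewrite flipK.
Qed.

(** The degrees in which basis elements change sign, so that the matrix of the differential and
    the contraction of the dual complex becomes the conjugate transpose of that of d + G. *)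
Definition dual_sign (m : nat) (r : int) : bool :=
  if odd m then (r == 1 %[mod 4])%Z || (r == 2 %[mod 4])%Z
  else (r == 2 %[mod 4])%Z || (r == 3 %[mod 4])%Z.

Section Dual.
Variables (m : nat) (C : complex R).

Definition dual_G (G : gmap R (rk C) (rk C)) : gmap R (dual_rk m C) (dual_rk m C) :=
  fun p q => sg R (p + 1) *: dag J (G (m%:Z - q) (m%:Z - p)).

Lemma dual_contraction G : chain_contraction G -> @chain_contraction R (dual J m C) (dual_G G).
Proof.
move=> [dG eG]; split=> [p q ne|r].
  by rewrite /dual_G dG ?dag0 ?scaler0 //; apply: contra ne => /eqP; lia.
rewrite [df _ _ _]/(dual_df J m C _ _) [df (dual J m C) _ _]/(dual_df J m C _ _) /dual_df /dual_G.
rewrite !(mulmx_sg, sg_mulmx) !sgZZ -!dagM subrK sgZZ.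
have e1 : m%:Z - (r + 1) = m%:Z - r - 1 by lia.
have e2 : m%:Z - (r - 1) = m%:Z - r + 1 by lia.
by rewrite /= /dual_rk e1 e2 [LHS]addrC -dagD eG dag1.
Qed.

Lemma dual_contractible : contractible C -> contractible (dual J m C).
Proof. by case=> G cG; exists (dual_G G); apply: dual_contraction. Qed.

Lemma covers_flip c (p : int -> nat) L : covers c p L ->
  covers (odd m (+) c) (fun r => p (m%:Z - r)) (rev [seq m%:Z - r | r <- L]).
Proof.
move=> [sL pL hL]; split.
- by rewrite rev_sorted sorted_map; apply: sub_sorted sL => i j /=; lia.
- move=> r; rewrite mem_rev => /mapP[s /pL es ->]; rewrite -es; lia.
move=> r er nr; rewrite mem_rev; apply/mapP; exists (m%:Z - r); last by rewrite flipK.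
apply: hL => //; move: er; lia.
Qed.

Lemma flip_rev L : [seq m%:Z - r | r <- rev [seq m%:Z - r | r <- L]] = rev L.
Proof.
rewrite map_rev -map_comp (eq_map (g := id)) ?map_id // => r /=; exact: flipK.
Qed.

Lemma ent_dual (f : gmap R (rk C) (rk C)) x y :
  ent (fun a b => dag J (f (m%:Z - b) (m%:Z - a)) : 'M_(dual_rk m C b, dual_rk m C a))
    (m%:Z - x.1, x.2) (m%:Z - y.1, y.2) = J (ent f y x).
Proof.
case: x y => [s i] [t j]; pose F s t : R := match insub i, insub j with
  | Some a, Some b => dag J (f s t) a b | _, _ => 0 end.
rewrite -[LHS]/(F (m%:Z - (m%:Z - s)) (m%:Z - (m%:Z - t))) !flipK /F /ent /=.
case: (insub i : option 'I_(rk C s)) => [a|]; case: (insub j : option 'I_(rk C t)) => [b|];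
  by rewrite ?raddf0 // !mxE.
Qed.

Lemma ent_sign (f g : gmap R (rk C) (rk C)) (e : bool) x y :
  f y.1 x.1 = (-1) ^+ e *: g y.1 x.1 -> ent f x y = (-1) ^+ e * ent g x y.
Proof.
rewrite /ent => ->; case: (insub x.2 : option 'I_(rk C x.1)) => [a|]; rewrite ?mulr0 //.
by case: (insub y.2 : option 'I_(rk C y.1)) => [b|]; rewrite ?mulr0 // !mxE.
Qed.

(** The differential of the dual complex enters its matrix with the sign -1, its contraction with
    the sign 1. So [dual_sign] has to differ between s and s - 1 and to agree between s and
    s + 1, which forces the period 4. *)
Lemma dual_sign_step (s : int) : oddz s = odd m ->
  dual_sign m s (+) dual_sign m (s - 1) = true /\ dual_sign m s (+) dual_sign m (s + 1) = false.
Proof.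
rewrite /dual_sign; case: (odd m) => e; split; lia.
Qed.

Lemma signed_dG (G : gmap R (rk C) (rk C)) s t : chain_contraction G -> oddz s = odd m ->
  sg R (m%:Z - t) *: df C s t + sg R (m%:Z - t + 1) *: G s t =
  (-1) ^+ (dual_sign m s (+) dual_sign m t) *: dG G s t.
Proof.
move=> cG es; rewrite /dG; have [->|ne] := eqVneq t (s - 1).
  have [-> _] := dual_sign_step es.
  rewrite cG.1; last by lia.
  by rewrite !(scaler0, addr0) sg_odd; congr (_ ^+ nat_of_bool _ *: _); lia.
have [->|ne'] := eqVneq t (s + 1); last by rewrite df_deg // cG.1 // !(scaler0, addr0).
have [_ ->] := dual_sign_step es.
rewrite df_deg; last by lia.
by rewrite scaler0 !add0r sg_odd; congr (_ ^+ nat_of_bool _ *: _); lia.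
Qed.

Lemma k1_dagN (x : K1 R) : k1_dag J (- x) = - k1_dag J x.
Proof. by apply/eqP; rewrite -addr_eq0 -k1_dagD addNr k1_dag0. Qed.

Lemma lowsum_covers c L M : covers c (rk C) L -> covers (~~ c) (rk C) M ->
  lowsum L (par C) (par C) (+) lowsum M (par C) (par C) = low (par C) (par C).
Proof.
wlog -> : c L M / c = false => [h cL cM|cL cM].
  case: c cL cM => cL cM; last exact: (h false).
  by rewrite addbC; apply: (h false).
have [uL uM] := (covers_uniq cL, covers_uniq cM); have [_ pL _] := cL; have [_ pM _] := cM.
by rewrite (low_split uL uM uL uM pL pM pL pM (covers_mem cL cM) (covers_mem cL cM)).
Qed.

Lemma psum_covers (F : int -> bool) c L M : covers c (rk C) L -> covers (~~ c) (rk C) M ->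
  psum F (par C) = (\sum_(r <- L) (F r && par C r)) (+) (\sum_(r <- M) (F r && par C r)).
Proof.
wlog -> : c L M / c = false => [h cL cM|cL cM].
  case: c cL cM => cL cM; last exact: (h false).
  by rewrite addbC; apply: (h false).
have := @sum_covers (pres F (par C)) (rk C) _ _ cL cM.
rewrite /tots psum_res /= => <- // r /andP[_] /=.
by case: (rk C r).
Qed.

(** Up to the signs of [dual_sign], the matrix of the dual complex is the conjugate transpose of the
    matrix of d + G. Dualizing reverses the order of the degrees, which gives the terms [low]. In
    even dimension it is the map from even to odd degrees that is transposed, and this is the
    inverse of d + G up to torsion 0. *)
Lemma utor_dual : contractible C -> utor (dual J m C) =
  k1_dag J (utor C) *~ (-1) ^+ m.+1 +
  sgb R (low (par C) (par C) (+) psum (dual_sign m) (par C)).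
Proof.
move=> [G cG]; have cG' := dual_contraction cG.
have [L cL] : exists L, covers (odd m) (rk C) L.
  case: (odd m); [exists (odl (bd C)); exact: covers_odl_rk | exists (evl (bd C)); exact: covers_evl_rk].
have [M cM] : exists M, covers (~~ odd m) (rk C) M.
  case: (odd m); [exists (evl (bd C)); exact: covers_evl_rk | exists (odl (bd C)); exact: covers_odl_rk].
have d0 := covers_flip cL; have d1 := covers_flip cM.
rewrite addbb in d0; rewrite addbN addbb in d1.
have [uL uM] := (covers_uniq cL, covers_uniq cM).
have [sL pL hL] := cL; have [sM pM hM] := cM.
rewrite (utorE hR cG' d1 d0) /gtau !(basis_flip (rk C)) !flip_rev ltau_map.
have iG := giso_dG hR cG cL cM.
have [vL vM] : uniq (basis (rk C) (rev L)) /\ uniq (basis (rk C) (rev M)).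
  by split; apply: basis_uniq; rewrite rev_uniq.
have pmL : perm_eq (basis (rk C) (rev L)) (basis (rk C) L) by apply: perm_rev_fl.
have pmM : perm_eq (basis (rk C) (rev M)) (basis (rk C) M) by apply: perm_rev_fl.
have pmL' := pmL; rewrite perm_sym in pmL'.
have iG1 : liso (ent (dG G)) (basis (rk C) M) (basis (rk C) (rev L)).
  by apply: (liso_permr (basis_uniq _ uL) pmL' iG).
have iG2 : liso (ent (dG G)) (basis (rk C) (rev M)) (basis (rk C) (rev L)).
  exact: liso_perm vM pmM iG1.
have [iJ tJ] := ltau_dag iG2.
rewrite (ltau_ext (G := fun x y => (-1) ^+ dual_sign m x.1 * J (ent (dG G) y x) *
     (-1) ^+ dual_sign m y.1)).
  rewrite ltau_scale // tJ (ltau_perm hR vM pmM iG1).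
  rewrite (ltau_permr hR (basis_uniq _ uL) pmL' iG) (psgn_sym hR vL pmL).
  rewrite (psgn_rev hR sL) ?basis_uniq // (psgn_rev hR sM) ?basis_uniq //.
  have szE (K : seq int) : lowsum K (fun r => odd (size (blk (rk C) r))) (fun r => odd (size (blk (rk C) r)))
      = lowsum K (par C) (par C).
    by apply: eq_bigr => i _; apply: eq_bigr => j _; rewrite !size_blk.
  rewrite !szE !sum_basis_parity !(perm_big _ (permEl (perm_rev _))) /=.
  rewrite sgbN addrCA -sgbD k1_dagD k1_dag_sgb -addrA -sgbD (psum_covers _ cL cM).
  rewrite [X in X (+) _]addbC (lowsum_covers cL cM).
  congr (_ + _); rewrite -signr_odd /=; case om: (odd m) cL cM => cL cM /=.
    by rewrite expr0 mulr1z (utorE hR cG cL cM).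
  by rewrite expr1 mulrN1z -k1_dagN (utorE hR cG cM cL) -(gtau_dGN hR cG cG cM cL).
move=> x y; rewrite !mem_basis !mem_rev => /andP[xL _] /andP[yM _].
pose f : gmap R (rk C) (rk C) := fun s t => sg R (m%:Z - t) *: df C s t + sg R (m%:Z - t + 1) *: G s t.
transitivity (ent (fun a b => dag J (f (m%:Z - b) (m%:Z - a)) : 'M_(dual_rk m C b, dual_rk m C a))
    (m%:Z - x.1, x.2) (m%:Z - y.1, y.2)).
  apply: ent_ext => /=; rewrite /dG [df _ _ _]/(dual_df J m C _ _) /dual_df /dual_G /f.
  by rewrite dagD !dag_sg (subKr m%:Z (m%:Z - y.1)).
rewrite ent_dual (@ent_sign f (dG G) (dual_sign m x.1 (+) dual_sign m y.1)).
  case: (dual_sign m x.1); case: (dual_sign m y.1);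
    by rewrite /= ?expr1 ?expr0 ?mul1r ?mulr1 ?mulN1r ?mulrN1 ?mulrNN ?raddfN ?opprK ?mul1r.
exact: signed_dG cG (pL _ xL).
Qed.

End Dual.
End DualTorsion.

(** * Torsion of dual maps *)

Section FlipSigns.
Implicit Types a b : parity.

Lemma tots_pres F a : tots (pres F a) = psum F a.
Proof. by rewrite /tots psum_res; apply: psum_ext. Qed.

Lemma psum_const (c : bool) a : psum (fun _ => c) a = c && tots a.
Proof. by case: c => //; rewrite /psum big1. Qed.

Lemma dotp_flip k a b : dotp (pflip k a) (pflip k b) = dotp a b.
Proof. by rewrite /dotp ker_flipl ker_flipr; apply: ker_ext => i j; rewrite (can_eq (flipK k)). Qed.

Lemma ods_flip k a : ods (pflip k a) = (oddz k && tots a) (+) ods a.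
Proof.
rewrite /ods psum_flip -psum_const -psumDF; apply: psum_ext => i; lia.
Qed.

Lemma flip_shift1 n a : pflip n%:Z a = pflip n.+1%:Z (pshift 1 a).
Proof. by apply: parityP => r /=; congr (a _); lia. Qed.

Lemma shift1_flip n a : pshift 1 (pflip n%:Z a) = pflip n.+1%:Z a.
Proof. by apply: parityP => r /=; congr (a _); lia. Qed.

(** The parity of n(n + 1)/2, by [odd_triangle]. *)
Definition odd_tri (n : nat) : bool := odd (n.+1 %/ 2).

(** The sign functions [alpha_deg] and [dual_sign] have period 4 in all their arguments, so that
    identities between them are checked on 16 cases. *)
Lemma mod4_cases (i : int) : exists2 r : int, (forall k, (i == k %[mod 4])%Z = (r == k %[mod 4])%Z)
   /\ oddz i = oddz r & (r = 0 \/ r = 1 \/ r = 2 \/ r = 3).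
Proof. by exists (i %% 4)%Z; [split=> [k|]; [rewrite modz_mod|]; lia | lia]. Qed.

Lemma nat_mod4 n : exists2 r : nat, [/\ odd n = odd r, odd (n.+1 %/ 2) = odd (r.+1 %/ 2)
   & forall i k : int, (i == n%:Z + k %[mod 4])%Z = (i == r%:Z + k %[mod 4])%Z] &
   (r = 0 \/ r = 1 \/ r = 2 \/ r = 3)%N.
Proof.
exists (n %% 4)%N; last by lia.
split; first by lia.
  by lia.
by move=> i k; lia.
Qed.

Lemma dual_sign_alpha n (i : int) : dual_sign n.+1 i (+) alpha_deg n i = oddz i (+) odd_tri n.
Proof.
rewrite /dual_sign /alpha_deg /odd_tri /=.
have [r [e1 ->] hr] := mod4_cases i; have [s [-> -> e2] hs] := nat_mod4 n.
by rewrite !e1 !e2; move: hs hr => [->|[->|[->|->]]] [->|[->|[->|->]]].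
Qed.

Lemma dual_sign_alpha1 n (i : int) :
  dual_sign n.+1 (i + 1) (+) alpha_deg n i = odd_tri n (+) ~~ odd n.
Proof.
rewrite /dual_sign /alpha_deg /odd_tri /=.
have e3 k : (i + 1 == k + 1 %[mod 4])%Z = (i == k %[mod 4])%Z by lia.
rewrite (e3 0) (e3 1) (e3 2).
have [r [e1 _] hr] := mod4_cases i; have [s [-> -> e2] hs] := nat_mod4 n.
by rewrite !e1 !e2; move: hs hr => [->|[->|[->|->]]] [->|[->|[->|->]]].
Qed.

End FlipSigns.

Section DualCone.
Variables (R : pzRingType) (hR : invariant_rank R) (J : involution R) (n : nat).
Local Notation sg := (sg R).

Lemma idmK (C : complex R) p q : p = q -> idm C p q *m idm C q p = 1%:M.
Proof. by move=> ->; rewrite idm1 mulmx1. Qed.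

Lemma mxiso_idm (C : complex R) p q : p = q -> mxiso (idm C p q).
Proof. by move=> ->; rewrite idm1; apply: mxiso1. Qed.

Lemma tau_idm (C : complex R) p q : p = q -> tau (idm C p q) = 0.
Proof. by move=> ->; rewrite idm1 tau1. Qed.

Section DualMap.
Variables (C D : complex R) (f : chain_map C D).

Lemma dual_map_df p q :
  dual_df J n C p q *m dag J (f (n%:Z - p)) = dag J (f (n%:Z - q)) *m dual_df J n D p q.
Proof. by rewrite /dual_df mulmx_sg sg_mulmx -!dagM cm_df. Qed.

Definition dual_map : chain_map (dual J n D) (dual J n C) :=
  @ChainMap R (dual J n D) (dual J n C) (fun r => dag J (f (n%:Z - r))) dual_map_df.

Local Notation m := (n.+1%:Z).

(** The cone of the dual of [f] is isomorphic to the dual of the cone of [f], in dimension one higher,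
    by an exchange of the two summands with suitable signs. *)
Definition dual_cone_iso r : 'M[R]_(rk C (n%:Z - r) + rk D (n%:Z - (r - 1)), rk D (m - r) + rk C (m - r - 1)) :=
  block_mx 0 (sg n%:Z *: idm C (m - r - 1) (n%:Z - r)) (sg r *: idm D (m - r) (n%:Z - (r - 1))) 0.

Definition dual_cone_iso' r : 'M[R]_(rk D (m - r) + rk C (m - r - 1), rk C (n%:Z - r) + rk D (n%:Z - (r - 1))) :=
  block_mx 0 (sg r *: idm D (n%:Z - (r - 1)) (m - r)) (sg n%:Z *: idm C (n%:Z - r) (m - r - 1)) 0.

Lemma dual_cone_isoK r : dual_cone_iso r *m dual_cone_iso' r = 1%:M.
Proof.
rewrite mulmx_block !(mulmx0, mul0mx, addr0, add0r) !(mulmx_sg, sg_mulmx) !sgZZ.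
by rewrite !idmK -?scalar_mx_block //; lia.
Qed.

Lemma dual_cone_isoK' r : dual_cone_iso' r *m dual_cone_iso r = 1%:M.
Proof.
rewrite mulmx_block !(mulmx0, mul0mx, addr0, add0r) !(mulmx_sg, sg_mulmx) !sgZZ.
by rewrite !idmK -?scalar_mx_block //; lia.
Qed.

Lemma dag_idm_comm a a' b : a' = a -> b = a ->
  idm C a' a *m (dag J (f a') *m idm D b a') = dag J (f a) *m idm D b a.
Proof. by move=> -> ->; rewrite !idm1 mul1mx. Qed.

Lemma dual_cone_iso_df p q :
  cone_df dual_map p q *m dual_cone_iso p = dual_cone_iso q *m dual_df J n.+1 (cone f) p q.
Proof.
have [->|h] := eqVneq q (p - 1); last by rewrite cone_deg // dual_deg // mulmx0 mul0mx.
rewrite /dual_df [df (cone f) _ _]/(cone_df f _ _) /cone_df /dual_cone_iso dag_block dag0.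
rewrite [df (dual J n C) _ _]/(dual_df J n C _ _) [df (dual J n D) _ _]/(dual_df J n D _ _) /dual_df.
rewrite idm1 mul1mx scale_block_mx !mulmx_block !(mulmx0, mul0mx, addr0, add0r, scaler0).
rewrite !(mulmx_sg, sg_mulmx) dag_sg dagM dag_idm !(mulmx_sg, sg_mulmx).
congr block_mx.
- rewrite dag_idm_comm; try lia.
  rewrite !scalerA -!sgD; congr (_ *: _); apply: sgE; lia.
- rewrite (@idm_mulr _ C _ (fun q => dag J (df C (n%:Z - (p - 1)) q))); last by lia.
  rewrite (@idm_mull _ C _ (fun q => dag J (df C q (m - p - 1)))); last by lia.
  by rewrite !scalerA -!sgD; congr (_ *: _); apply: sgE; lia.
- rewrite (@idm_mulr _ D _ (fun q => dag J (df D (n%:Z - (p - 1 - 1)) q))); last by lia.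
  rewrite (@idm_mull _ D _ (fun q => dag J (df D q (m - p)))); last by lia.
  by rewrite !scalerA -!sgD; congr (_ *: _); apply: sgE; lia.
Qed.

Definition dual_cone_sign : parity :=
  padd (padd (pres (fun _ => odd n) (pflip n%:Z (par C)))
    (pres (fun r => oddz r) (pflip m (par D)))) (pres (pflip n%:Z (par C)) (pflip m (par D))).

Lemma tau_dual_cone_iso r : tau (dual_cone_iso r) = sgb R (dual_cone_sign r).
Proof.
have i1 : mxiso (sg n%:Z *: idm C (m - r - 1) (n%:Z - r)) by apply/mxiso_sg/mxiso_idm; lia.
have i2 : mxiso (sg r *: idm D (m - r) (n%:Z - (r - 1))) by apply/mxiso_sg/mxiso_idm; lia.
have [_ ->] := tau_antidiag hR 0 i1 i2.
have e : n%:Z - (r - 1) = m - r by lia.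
rewrite !(tau_sg hR) ?tau_idm; try (apply: mxiso_idm; lia); try lia.
by rewrite !add0r -!sgbD /= e.
Qed.

Hypothesis cf : contractible (cone f).

Lemma dual_map_contractible : contractible (cone dual_map).
Proof.
apply: (@iso_contractible _ (dual J n.+1 (cone f)) (cone dual_map) dual_cone_iso dual_cone_iso' dual_cone_isoK dual_cone_isoK').
  exact: dual_cone_iso_df.
exact: dual_contractible.
Qed.

Lemma utor_dual_map : utor (cone dual_map) = k1_dag J (utor (cone f)) *~ (-1) ^+ n +
  sgb R (low (par (cone f)) (par (cone f)) (+) psum (dual_sign n.+1) (par (cone f)) (+) tots dual_cone_sign).
Proof.
have cd := dual_contractible J n.+1 cf.
rewrite (@utor_iso _ hR (dual J n.+1 (cone f)) (cone dual_map) dual_cone_iso dual_cone_iso' dual_cone_isoK dual_cone_isoK'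
  dual_cone_iso_df dual_cone_sign cd).
- by rewrite (utor_dual hR) // [in RHS]sgbD addrA !exprS !mulN1r opprK.
- move=> r /=; rewrite /dual_rk /= /cone_rk -[rk C (n%:Z - r)]/(rk C _).
  have -> : n%:Z - r = m - r - 1 by lia.
  case: (rk D _) => [|d]; case: (rk C _) => [|c] //=; rewrite ?addn0 ?add0n ?andbF //.
exact: tau_dual_cone_iso.
Qed.
End DualMap.

(** Combines the torsion of the dual of a complex with the isomorphism between the cone of the dual
    map and the dual of the cone. The correction terms beta and alpha in the sign of a dual complex
    are made to absorb all signs that arise. *)
Lemma tau_map_dual (C D : scomplex R) (f : chain_map C D) : contractible (cone f) ->
  tau_map (sdual J n D) (sdual J n C) (dual_map f) = k1_dag J (tau_map C D f) *~ (-1) ^+ n.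
Proof.
move=> cf; have cd := dual_map_contractible cf; have e := equiv_tots hR cf.
rewrite !tau_mapE // utor_dual_map // !k1_dagD k1_dag_sgb.
have [bC eC] := eta_sgb C; have [bD eD] := eta_sgb D.
rewrite /= !dual_etaE eC eD !k1_dag_sgb -!addrA -!sgbD !mulrzDl sgb_exp.
congr (_ + sgb R _).
rewrite !par_cone !par_dual.
rewrite /dual_cone_sign !(tots_add, psumD, lowDl, lowDr).
rewrite -dotpE !tots_pres psum_const -/(ods _) (psum_shift _ 1 (par C)).
rewrite (shift1_flip n (par D)) (flip_shift1 n (par C)) !low_flip dotp_flip !low_shift.
rewrite !ods_flip ods_shift1 !tots_flip !tots_shift e.
have h1 : psum (dual_sign n.+1) (par D) = ods (par D) (+) (odd_tri n && tots (par C)) (+) psum (alpha_deg n) (par D).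
  by rewrite -e -psum_const -!psumDF; apply: psum_ext => i; rewrite -dual_sign_alpha addbK.
have h2 : psum (fun i => dual_sign n.+1 (i + 1)) (par C) =
     ((odd_tri n (+) ~~ odd n) && tots (par C)) (+) psum (alpha_deg n) (par C).
  by rewrite -psum_const -!psumDF; apply: psum_ext => i; rewrite -(dual_sign_alpha1 n i) addbK.
have /addb_move/addb_move h3 := lowD (pshift 1 (par C)) (par D).
rewrite ods_shift1 !tots_shift e in h3.
have -> : oddz n.+1%:Z = ~~ odd n by [].
rewrite h1 h2 h3.
bool_ring.
Qed.

End DualCone.

(** * Change of orientation and homotopy invariance *)

Section SymTorsion.
Variables (R : pzRingType) (hR : invariant_rank R) (J : involution R) (n : nat).
Local Notation sg := (sg R).

Lemma tau_map_ext (C D : scomplex R) (f f' : chain_map C D) : (forall r, f' r = f r) ->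
  contractible (cone f) -> contractible (cone f') /\ tau_map C D f' = tau_map C D f.
Proof.
move=> e cf.
have h r : f' r - f r = df D (r + 1) r *m (0 : 'M_(rk D (r + 1), rk C r)) +
    (0 : 'M_(rk D r, rk C (r - 1))) *m df C r (r - 1).
  by rewrite e subrr mulmx0 mul0mx addr0.
have cf' := @htpy_contractible R C D f f' (fun p q => 0) h cf.
split=> //; exact: (@tau_map_htpy R hR C D f f' (fun p q => 0) h cf).
Qed.

(** The sign of [C] enters twice, through [C] and through its dual, and cancels. *)
Lemma tau_symE (C : scomplex R) (phi : sym_struct J n C) : contractible (cone (phi0 phi)) ->
  tau_sym C phi = utor (cone (phi0 phi)) +
    sgb R (low (par C) (par C) (+) psum (alpha_deg n) (par C) (+)
           low (par C) (pshift 1 (pflip n%:Z (par C))) (+) (ods (par C) && tots (par C))).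
Proof.
move=> cf; rewrite /tau_sym tau_mapE //= dual_etaE (addrA (eta C)) eta2 add0r par_dual.
by rewrite -addrA -sgbD tots_flip !addbA.
Qed.

(** The map - phi_0 is phi_0 followed by - 1, whose torsion is chi(C) tau(-1). *)
Lemma tau_sym_opp (C : scomplex R) (phi : sym_struct J n C) : contractible (cone (phi0 phi)) ->
  tau_sym C (sym_opp phi) = tau_sym C phi + sgb R (tots (par C)).
Proof.
move=> cf.
have kk r : (- 1%:M : 'M[R]_(rk C r)) *m - 1%:M = 1%:M by rewrite mulmxN mulNmx opprK mulmx1.
have ht r : par C r -> rk C r != 0%N by rewrite /=; case: (rk C r).
have [c1 e1] := @tau_map_iso _ hR C C (opp_map C) (fun r => - 1%:M) (par C) kk kk ht
   (fun r => tauN1 hR (rk C r)).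
have [c2 e2] := @tau_map_comp _ hR (sdual J n C) C C (phi0 phi) (opp_map C) cf c1.
have h r : phi0 (sym_opp phi) r = comp_map (phi0 phi) (opp_map C) r.
  by rewrite /= /opp_sym mulNmx mul1mx.
have [_ e3] := @tau_map_ext (sdual J n C) C _ (phi0 (sym_opp phi)) h c2.
by rewrite /tau_sym e3 e2 e1 eta2 addr0.
Qed.

Section Morphism.
Variables (C C' : scomplex R) (phi : sym_struct J n C) (phi' : sym_struct J n C').
Variables (f : chain_map C C') (sigma : hom_seq C').
Hypothesis mf : sym_morphism phi phi' f sigma.

(** The relation for sigma_0 says that it is a homotopy between phi'_0 and f phi_0 f^*. *)
Lemma morphism_htpy r :
  phi0 phi' r - comp_map (comp_map (dual_map J n f) (phi0 phi)) f r =
  df C' (r + 1) r *m sigma 0%N (n%:Z - r) (r + 1) +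
  sigma 0%N (n%:Z - (r - 1)) r *m df (dual J n C') r (r - 1).
Proof.
have := @mf 0%N (n%:Z - r) r.
rewrite /sym_diff /transp /= dag0 !(scaler0, addr0) mulmxA => -> //; last by lia.
have -> : n%:Z - r + 1 = n%:Z - (r - 1) by lia.
by rewrite /dual_df mulmx_sg.
Qed.

(** By homotopy invariance phi'_0 may be replaced by f phi_0 f^*, whose torsion is the sum of those
    of f^*, phi_0 and f. *)
Lemma tau_sym_morphism : contractible (cone (phi0 phi)) -> contractible (cone f) ->
  tau_sym C' phi' = tau_sym C phi + tau_map C C' f + k1_dag J (tau_map C C' f) *~ (-1) ^+ n.
Proof.
move=> cphi cf.
have cd := dual_map_contractible J n cf.
have [c1 e1] := @tau_map_comp _ hR (sdual J n C') (sdual J n C) C (dual_map J n f) (phi0 phi) cd cphi.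
have [c2 e2] := @tau_map_comp _ hR (sdual J n C') C C' _ f c1 cf.
rewrite /tau_sym (@tau_map_htpy _ hR (sdual J n C') C' _ (phi0 phi')
  (fun p q => sigma 0%N (n%:Z - p) q) morphism_htpy c2).
by rewrite e2 e1 (tau_map_dual hR) // -addrA addrC.
Qed.
End Morphism.
End SymTorsion.

(** * Duality *)

Lemma odd_triangle n : odd ((n * n.+1) %/ 2)%N = odd_tri n.
Proof.
rewrite /odd_tri -(odd_double_half n); set k := n./2; set b := odd n.
have e : ((b + k.*2) * (b + k.*2).+1 = if b then k.*2.+1 * k.+1 * 2 else k * k.*2.+1 * 2)%N.
  by case: b => /=; rewrite -!muln2; lia.
rewrite {}e; case: b => /=; rewrite mulnK // oddM /= odd_double /=; lia.
Qed.

(** The sign (-1)^(r(n-r)) of the identification with the double dual and the signs alpha_n of the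
    two duals combine to a constant. *)
Lemma double_dual_sign n (r : int) :
  oddz (r * (n%:Z - r)) (+) alpha_deg n r (+) alpha_deg n (n%:Z - r) = odd_tri n.
Proof.
have -> : oddz (r * (n%:Z - r)) = oddz r && (odd n (+) oddz r).
  by rewrite abszM oddM; congr (_ && _); lia.
rewrite /alpha_deg /odd_tri.
have e3 k : (n%:Z - r == n%:Z + k %[mod 4])%Z = (r == - k %[mod 4])%Z by lia.
rewrite !e3.
have [i [e1 ->] hr] := mod4_cases r; have [s [-> -> e2] hs] := nat_mod4 n.
by rewrite !e1 !e2; move: hs hr => [->|[->|[->|->]]] [->|[->|[->|->]]].
Qed.

Section DoubleDual.
Variables (R : pzRingType) (hR : invariant_rank R) (J : involution R) (n : nat).
Local Notation sg := (sg R).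
Local Notation ddual C := (dual J n (dual J n C)).

(** The sign makes the identification of a complex with its double dual a chain map. *)
Definition ddual_comp (C : complex R) r : 'M[R]_(rk C r, rk (ddual C) r) :=
  sg (r * (n%:Z - r)) *: idm C (n%:Z - (n%:Z - r)) r.

Lemma ddual_df (C : complex R) p q :
  df C p q *m ddual_comp C p = ddual_comp C q *m df (ddual C) p q.
Proof.
have [->|h] := eqVneq q (p - 1); last by rewrite !df_deg // mulmx0 mul0mx.
rewrite /ddual_comp [df (ddual C) _ _]/(dual_df J n (dual J n C) _ _) /dual_df.
rewrite [df (dual J n C) _ _]/(dual_df J n C _ _) /dual_df dag_sg dagK.
rewrite !(mulmx_sg, sg_mulmx).
rewrite (@idm_mulr _ C _ (fun q => df C q (p - 1))); last by lia.
rewrite (@idm_mull _ C _ (fun q => df C (n%:Z - (n%:Z - p)) q)); last by lia.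
rewrite !scalerA -!sgD; congr (_ *: _); apply: sgE.
rewrite (_ : (p - 1) * (n%:Z - (p - 1)) = p * (n%:Z - p) + (2 * p - n%:Z - 1)); last first.
  by rewrite mulrBl mul1r opprB addrA mulrBr mulrDr mulr1; lia.
by move: (p * _) => k; lia.
Qed.

Definition ddual_map (C : complex R) : chain_map (ddual C) C :=
  @ChainMap R (ddual C) C (ddual_comp C) (@ddual_df C).

Lemma tau_ddual (C : scomplex R) : contractible (cone (ddual_map C)) /\
  tau_map (sdual J n (sdual J n C)) C (ddual_map C) = sgb R (odd_tri n && tots (par C)).
Proof.
pose t := pres (fun r => oddz (r * (n%:Z - r))) (par C).
pose f' r : 'M[R]_(rk (ddual C) r, rk C r) := sg (r * (n%:Z - r)) *: idm C r (n%:Z - (n%:Z - r)).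
have e r : n%:Z - (n%:Z - r) = r by lia.
have k r : ddual_map C r *m f' r = 1%:M.
  by rewrite /= mulmx_sg sg_mulmx sgZZ idmK.
have k' r : f' r *m ddual_map C r = 1%:M.
  by rewrite /= mulmx_sg sg_mulmx sgZZ idmK.
have ht r : t r -> rk (ddual C) r != 0%N.
  by rewrite /= /dual_rk /= /dual_rk e => /andP[_]; case: (rk C r).
have tf r : tau (ddual_map C r) = sgb R (t r).
  rewrite [ddual_map C r]/(sg _ *: idm C _ r) (tau_sg hR); last exact: mxiso_idm (e r).
  by rewrite (tau_idm C (e r)) add0r.
have [c ->] := @tau_map_iso _ hR (sdual J n (sdual J n C)) C (ddual_map C) f' t k k' ht tf.
split=> //; rewrite /= !dual_etaE /= dual_etaE.
have [b ->] := eta_sgb C.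
rewrite -!sgbD; congr (sgb R _).
rewrite tots_pres par_dual low_flip psum_flip -psum_const.
rewrite -(psum_ext (par C) (double_dual_sign n)) !psumDF.
bool_ring.
Qed.

Lemma solve_transpose m1 m2 (A B T : 'M[R]_(m1, m2)) :
  A + sg (n.+1%:Z + 1%:Z) *: (B + sg 1%:Z *: T) = 0 -> B - T = sg (n%:Z + 1) *: A.
Proof.
rewrite (_ : sg 1%:Z = - 1) // scaleN1r => /eqP; rewrite addr_eq0 => /eqP ->.
rewrite scalerN scalerA -sgD -scaleNr -(@sgN _ 0); last by lia.
by rewrite scale1r.
Qed.

(** The composite of the dual of phi_0 with the identification of the double dual is the transpose
    T phi_0, and phi_1 is a homotopy between it and phi_0. *)
Lemma transpose_htpy (C : complex R) (phi : sym_struct J n C) r :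
  phi0 phi r - comp_map (dual_map J n (phi0 phi)) (ddual_map C) r =
  df C (r + 1) r *m (sg (n%:Z + 1) *: phi 1%N (n%:Z - r) (r + 1)) +
  (sg (n%:Z + 1) *: phi 1%N (n%:Z - (r - 1)) r) *m df (dual J n C) r (r - 1).
Proof.
have h := @sym_eq _ _ _ _ phi 1%N (n%:Z - r) r.
have {h} : sym_diff J n.+1 phi 1 (n%:Z - r) r = 0 by apply: h; lia.
rewrite /sym_diff /lower (_ : n%:Z - r + 1 = n%:Z - (r - 1)); last by lia.
have -> : comp_map (dual_map J n (phi0 phi)) (ddual_map C) r = transp J (phi 0%N) (n%:Z - r) r.
  rewrite /= /ddual_comp sg_mulmx /transp (mulrC r) /=.
  rewrite (@idm_mull _ C _ (fun q => dag J (phi 0%N q (n%:Z - r)))) //; lia.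
rewrite /= /dual_df !sg_mulmx !mulmx_sg => h; rewrite -[RHS]scalerDr.
exact: solve_transpose h.
Qed.

(** The homotopy [transpose_htpy] expresses the torsion of phi_0 by those of its dual and of the
    identification with the double dual. *)
Lemma tau_sym_dual (C : scomplex R) (phi : sym_struct J n C) : contractible (cone (phi0 phi)) ->
  tau_sym C phi = k1_dag J (tau_sym C phi) *~ (-1) ^+ n + sgb R (odd_tri n && tots (par C)).
Proof.
move=> cf; have cd := dual_map_contractible J n cf.
have [ck tk] := tau_ddual C.
have [cc tc] := @tau_map_comp _ hR (sdual J n C) (sdual J n (sdual J n C)) C _ _ cd ck.
rewrite {1}/tau_sym (@tau_map_htpy _ hR (sdual J n C) C _ (phi0 phi)
  (fun p q => sg (n%:Z + 1) *: phi 1%N (n%:Z - p) q) (transpose_htpy phi) cc).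
by rewrite tc tk (@tau_map_dual _ hR J n (sdual J n C) C (phi0 phi) cf).
Qed.
End DoubleDual.

(** * Additivity *)

Section Additivity.
Variables (R : pzRingType) (hR : invariant_rank R) (J : involution R) (n : nat).
Local Notation sg := (sg R).

Lemma size_basis p l : size (basis p l) = \sum_(r <- l) p r.
Proof.
elim: l => [|r l IH]; first by rewrite big_nil.
by rewrite basis_cons size_cat size_blk IH big_cons.
Qed.

Lemma sum_reflect (p : int -> nat) (k : int) c l : oddz k = false ->
  covers c p l -> covers c (fun r => p (k - r)) l ->
  \sum_(r <- l) p (k - r) = \sum_(r <- l) p r.
Proof.
move=> ek cl [_ _ pl']; have ul := covers_uniq cl; case: cl => _ lc pl.
pose F r := if oddz r == c then p r else 0%N.
have -> : \sum_(r <- l) p r = \sum_(r <- l) F r.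
  by apply: eq_big_seq => r /lc rc; rewrite /F rc eqxx.
have -> : \sum_(r <- l) p (k - r) = \sum_(r <- [seq k - r | r <- l]) F r.
  rewrite big_map; apply: eq_big_seq => r /lc rc; rewrite /F.
  by rewrite (_ : oddz (k - r) = c) ?eqxx // -rc; lia.
have supp r : F r != 0%N -> oddz r = c /\ p r != 0%N by rewrite /F; case: ifP => [/eqP|].
apply: sum_supported => //.
- rewrite map_inj_uniq //.
  exact: (can_inj (flipK k)).
- move=> r /supp[rc pr]; apply/mapP; exists (k - r); last by rewrite flipK.
  by apply: pl'; [rewrite -rc; lia | rewrite flipK].
by move=> r /supp[rc pr]; apply: pl.
Qed.

(** The cone of phi_0 is contractible, so its odd part and its even part have the same rank. For
    odd n the degrees r and n + 1 - r of its two summands have the same parity, so these ranks are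
    twice the ranks of C_odd and C_even. Hence C_odd and C_even have the same rank. *)
Lemma odd_poincare_tots (C : complex R) (phi : sym_struct J n C) :
  odd n -> contractible (cone (phi0 phi)) -> tots (par C) = false.
Proof.
move=> on [G cG]; pose N := (bd C + n).+2; pose X := cone (phi0 phi).
have hX r : (N < `|r|)%N -> rk X r = 0%N by move=> h; apply: rk_bd; rewrite /=; lia.
have hC r : (N < `|r|)%N -> rk C r = 0%N by move=> h; apply: rk_bd; lia.
have hD r : (N < `|r|)%N -> rk C (n.+1%:Z - r) = 0%N by move=> h; apply: rk_bd; lia.
have := mxiso_eq hR (giso_dG hR cG (covers_odl hX) (covers_evl hX)).
have en : oddz n.+1%:Z = false by rewrite /= on.
have rX r : rk X r = (rk C r + rk C (n.+1%:Z - r))%N.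
  by rewrite /= /cone_rk /= /dual_rk; congr (_ + rk C _)%N; lia.
have sX l c : covers c (rk C) l -> covers c (fun r => rk C (n.+1%:Z - r)) l ->
    size (basis (rk X) l) = (\sum_(r <- l) rk C r).*2.
  move=> c1 c2; rewrite size_basis -addnn -{2}(sum_reflect en c1 c2) -big_split.
  by apply: eq_bigr => r _; rewrite rX.
rewrite (sX _ _ (covers_evl hC) (covers_evl hD)) (sX _ _ (covers_odl hC) (covers_odl hD)).
move=> /double_inj e.
rewrite (sum_covers (covers_evl hC) (covers_odl hC)); last by move=> r /=; case: (rk C r).
by rewrite -!odd_size_basis !size_basis e addbb.
Qed.

(** The cone of a direct sum of maps is the direct sum of the cones, after an exchange of the two
    summands in the middle. *)
Section Sum.
Variables (C D : complex R) (phi : sym_struct J n C) (psi : sym_struct J n D).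
Local Notation X := (cone (phi0 phi)).
Local Notation Y := (cone (phi0 psi)).

Definition no_conn : gmap R (rk Y) (rk X) := fun p q => 0.

Lemma no_conn_deg p q : q != p - 1 -> no_conn p q = 0.
Proof. by []. Qed.

Lemma no_conn_df p q r : df X q r *m no_conn p q + no_conn q r *m df Y p q = 0.
Proof. by rewrite mulmx0 mul0mx addr0. Qed.

Local Notation E := (ext no_conn_deg no_conn_df).
Local Notation S := (cone (phi0 (sym_dsum phi psi))).

Definition sum_iso r : 'M[R]_(rk S r, rk E r) :=
  block_mx (block_mx 1%:M 0 0 0) (block_mx 0 0 1%:M 0)
           (block_mx 0 1%:M 0 0) (block_mx 0 0 0 1%:M)
    : 'M_((rk C r + rk D r) + (rk C (n%:Z - (r - 1)) + rk D (n%:Z - (r - 1))),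
          (rk C r + rk C (n%:Z - (r - 1))) + (rk D r + rk D (n%:Z - (r - 1)))).

Definition sum_iso' r : 'M[R]_(rk E r, rk S r) :=
  block_mx (block_mx 1%:M 0 0 0) (block_mx 0 0 1%:M 0)
           (block_mx 0 1%:M 0 0) (block_mx 0 0 0 1%:M)
    : 'M_((rk C r + rk C (n%:Z - (r - 1))) + (rk D r + rk D (n%:Z - (r - 1))),
          (rk C r + rk D r) + (rk C (n%:Z - (r - 1)) + rk D (n%:Z - (r - 1)))).

Lemma sum_isoK r : sum_iso r *m sum_iso' r = 1%:M.
Proof.
rewrite /sum_iso /sum_iso' !mulmx_block !(mulmx1, mul1mx, mulmx0, mul0mx, addr0, add0r).
by rewrite !add_block_mx !(addr0, add0r) !scalar_mx_block !block_mx0.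
Qed.

Lemma sum_isoK' r : sum_iso' r *m sum_iso r = 1%:M.
Proof.
rewrite /sum_iso /sum_iso' !mulmx_block !(mulmx1, mul1mx, mulmx0, mul0mx, addr0, add0r).
by rewrite !add_block_mx !(addr0, add0r) !scalar_mx_block !block_mx0.
Qed.

Lemma sum_iso_df p q : df S p q *m sum_iso p = sum_iso q *m df E p q.
Proof.
have [->|h] := eqVneq q (p - 1); last by rewrite (@df_deg _ S) // (@df_deg _ E) // mulmx0 mul0mx.
rewrite [df S _ _]/(cone_df _ _ _) [df E _ _]/(ext_df _ _ _) /cone_df /ext_df.
rewrite [df X _ _]/(cone_df _ _ _) [df Y _ _]/(cone_df _ _ _) /cone_df !idm1 !mul1mx.
rewrite [df (dsum C D) _ _]/(block_mx _ _ _ _).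
rewrite [df (dual J n (dsum C D)) _ _]/(dual_df J n _ _ _) /dual_df [df (dsum C D) _ _]/(block_mx _ _ _ _).
rewrite [phi0 (sym_dsum phi psi) _]/(block_mx _ 0 0 _).
rewrite [df (dual J n C) _ _]/(dual_df J n _ _ _) [df (dual J n D) _ _]/(dual_df J n _ _ _) /dual_df.
rewrite dag_block !dag0 !scale_block_mx !scaler0 /sum_iso /no_conn.
rewrite !mulmx_block !(mulmx1, mul1mx, mulmx0, mul0mx, addr0, add0r).
by rewrite !add_block_mx !(mulmx1, mul1mx, mulmx0, mul0mx, addr0, add0r).
Qed.

Lemma sum_contractible : contractible X -> contractible Y -> contractible S.
Proof.
move=> cX cY; apply: (@iso_contractible _ E S sum_iso sum_iso' sum_isoK sum_isoK').
  exact: sum_iso_df.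
exact: ext_contractible.
Qed.

Definition sum_sign : parity := pres (par D) (pshift 1 (pflip n%:Z (par C))).

Lemma utor_sum : contractible X -> contractible Y ->
  utor S = utor X + utor Y + sgb R (low (par X) (par Y) (+) tots sum_sign).
Proof.
move=> cX cY; have cE := ext_contractible no_conn_deg no_conn_df cX cY.
rewrite (@utor_iso _ hR E S sum_iso sum_iso' sum_isoK sum_isoK' sum_iso_df sum_sign cE).
- by rewrite (utor_ext hR) // -!addrA sgbD.
- move=> r /=; rewrite -[ext_rk _ _ _]/((rk C r + rk C (n%:Z - (r - 1))) + (rk D r + rk D (n%:Z - (r - 1))))%N.
  by case: (rk D r) => //= d _; rewrite !addnS.
by move=> r; have [_ ->] := tau_swap_mid hR (rk C r) (rk D r) (rk C (n%:Z - (r - 1))) (rk D (n%:Z - (r - 1))).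
Qed.
End Sum.

Lemma padd_sflip a b : pshift 1 (pflip n%:Z (padd a b)) =
  padd (pshift 1 (pflip n%:Z a)) (pshift 1 (pflip n%:Z b)).
Proof. exact: parityP. Qed.

(** The signs that the exchange contributes cancel those of the direct sum, up to a multiple of
    n chi(C), which vanishes by [odd_poincare_tots]. *)
Lemma tau_sym_dsum (C D : scomplex R) (phi : sym_struct J n C) (psi : sym_struct J n D) :
  contractible (cone (phi0 phi)) -> contractible (cone (phi0 psi)) ->
  tau_sym (sdsum C D) (sym_dsum phi psi) = tau_sym C phi + tau_sym D psi.
Proof.
move=> cX cY; have cS := sum_contractible cX cY.
rewrite (tau_symE (C := sdsum C D)) // !tau_symE // utor_sum //.
rewrite -[LHS]addrA [RHS]addrACA -!sgbD; congr (_ + sgb R _).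
have oC := odd_poincare_tots (phi := phi).
rewrite /sum_sign -dotpE !par_cone !par_dual par_dsum padd_sflip.
rewrite !(lowDl, lowDr, psumD, ods_add, tots_add) !low_shift !low_flip.
set c := par C in oC *; set d := par D.
have /addb_move/addb_move h := lowD d (pshift 1 (pflip n%:Z c)).
have oa : ods (pshift 1 (pflip n%:Z c)) = tots c (+) (odd n && tots c) (+) ods c.
  by rewrite ods_shift1 tots_flip ods_flip addbA.
rewrite oa tots_shift tots_flip in h.
have oC' : odd n && tots c = false by case: (boolP (odd n)) => // /oC ->.
rewrite oC' in h.
rewrite h.
bool_ring.
Qed.
End Additivity.

(** * Boundaries *)

Lemma antidiag_inverse (R : pzRingType) m1 m2 n1 n2 (X : 'M[R]_(m1, n1)) (A : 'M_(m1, n2))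
    (A' : 'M_(n2, m1)) (B : 'M_(m2, n1)) (B' : 'M_(n1, m2)) :
  A *m A' = 1%:M -> A' *m A = 1%:M -> B *m B' = 1%:M -> B' *m B = 1%:M ->
  let M := block_mx X A B 0 in let M' := block_mx 0 B' A' (- (A' *m X *m B')) in
  M *m M' = 1%:M /\ M' *m M = 1%:M.
Proof.
move=> a a' b b'; rewrite /= !mulmx_block !(mulmx0, mul0mx, addr0, add0r, mulmxN, mulNmx) !mulmxA.
rewrite a a' b b' mul1mx.
by rewrite -(mulmxA _ B' B) b' mulmx1 !addrN subr0 -!scalar_mx_block.
Qed.

Section BoundaryTorsion.
Variables (R : pzRingType) (hR : invariant_rank R) (J : involution R) (n : nat).
Variables (D : complex R) (psi : sym_struct J n.+1 D).
Local Notation sg := (sg R).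
Local Notation m := (n.+1%:Z).
Local Notation B := (bdry psi).

Definition bdry_corner r : 'M[R]_(rk D (r + 1), rk D (n%:Z - r + 1)) :=
  sg (m - r + 0%N%:Z - 1) *: transp J (psi 1%N) (n%:Z - r + 1) (r + 1).

(** The chain map phi_0 of a boundary is an isomorphism in each degree, because it is antidiagonal up
    to the corner that is given by the transpose of psi_1. *)
Definition bdry_inv r : 'M[R]_(rk (dual J n B) r, rk B r) :=
  block_mx 0 (idm D (m - r) (n%:Z - r + 1))
    (sg (r * m) *: idm D (r + 1) (m - (n%:Z - r)))
    (- (sg (r * m) *: idm D (r + 1) (m - (n%:Z - r)) *m bdry_corner r *m idm D (m - r) (n%:Z - r + 1)))
  : 'M_(rk D (n%:Z - r + 1) + rk D (m - (n%:Z - r)), rk D (r + 1) + rk D (m - r)).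

Lemma bdry_phi0E r : phi0 (bdry_sym psi) r =
  block_mx (bdry_corner r) (sg (r * m) *: idm D (m - (n%:Z - r)) (r + 1))
           (idm D (n%:Z - r + 1) (m - r)) 0.
Proof. by []. Qed.

Lemma bdry_deg1 r : n%:Z - r + 1 = m - r. Proof. lia. Qed.
Lemma bdry_deg2 r : m - (n%:Z - r) = r + 1. Proof. lia. Qed.

Lemma bdry_phi0_iso r :
  phi0 (bdry_sym psi) r *m bdry_inv r = 1%:M /\ bdry_inv r *m phi0 (bdry_sym psi) r = 1%:M.
Proof.
rewrite bdry_phi0E; apply: antidiag_inverse; rewrite ?mulmx_sg ?sg_mulmx ?sgZZ;
  by apply: idmK; rewrite ?bdry_deg1 ?bdry_deg2.
Qed.

Definition bdry_sign : parity :=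
  padd (pres (fun r => oddz (r * m)) (pshift (-1) (par D))) (pres (pshift (-1) (par D)) (pflip m (par D))).

Lemma par_bdry : par B = padd (pshift (-1) (par D)) (pflip m (par D)).
Proof. by apply: parityP => r /=; rewrite /bdry_rk oddD opprK. Qed.

Lemma odd_triS : odd_tri n.+1 = odd_tri n (+) ~~ odd n.
Proof. by rewrite /odd_tri; lia. Qed.

Lemma bdry_sign_deg i : oddz ((i + -1) * m) (+) alpha_deg n (i + -1) (+) alpha_deg n (m - i) = odd_tri n.
Proof.
rewrite -(double_dual_sign n (i + -1)) (_ : m - i = n%:Z - (i + -1)); last by lia.
congr (_ (+) _ (+) _); rewrite !abszM !oddM; case: (boolP (oddz (i + -1))) => //= e; lia.
Qed.

(** All sign terms cancel except the triangular number, as in [double_dual_sign]. *)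
Lemma tau_bdry (e : K1 R) (eP : is_sign e) :
  contractible (cone (phi0 (bdry_sym psi))) /\
  tau_sym (SComplex B e eP) (bdry_sym psi) = sgb R (odd_tri n.+1 && tots (par D)).
Proof.
have ht r : bdry_sign r -> rk (dual J n B) r != 0%N.
  rewrite /= /dual_rk /= /bdry_rk bdry_deg2 opprK.
  by case: (rk D (r + 1)) => [|k]; rewrite ?andbF // addnS.
have tf r : tau (phi0 (bdry_sym psi) r) = sgb R (bdry_sign r).
  rewrite bdry_phi0E.
  have i2 := mxiso_idm D (bdry_deg1 r); have i1' := mxiso_idm D (bdry_deg2 r).
  have i1 : mxiso (sg (r * m) *: idm D (m - (n%:Z - r)) (r + 1)) by apply: mxiso_sg.
  have [_ ->] := tau_antidiag hR (bdry_corner r) i1 i2.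
  rewrite (tau_sg hR) // !tau_idm ?bdry_deg1 ?bdry_deg2 // add0r addr0 -sgbD /=.
  by rewrite opprK.
have [c t] := @tau_map_iso _ hR (sdual J n (SComplex B e eP)) (SComplex B e eP)
  (phi0 (bdry_sym psi)) bdry_inv bdry_sign (fun r => (bdry_phi0_iso r).1) (fun r => (bdry_phi0_iso r).2) ht tf.
split=> //; rewrite /tau_sym t /= dual_etaE (addrA e) (eta2 (SComplex B e eP)) add0r -sgbD.
congr (sgb R _).
rewrite [par (SComplex _ _ _)]par_bdry /bdry_sign tots_add -dotpE tots_pres.
set a := par D; rewrite !(lowDl, lowDr, psumD) low_shift low_flip.
have /addb_move/addb_move h := lowD (pshift (-1) a) (pflip m a).
have os : ods (pshift (-1) a) = tots a (+) ods a.
  by rewrite -evs_tots /ods psum_shift; apply: psum_ext => i; lia.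
rewrite os ods_flip tots_shift tots_flip in h.
rewrite h !psum_shift psum_flip odd_triS (andb_addl (odd_tri n)) -(psum_const (odd_tri n)).
rewrite -(psum_ext a bdry_sign_deg) !psumDF.
have -> : oddz m = ~~ odd n by [].
move: (psum _ _) (psum _ _) (psum _ _) (dotp _ _) (low a a) (low _ _) (ods a) (tots a) (odd n).
clear; move=> *; bool_ring.
Qed.
End BoundaryTorsion.

(** * Properties of the absolute torsion *)

Lemma eps_chi (R : pzRingType) (C : complex R) k : eps R (chi C) (chi C) *+ k = sgb R (odd k && tots (par C)).
Proof.
rewrite epsE odd_chi andbb; elim: k => [|k IH]; first by rewrite mulr0n.
by rewrite mulrS IH -sgbD /=; congr (sgb R _); case: (odd k); case: tots.
Qed.

Theorem proposition26 (R : pzRingType) (J : involution R)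
    (hR : invariant_rank R) (n : nat) (C C' : scomplex R)
    (phi : sym_struct J n C) (phi' : sym_struct J n C')
    (dimC : dimensional n C) (dimC' : dimensional n C')
    (pdC : poincare phi) (pdC' : poincare phi') :
  (* (1) additivity *)
  (tau_sym (sdsum C C') (sym_dsum phi phi') = tau_sym C phi + tau_sym C' phi') /\
  (* (2) duality *)
  (tau_sym C phi =
    k1_dag J (tau_sym C phi) *~ (-1) ^+ n
    + eps R (chi C) (chi C) *+ ((n * n.+1) %/ 2)) /\
  (* (3) homotopy invariance *)
  (forall (f : chain_map C C') (sigma : hom_seq C'),
    sym_morphism phi phi' f sigma -> chain_equivalence f ->
    tau_sym C' phi' =
      tau_sym C phi + tau_map C C' f + k1_dag J (tau_map C C' f) *~ (-1) ^+ n) /\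
  (* (4) cobordism invariance *)
  (forall (D : scomplex R) (psi : sym_struct J n.+1 D),
    dimensional n.+1 D -> connected psi ->
    forall (eta_bd : K1 R) (eta_bdP : is_sign eta_bd)
      (f : chain_map C (bdry psi)) (sigma : hom_seq (bdry psi)),
    sym_morphism phi (bdry_sym psi) f sigma -> chain_equivalence f ->
    let t := tau_map C (SComplex (bdry psi) eta_bd eta_bdP) f in
    tau_sym C phi =
      k1_dag J t *~ (-1) ^+ n.+1 - t
      + eps R (chi D) (chi D) *+ ((n.+1 * n.+2) %/ 2)) /\
  (* (5) orientation change *)
  (tau_sym C (sym_opp phi) = tau_sym C phi + eps R (chi C) (chi C)) /\
  (* (6) independence of the choice of sign *)
  (forall (eta' : K1 R) (eta'P : is_sign eta'),
    tau_sym (SComplex C eta' eta'P) phi = tau_sym C phi).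
Proof.
have cC := equiv_contractible pdC; have cC' := equiv_contractible pdC'.
split; first exact: tau_sym_dsum.
split; first by rewrite eps_chi odd_triangle; apply: tau_sym_dual.
split; first by move=> f sigma mf ef; apply: (tau_sym_morphism hR mf) => //; apply: equiv_contractible.
split.
  move=> D psi _ _ e eP f sigma mf ef t.
  have [cB tB] := tau_bdry hR psi eP.
  have := @tau_sym_morphism _ hR J n C (SComplex (bdry psi) e eP) phi (bdry_sym psi) f sigma mf cC
    (equiv_contractible ef).
  rewrite tB -/t eps_chi odd_triangle => ->.
  by rewrite exprS mulN1r mulrNz -opprD -addrA (addrC t) [RHS]addrC addrK.
split.
  by rewrite tau_sym_opp // -[eps _ _ _]mulr1n eps_chi.
by move=> e eP; rewrite !tau_symE.
Qed.
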